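(* Let $0<q<1$, $0<a<\infty$, let $p,r:[0,a]\to\mathbb{R}$ be continuous at zero with $p,r\in L_q^1(0,a)$, and let $k_{ij}$ ($i,j=1,2$) be real numbers. Consider the boundary value problem $$-\tfrac1q D_{q^{-1}}y_2(x)+p(x)y_1(x)=\lambda y_1(x),\qquad D_q y_1(x)+r(x)y_2(x)=\lambda y_2(x),\qquad 0\le x\le a,$$ $$k_{11}y_1(0)+k_{12}y_2(0)=0,\qquad k_{21}y_1(a)+k_{22}y_2(aq^{-1})=0,$$ with complex eigenvalue parameter $\lambda$. The eigenvalues $\{\lambda_m\}$ of this problem, which are the zeros of $\Delta(\lambda)=k_{21}\phi_1(a,\lambda)+k_{22}\phi_2(aq^{-1},\lambda)$, where $\phi=(\phi_1,\phi_2)^T$ is the solution of the system with $\phi_1(0,\lambda)=k_{12}$, $\phi_2(0,\lambda)=-k_{11}$, have the following asymptotic relations as $m\to\infty$. Case 1: $k_{12}\ne0$, $k_{11}=0$. (i) If $k_{21}=0$, then $\lambda_m=\dfrac{q^{-m+1/2}}{a(1-q)}\bigl(1+O(q^{m/2})\bigr)$. (ii) If $k_{22}=0$, then $\lambda_m=\dfrac{q^{-m+1/2}}{a(1-q)}\bigl(1+O(q^{m})\bigr)$. Case 2: $k_{12}=0$, $k_{11}\neq0$. (i) If $k_{21}=0$, then $\lambda_m=\dfrac{q^{-m+1}}{a(1-q)}\bigl(1+O(q^{m/2})\bigr)$. (ii) If $k_{22}=0$, then $\lambda_m=\dfrac{q^{-m}}{a(1-q)}\bigl(1+O(q^{m}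)\bigr)$.
   Context: The $q$-difference operator is $D_qf(x)=\frac{f(x)-f(qx)}{x(1-q)}$ for $x\neq0$, and $D_qf(0)=\lim_{n\to\infty}\frac{f(xq^n)-f(0)}{xq^n}$ if the limit exists and does not depend on $x$. Also $D_{q^{-1}}f(x)=\frac{f(x)-f(q^{-1}x)}{x(1-q^{-1})}$ for $x\ne0$ and $D_{q^{-1}}f(0)=D_qf(0)$; thus $D_{q^{-1}}f(x)=(D_qf)(xq^{-1})$. The Jackson integral is $\int_0^x f(t)\,d_qt=x(1-q)\sum_{n\ge0}q^nf(xq^n)$ when the series converges. $L_q^1(0,a)$ is the space of functions $f$ with $\int_0^a|f(t)|\,d_qt<\infty$. A function $f$ is $q$-regular at zero if $\lim_{n\to\infty}f(xq^n)=f(0)$ for all $x$ in its domain; all functions considered (in particular the components of solutions) are $q$-regular at zero. The second component $y_2$ of a solution is understood to be defined on $[0,aq^{-1}]$ so that the expressions make sense. The solution of the system with prescribed values of $y_1(0),y_2(0)$ exists and is unique (known). An eigenvalue is a $\lambda\in\mathbb{C}$ for which there is a nontrivial solution $y=(y_1,y_2)^T$ of the system satisfying both boundary conditions.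
   Formalization: Formally, k21 and k22 are not both zero (else every λ is an eigenvalue), and, as there are infinitely many negative eigenvalues too, all but finitely many eigenvalues form two sequences, one with the stated relation and one with its negative. *)

(* Defs.v *)
From Stdlib Require Import Reals List.
From Coquelicot Require Import Coquelicot.
Open Scope R_scope.

(* Functions on an interval [0,b] are total functions on R of which only the
   values on [0,b] are ever constrained. *)

Definition continuous_at_zero (b : R) (f : R -> R) : Prop :=
  filterlim f (within (fun x => 0 <= x <= b) (locally 0)) (locally (f 0)).

Definition is_Jackson_integral (q : R) (f : R -> R) (x v : R) : Prop :=
  is_series (fun n => x * (1 - q) * (q ^ n * f (x * q ^ n))) v.

Definition in_Lq1 (q a : R) (f : R -> R) : Prop :=
  exists v, is_Jackson_integral q (fun t => Rabs (f t)) a v.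

Definition q_regular_at_zero (q b : R) (f : R -> C) : Prop :=
  forall x, 0 <= x <= b ->
    filterlim (fun n => f (x * q ^ n)) eventually (locally (f 0)).

(* [is_Dq q b f x d]: the q-derivative at [x] of [f], a function on [0,b],
   exists and equals [d]. *)
Definition is_Dq (q b : R) (f : R -> C) (x : R) (d : C) : Prop :=
  (x <> 0 -> d = ((f x - f (q * x)%R) / RtoC (x * (1 - q)))%C) /\
  (x = 0 -> forall t, 0 < t <= b ->
     filterlim (fun n => ((f (t * q ^ n)%R - f 0) / RtoC (t * q ^ n)%R)%C)
       eventually (locally d)).

Definition is_Dqinv (q b : R) (f : R -> C) (x : R) (d : C) : Prop :=
  (x <> 0 -> d = ((f x - f (/ q * x)%R) / RtoC (x * (1 - / q)))%C) /\
  (x = 0 -> is_Dq q b f 0 d).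

Definition is_solution (q a : R) (p r : R -> R) (lam : C) (y1 y2 : R -> C)
    : Prop :=
  q_regular_at_zero q a y1 /\
  q_regular_at_zero q (a * / q) y2 /\
  forall x, 0 <= x <= a ->
    exists d1 d2 : C,
      is_Dq q a y1 x d1 /\
      is_Dqinv q (a * / q) y2 x d2 /\
      (- RtoC (1 / q) * d2 + RtoC (p x) * y1 x = lam * y1 x)%C /\
      (d1 + RtoC (r x) * y2 x = lam * y2 x)%C.

Definition nontrivial (q a : R) (y1 y2 : R -> C) : Prop :=
  (exists x, 0 <= x <= a /\ y1 x <> RtoC 0) \/
  (exists x, 0 <= x <= a * / q /\ y2 x <> RtoC 0).

Definition is_eigenvalue (q a : R) (p r : R -> R) (k11 k12 k21 k22 : R)
    (lam : C) : Prop :=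
  exists y1 y2 : R -> C,
    is_solution q a p r lam y1 y2 /\
    nontrivial q a y1 y2 /\
    (RtoC k11 * y1 0 + RtoC k12 * y2 0 = RtoC 0)%C /\
    (RtoC k21 * y1 a + RtoC k22 * y2 (a * / q)%R = RtoC 0)%C.

Definition is_phi (q a : R) (p r : R -> R) (k11 k12 : R)
    (phi1 phi2 : R -> C -> C) : Prop :=
  forall lam : C,
    is_solution q a p r lam (fun x => phi1 x lam) (fun x => phi2 x lam) /\
    phi1 0 lam = RtoC k12 /\
    phi2 0 lam = RtoC (- k11).

Definition Delta_char (q a k21 k22 : R) (phi1 phi2 : R -> C -> C) (lam : C) : C :=
  (RtoC k21 * phi1 a lam + RtoC k22 * phi2 (a * / q)%R lam)%C.

(* lam_m = mu_m (1 + O(eps_m)) as m -> oo *)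
Definition rel_asymp (lam : nat -> C) (mu eps : nat -> R) : Prop :=
  exists (K : R) (N : nat), forall m : nat, (N <= m)%nat ->
    exists theta : C,
      lam m = (RtoC (mu m) * (RtoC 1 + theta))%C /\ Cmod theta <= K * eps m.

(* The spectrum is unbounded in both directions: already for p = r = 0 it is
   symmetric about 0.  Hence an asymptotic relation for "the eigenvalues" is
   read as follows: up to finitely many exceptions they form two sequences,
   one asymptotic to mu_m and one to - mu_m.  The sequences start at some rank
   N because the finitely many exceptions can shift any numbering that starts
   from the smallest eigenvalues, whereas mu_m fixes the number m. *)
Definition eigenvalues_asymp (E : C -> Prop) (mu eps : nat -> R) : Prop :=
  exists (lam_pos lam_neg : nat -> C) (N : nat) (exceptions : list C),
    (forall m : nat, (N <= m)%nat -> E (lam_pos m) /\ E (lam_neg m)) /\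
    (forall z : C, E z ->
       In z exceptions \/
       exists m : nat, (N <= m)%nat /\ (z = lam_pos m \/ z = lam_neg m)) /\
    rel_asymp lam_pos mu eps /\
    rel_asymp lam_neg (fun m => - mu m) eps.

(* Main.v *)
Require Import Defs.
From Stdlib Require Import Reals List Lra Lia Psatz ZArith Classical IndefiniteDescription.
From Coquelicot Require Import Coquelicot.
Open Scope R_scope.

(** The two components of a solution, sampled on the lattice x q^n and taken
    alternately with suitable signs and weights, form one sequence Y with
      Y_j = b Q^j (lam - s_j) Y_(j+1) - Y_(j+2),
    where q = P^4, Q = P^2, and s collects the values of p and r on the lattice,
    which are bounded since p and r are continuous at zero ([interlace_csol]).
    As Q^j is summable, such sequences behave at infinity like
    c0, c1, -c0, -c1, c0, and so on; they are determined by c0, c1, which encode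
    the values of the solution at zero, and every c0, c1 occurs.  This gives
    existence and uniqueness for the system, hence the description of the
    eigenvalues as zeros of Delta.  In the four cases of the asymptotics the
    boundary conditions prescribe, up to a factor, the limit pattern
    chi (j + tau), with chi = 1, 0, -1, 0 periodically, and require Y_0 = 0 or
    Y_1 = 0; after dropping the first term in the second case, one studies the
    zeros in lam of Y_0.

    These zeros are real, because Im (Y_j conj Y_(j+1)) is monotone in j and tends
    to zero ([zeros_are_real]).  Reflecting lam and s reduces negative zeros to
    positive ones.

    For s = 0 the solution is an explicit power series.  Scale lam by
    lam b = w P^(1-2N).  After normalization the series for Y_0 is close to a theta
    series in w, and for N + tau odd it is
    antisymmetric under w -> 1/w.  The q-binomial theorem turns that theta series
    into (w - 1/w) times a product bounded below for Q <= w <= 1/Q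
    ([theta_estimate]).

    With s, the part of the recurrence where b Q^j lam is large is hyperbolic:
    there Y_0 = 0 amounts to one ratio Y_J / Y_(J+1) = t_J, with t_J a continued
    fraction that forgets perturbations.  The remaining part has bounded
    coefficients.  Both parts depend on s only at relative order 1/lam, so a
    positive multiple of Y_0, up to a fixed sign, is still a positive factor times
    (w - 1/w), with an error O(Q^N) ([window_estimate]).  Hence all
    zeros in the window satisfy w = 1 + O(Q^N), and the intermediate value theorem
    gives at least one.  There is only one, because a Casoratian identity keeps two
    zeros in the same window at a definite distance ([zeros_separated]).  The
    windows for successive N of the right parity cover all large lam, and the same
    separation shows that only finitely many zeros are left out. *)

(** * Discrete Gronwall inequalities *)

Lemma pow_in_unit (Q : R) (hQ : 0 < Q < 1) (n : nat) : 0 < Q ^ n <= 1.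
Proof.
  split; [apply pow_lt; lra|].
  rewrite <- (pow1 n). apply pow_incr; lra.
Qed.

Lemma exp_le (x y : R) : x <= y -> exp x <= exp y.
Proof.
  intros [h|h]; [left; apply exp_increasing; exact h | rewrite h; lra].
Qed.

Lemma gronwall_partial (Q g e : R) (A : nat -> R) (hQ : 0 < Q < 1)
  (hg : 0 <= g) (he : 0 <= e) (hA : forall j, 0 <= A j)
  (hrec : forall j, A j <= (1 + g * Q ^ j) * A (S j) + e * Q ^ j) :
  forall k j, A j <= exp (g * (Q ^ j - Q ^ (j + k)) / (1 - Q)) *
                     (A (j + k)%nat + e * (Q ^ j - Q ^ (j + k)) / (1 - Q)).
Proof.
  intros k. induction k as [|k IH]; intros j.
  - rewrite Nat.add_0_r. replace (g * (Q ^ j - Q ^ j) / (1 - Q)) with 0 by (field; lra).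
    rewrite exp_0. right. field; lra.
  - specialize (IH (S j)). replace (S j + k)%nat with (j + S k)%nat in IH by lia.
    destruct (pow_in_unit Q hQ j) as [p0 _].
    set (E := exp (g * (Q ^ S j - Q ^ (j + S k)) / (1 - Q))) in IH.
    set (X := A (j + S k)%nat + e * (Q ^ S j - Q ^ (j + S k)) / (1 - Q)) in IH.
    assert (hE : exp (g * (Q ^ j - Q ^ (j + S k)) / (1 - Q)) = exp (g * Q ^ j) * E).
    { unfold E. rewrite <- exp_plus. f_equal. simpl (Q ^ S j). field; lra. }
    rewrite hE.
    replace (A (j + S k)%nat + e * (Q ^ j - Q ^ (j + S k)) / (1 - Q))
      with (X + e * Q ^ j) by (unfold X; simpl (Q ^ S j); field; lra).
    assert (h1 : 1 + g * Q ^ j <= exp (g * Q ^ j)) by apply exp_ineq1_le.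
    assert (hle : Q ^ (j + S k) <= Q ^ S j).
    { replace (j + S k)%nat with (S j + k)%nat by lia. rewrite pow_add.
      destruct (pow_in_unit Q hQ k). assert (0 < Q ^ S j) by (apply pow_lt; lra). nra. }
    assert (hE1 : 1 <= E).
    { unfold E. rewrite <- exp_0 at 1. apply exp_le.
      apply Rdiv_le_0_compat; [apply Rmult_le_pos; lra|lra]. }
    assert (hgq : 0 <= g * Q ^ j) by (apply Rmult_le_pos; lra).
    assert (heq : 0 <= e * Q ^ j) by (apply Rmult_le_pos; lra).
    set (F := exp (g * Q ^ j)) in *.
    assert (0 <= E * X) by (eapply Rle_trans; [apply (hA (S j))|exact IH]).
    assert (1 <= F * E) by nra.
    apply Rle_trans with (F * (E * X) + e * Q ^ j); [|nra].
    eapply Rle_trans; [apply hrec|].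
    apply Rplus_le_compat_r.
    apply Rmult_le_compat; [lra|apply hA|exact h1|exact IH].
Qed.

(** The recurrences below are controlled from infinity, so the bound is by the limit
    of [A] there; the factors (1 + g Q^i) multiply to at most exp (g / (1 - Q)). *)
Lemma gronwall (Q g e L : R) (A : nat -> R) (hQ : 0 < Q < 1)
  (hg : 0 <= g) (he : 0 <= e) (hA : forall j, 0 <= A j)
  (hrec : forall j, A j <= (1 + g * Q ^ j) * A (S j) + e * Q ^ j)
  (hlim : is_lim_seq A L) :
  forall j, A j <= exp (g / (1 - Q)) * (L + e * Q ^ j / (1 - Q)).
Proof.
  intros j.
  assert (hL : is_lim_seq (fun k => exp (g / (1 - Q)) * (A (k + j)%nat + e * Q ^ j / (1 - Q)))
                (exp (g / (1 - Q)) * (L + e * Q ^ j / (1 - Q)))).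
  { apply (is_lim_seq_scal_l _ (exp (g / (1 - Q))) (L + e * Q ^ j / (1 - Q))).
    apply is_lim_seq_plus'; [|apply is_lim_seq_const].
    apply (is_lim_seq_incr_n A j). exact hlim. }
  refine (is_lim_seq_le (fun _ => A j) _ (A j) _ _ (is_lim_seq_const _) hL).
  intros k. simpl.
  eapply Rle_trans; [apply (gronwall_partial Q g e A hQ hg he hA hrec k j)|].
  rewrite (Nat.add_comm k j).
  destruct (pow_in_unit Q hQ j), (pow_in_unit Q hQ (j + k)).
  apply Rmult_le_compat.
  - left; apply exp_pos.
  - apply Rplus_le_le_0_compat; [apply hA|].
    apply Rdiv_le_0_compat; [apply Rmult_le_pos; [lra|]|lra].
    rewrite pow_add. destruct (pow_in_unit Q hQ k). nra.
  - apply exp_le. apply Rmult_le_compat_r; [left; apply Rinv_0_lt_compat; lra|nra].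
  - apply Rplus_le_compat_l. apply Rmult_le_compat_r; [left; apply Rinv_0_lt_compat; lra|nra].
Qed.

(** Read in the other direction: a sequence with a nonzero limit cannot start too
    small. *)
Lemma gronwall_forward (Q g L : R) (A : nat -> R) (hQ : 0 < Q < 1)
  (hg : 0 <= g) (hA : forall j, 0 <= A j)
  (hrec : forall j, A (S j) <= (1 + g * Q ^ j) * A j)
  (hlim : is_lim_seq A L) :
  L <= exp (g / (1 - Q)) * A 0%nat.
Proof.
  assert (h : forall k, A k <= exp (g * (1 - Q ^ k) / (1 - Q)) * A 0%nat).
  { intros k. induction k as [|k IH].
    - simpl. replace (g * (1 - 1) / (1 - Q)) with 0 by (field; lra). rewrite exp_0. lra.
    - replace (g * (1 - Q ^ S k) / (1 - Q)) with (g * Q ^ k + g * (1 - Q ^ k) / (1 - Q))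
        by (simpl; field; lra).
      rewrite exp_plus, Rmult_assoc.
      destruct (pow_in_unit Q hQ k).
      eapply Rle_trans; [apply hrec|].
      apply Rmult_le_compat; [|apply hA|apply exp_ineq1_le|exact IH].
      assert (0 <= g * Q ^ k) by (apply Rmult_le_pos; lra). lra. }
  refine (is_lim_seq_le A (fun _ => exp (g / (1 - Q)) * A 0%nat) L _ _ hlim (is_lim_seq_const _)).
  intros k. eapply Rle_trans; [apply h|].
  apply Rmult_le_compat_r; [apply hA|].
  destruct (pow_in_unit Q hQ k).
  apply exp_le. apply Rmult_le_compat_r; [left; apply Rinv_0_lt_compat; lra|nra].
Qed.

(** * Finite products and the q-binomial theorem *)

(** This is cos (n pi / 2): a solution of Y_j = g_j Y_(j+1) - Y_(j+2) with g small
    changes sign every second step. *)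
Fixpoint chi (n : nat) : R :=
  match n with
  | 0%nat => 1
  | 1%nat => 0
  | S (S n') => - chi n'
  end.

Lemma chi_SS (n : nat) : chi (S (S n)) = - chi n.
Proof. reflexivity. Qed.

Lemma chi_double (j m : nat) : chi (2 * j + m) = (-1) ^ j * chi m.
Proof.
  induction j as [|j IH]; [simpl; ring|].
  replace (2 * S j + m)%nat with (S (S (2 * j + m))) by lia.
  rewrite chi_SS, IH. simpl. ring.
Qed.

Lemma chi_odd (n : nat) : Nat.odd n = true -> chi n = 0.
Proof.
  intros h. apply Nat.odd_spec in h. destruct h as [k ->].
  rewrite chi_double. simpl. ring.
Qed.

Lemma chi_even (n : nat) : Nat.odd n = false -> chi n = 1 \/ chi n = -1.
Proof.
  intros h. rewrite <- Nat.negb_even in h. apply Bool.negb_false_iff in h.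
  apply Nat.even_spec in h. destruct h as [k ->].
  rewrite <- (Nat.add_0_r (2 * k)), chi_double. simpl (chi 0).
  rewrite Rmult_1_r. induction k as [|k IH]; [left; reflexivity|].
  simpl. destruct IH as [-> | ->]; [right|left]; ring.
Qed.

Lemma chi_abs_le (n : nat) : Rabs (chi n) <= 1.
Proof.
  destruct (Nat.odd n) eqn:h.
  - rewrite chi_odd, Rabs_R0 by exact h. lra.
  - destruct (chi_even n h) as [-> | ->]; [rewrite Rabs_R1|rewrite Rabs_left]; lra.
Qed.

Lemma chi_abs_consecutive (n : nat) : Rabs (chi n) + Rabs (chi (S n)) = 1.
Proof.
  destruct (Nat.odd n) eqn:h.
  - rewrite chi_odd, Rabs_R0 by exact h.
    assert (h' : Nat.odd (S n) = false).
    { rewrite Nat.odd_succ, <- Nat.negb_odd, h. reflexivity. }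
    destruct (chi_even _ h') as [-> | ->]; [rewrite Rabs_R1|rewrite Rabs_left]; lra.
  - assert (h' : Nat.odd (S n) = true).
    { rewrite Nat.odd_succ, <- Nat.negb_odd, h. reflexivity. }
    rewrite (chi_odd (S n) h'), Rabs_R0.
    destruct (chi_even _ h) as [-> | ->]; [rewrite Rabs_R1|rewrite Rabs_left]; lra.
Qed.

Fixpoint rprod (f : nat -> R) (n : nat) : R :=
  match n with
  | 0%nat => 1
  | S n' => rprod f n' * f n'
  end.

(** The q-Pochhammer symbol (q; q)_n. *)
Definition poch (q : R) (n : nat) : R := rprod (fun i => 1 - q ^ S i) n.

Lemma poch_S (q : R) (n : nat) : poch q (S n) = poch q n * (1 - q ^ S n).
Proof. reflexivity. Qed.

Lemma pow_S_lt_1 (q : R) (hq : 0 < q < 1) (n : nat) : 0 < q ^ S n < 1.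
Proof.
  destruct (pow_in_unit q hq n). simpl. nra.
Qed.

Lemma poch_pos (q : R) (hq : 0 < q < 1) (n : nat) : 0 < poch q n <= 1.
Proof.
  induction n as [|n IH]; [unfold poch; simpl; lra|].
  rewrite poch_S. pose proof (pow_S_lt_1 q hq n). nra.
Qed.

Lemma poch_tail (q : R) (hq : 0 < q < 1) (j k : nat) :
  poch q j * (1 - q ^ j * (1 - q ^ k) / (1 - q)) <= poch q (j + k) <= poch q j.
Proof.
  induction k as [|k IH].
  - rewrite Nat.add_0_r. simpl. replace (q ^ j * (1 - 1) / (1 - q)) with 0 by (field; lra). lra.
  - replace (j + S k)%nat with (S (j + k)) by lia. rewrite poch_S.
    pose proof (pow_S_lt_1 q hq (j + k)) as h1.
    pose proof (poch_pos q hq (j + k)). pose proof (poch_pos q hq j) as hj.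
    destruct (pow_in_unit q hq k), (pow_in_unit q hq j).
    split; [|nra].
    assert (hx : q ^ S (j + k) = q * (q ^ j * q ^ k)) by (simpl; rewrite pow_add; ring).
    rewrite hx in *.
    replace (1 - q ^ j * (1 - q ^ S k) / (1 - q)) with
      ((1 - q ^ j * (1 - q ^ k) / (1 - q)) - q ^ j * q ^ k) by (simpl; field; lra).
    set (b := q ^ j * q ^ k) in *.
    assert (hb : 0 < b) by (unfold b; apply Rmult_lt_0_compat; lra).
    destruct IH as [IH1 IH2].
    assert (q * poch q (j + k) * b <= poch q j * b).
    { apply Rmult_le_compat_r; [lra|nra]. }
    lra.
Qed.

Lemma poch_ratio_bound (q : R) (hq : 0 < q < 1) (j D : nat) : (j <= D)%nat ->
  0 <= 1 - poch q D / poch q j <= q ^ j / (1 - q).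
Proof.
  intros h. replace D with (j + (D - j))%nat by lia.
  destruct (poch_tail q hq j (D - j)) as [h1 h2].
  destruct (poch_pos q hq j), (pow_in_unit q hq j), (pow_in_unit q hq (D - j)).
  set (p := poch q (j + (D - j))) in *.
  replace p with (poch q j * (p / poch q j)) in h1, h2 by (field; lra).
  split; [nra|].
  assert (q ^ j * (1 - q ^ (D - j)) / (1 - q) <= q ^ j / (1 - q)).
  { apply Rmult_le_compat_r; [left; apply Rinv_0_lt_compat; lra|nra]. }
  nra.
Qed.

Lemma pow_small (q : R) (hq : 0 < q < 1) (e : R) : 0 < e ->
  exists N : nat, forall n : nat, (N <= n)%nat -> q ^ n < e.
Proof.
  intros he.
  destruct (pow_lt_1_zero q (ltac:(rewrite Rabs_right; lra)) e he) as [N hN].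
  exists N. intros n hn. specialize (hN n hn).
  rewrite Rabs_right in hN; [exact hN|].
  apply Rle_ge, pow_le; lra.
Qed.

Lemma poch_lower (q : R) (hq : 0 < q < 1) :
  exists c, 0 < c /\ forall n, c <= poch q n.
Proof.
  destruct (pow_small q hq ((1 - q) / 2) ltac:(lra)) as [J hJ].
  exists (poch q J / 2). pose proof (poch_pos q hq J). split; [lra|].
  intros n. destruct (Nat.le_gt_cases J n) as [h|h].
  - pose proof (poch_ratio_bound q hq J n h) as [_ hb].
    pose proof (hJ J (Nat.le_refl _)).
    assert (q ^ J / (1 - q) <= 1 / 2).
    { apply (Rmult_le_reg_r (1 - q)); [lra|]. unfold Rdiv.
      rewrite Rmult_assoc, Rinv_l; lra. }
    replace (poch q n) with (poch q J * (poch q n / poch q J)) by (field; lra). nra.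
  - pose proof (poch_tail q hq n (J - n)) as [_ hb].
    replace (n + (J - n))%nat with J in hb by lia. lra.
Qed.

(** The Gaussian binomial coefficient, by the Pascal rule adapted to multiplying
    the product of [q_binomial] by its next factor. *)
Fixpoint qbin (r : R) (D j : nat) : R :=
  match D, j with
  | _, 0%nat => 1
  | 0%nat, S _ => 0
  | S D', S j' => qbin r D' (S j') + r ^ (D' - j') * qbin r D' j'
  end.

Lemma qbin_0 (r : R) (D : nat) : qbin r D 0 = 1.
Proof. destruct D; reflexivity. Qed.

Lemma qbin_out (r : R) (D : nat) : forall j, (D < j)%nat -> qbin r D j = 0.
Proof.
  induction D as [|D IH]; intros [|j] h; try lia; [reflexivity|].
  simpl. rewrite !IH by lia. ring.
Qed.

Lemma qbin_poch (r : R) (D : nat) : forall j, (j <= D)%nat ->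
  qbin r D j * (poch r j * poch r (D - j)) = poch r D.
Proof.
  induction D as [|D IH]; intros [|j] h; try lia.
  - unfold poch; simpl; ring.
  - rewrite qbin_0, Nat.sub_0_r. change (poch r 0) with 1. ring.
  - simpl (qbin r (S D) (S j)). simpl (S D - S j)%nat.
    rewrite !poch_S. destruct (Nat.eq_dec j D) as [->|hne].
    + rewrite qbin_out by lia. specialize (IH D (Nat.le_refl _)).
      rewrite Nat.sub_diag in *. rewrite <- IH at 2.
      change (r ^ 0) with 1. ring.
    + pose proof (IH (S j) ltac:(lia)) as h1. pose proof (IH j ltac:(lia)) as h2.
      rewrite poch_S in h1.
      replace (D - j)%nat with (S (D - S j)) in * by lia.
      rewrite poch_S in *.
      assert (hp : r ^ S (D - S j) * r ^ S j = r ^ S D).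
      { rewrite <- pow_add. f_equal. lia. }
      rewrite <- hp.
      set (A := qbin r D (S j)) in *. set (B := qbin r D j) in *.
      set (u := r ^ S (D - S j)) in *. set (v := r ^ S j) in *.
      transitivity ((1 - u) * (A * (poch r j * (1 - v) * poch r (D - S j))) +
                    u * (1 - v) * (B * (poch r j * (poch r (D - S j) * (1 - u))))); [ring|].
      rewrite h1, h2. ring.
Qed.

Lemma sum_f_R0_shift (f : nat -> R) (n : nat) :
  sum_f_R0 f (S n) = f 0%nat + sum_f_R0 (fun j => f (S j)) n.
Proof.
  induction n as [|n IH]; [reflexivity|].
  rewrite (tech5 f (S n)), IH, (tech5 (fun j => f (S j)) n). ring.
Qed.

(** The step from [D] to [D + 1] multiplies by 1 - y r^D, which is the Pascal rule
    coefficient by coefficient. *)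
Lemma q_binomial (r y : R) (D : nat) :
  rprod (fun i => 1 - y * r ^ i) D =
  sum_f_R0 (fun j => qbin r D j * rprod (fun i => - (y * r ^ i)) j) D.
Proof.
  induction D as [|D IH]; [simpl; ring|].
  set (E := rprod (fun i => - (y * r ^ i))) in *.
  rewrite sum_f_R0_shift, qbin_0.
  transitivity (1 + (sum_f_R0 (fun j => qbin r D (S j) * E (S j)) D
                 - y * r ^ D * sum_f_R0 (fun j => qbin r D j * E j) D)).
  - assert (h : sum_f_R0 (fun j => qbin r D j * E j) D =
                1 + sum_f_R0 (fun j => qbin r D (S j) * E (S j)) D).
    { assert (h := sum_f_R0_shift (fun j => qbin r D j * E j) D).
      rewrite tech5, qbin_out, qbin_0 in h by lia.
      change (E 0%nat) with 1 in h. lra. }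
    simpl (rprod _ (S D)). rewrite IH, h. ring.
  - change (E 0%nat) with 1. rewrite Rmult_1_l.
    f_equal. rewrite scal_sum, <- minus_sum. apply sum_eq. intros j hj.
    simpl (qbin r (S D) (S j)).
    change (E (S j)) with (E j * - (y * r ^ j)).
    replace (r ^ D) with (r ^ (D - j) * r ^ j) by (rewrite <- pow_add; f_equal; lia).
    ring.
Qed.

Lemma rprod_shift (f : nat -> R) (n : nat) :
  rprod f (S n) = f 0%nat * rprod (fun i => f (S i)) n.
Proof.
  induction n as [|n IH]; [simpl; ring|].
  change (rprod f (S n) * f (S n) = f 0%nat * (rprod (fun i => f (S i)) n * f (S n))).
  rewrite IH. ring.
Qed.

Lemma rprod_ext (f g : nat -> R) (n : nat) :
  (forall i, (i < n)%nat -> f i = g i) -> rprod f n = rprod g n.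
Proof.
  induction n as [|n IH]; intros h; [reflexivity|].
  simpl. rewrite IH, h; [reflexivity|lia|]. intros i hi. apply h. lia.
Qed.

(** Two factors of the Jacobi triple product in the variable w^2, exchanged by
    w -> 1/w. *)
Definition theta_factor (P w : R) (i : nat) : R :=
  (1 - (P ^ 8) ^ S i * w ^ 2) * (1 - (P ^ 8) ^ S i / w ^ 2).

(** Centring the product of the q-binomial theorem makes the factors with opposite
    indices pair up, each pair being symmetric under w -> 1/w; the middle factor
    leaves 1/w - w.  This is a finite form of the triple product identity. *)
Lemma centered_product (P w : R) (hP : 0 < P) (hw : 0 < w) (n : nat) :
  P ^ ((2 * n + 1) * (2 * n + 1)) / w ^ (2 * n + 1) *
    rprod (fun i => 1 - w ^ 2 / (P ^ 8) ^ n * (P ^ 8) ^ i) (2 * n + 1) =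
  (-1) ^ n * P * (/ w - w) * rprod (theta_factor P w) n.
Proof.
  induction n as [|n IH]; [simpl; field; lra|].
  assert (hPn : P ^ 8 <> 0) by (apply pow_nonzero; lra).
  assert (hPk : forall k, (P ^ 8) ^ k <> 0) by (intros; apply pow_nonzero, hPn).
  assert (hwk : forall k, w ^ k <> 0) by (intros; apply pow_nonzero; lra).
  replace (2 * S n + 1)%nat with (S (S (2 * n + 1))) by lia.
  rewrite rprod_shift.
  change (rprod (fun i => 1 - w ^ 2 / (P ^ 8) ^ S n * (P ^ 8) ^ S i) (S (2 * n + 1))) with
   (rprod (fun i => 1 - w ^ 2 / (P ^ 8) ^ S n * (P ^ 8) ^ S i) (2 * n + 1) *
    (1 - w ^ 2 / (P ^ 8) ^ S n * (P ^ 8) ^ S (2 * n + 1))).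
  rewrite (rprod_ext _ (fun i => 1 - w ^ 2 / (P ^ 8) ^ n * (P ^ 8) ^ i)).
  2:{ intros i _. change ((P ^ 8) ^ S n) with (P ^ 8 * (P ^ 8) ^ n).
      change ((P ^ 8) ^ S i) with (P ^ 8 * (P ^ 8) ^ i).
      specialize (hPk n). revert hPn hPk. generalize ((P ^ 8) ^ n) (P ^ 8).
      intros u v hu hv. field. auto. }
  replace (S (S (2 * n + 1)) * S (S (2 * n + 1)))%nat
    with ((2 * n + 1) * (2 * n + 1) + 8 * S n)%nat by lia.
  rewrite pow_add, (pow_mult P 8 (S n)).
  replace ((P ^ 8) ^ S (2 * n + 1)) with ((P ^ 8) ^ S n * (P ^ 8) ^ S n)
    by (rewrite <- pow_add; f_equal; lia).
  replace (w ^ S (S (2 * n + 1))) with (w ^ (2 * n + 1) * w ^ 2)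
    by (rewrite <- pow_add; f_equal; lia).
  change (rprod (theta_factor P w) (S n))
    with (rprod (theta_factor P w) n * theta_factor P w n).
  change ((-1) ^ S n) with (-1 * (-1) ^ n).
  set (X := rprod (fun i => 1 - w ^ 2 / (P ^ 8) ^ n * (P ^ 8) ^ i) (2 * n + 1)) in *.
  transitivity ((P ^ ((2 * n + 1) * (2 * n + 1)) / w ^ (2 * n + 1) * X) *
                (- theta_factor P w n)).
  - unfold theta_factor. simpl ((P ^ 8) ^ 0).
    generalize (hPk (S n)). generalize ((P ^ 8) ^ S n). intros u hu.
    field. repeat split; auto; try lra.
  - rewrite IH. ring.
Qed.

(** * A theta series with a product formula *)

Definition dist (n N : nat) : nat := ((n - N) + (N - n))%nat.

Lemma dist_sq (n N : nat) : (dist n N * dist n N + 2 * n * N = n * n + N * N)%nat.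
Proof.
  unfold dist. destruct (Nat.le_ge_cases n N) as [h|h].
  - replace N with (n + (N - n))%nat by lia. generalize (N - n)%nat; intros k.
    replace (n - (n + k))%nat with 0%nat by lia.
    replace (n + k - n)%nat with k by lia. lia.
  - replace n with (N + (n - N))%nat by lia. generalize (n - N)%nat; intros k.
    replace (N - (N + k))%nat with 0%nat by lia.
    replace (N + k - N)%nat with k by lia. lia.
Qed.

Lemma pow_anti (Q : R) (hQ : 0 < Q < 1) (m n : nat) : (m <= n)%nat -> Q ^ n <= Q ^ m.
Proof.
  intros h. replace n with (m + (n - m))%nat by lia. rewrite pow_add.
  destruct (pow_in_unit Q hQ (n - m)), (pow_in_unit Q hQ m). nra.
Qed.

Lemma sum_pow_dist (Q : R) (hQ : 0 < Q < 1) (N M : nat) :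
  sum_f_R0 (fun n => Q ^ dist n N) M <= 2 / (1 - Q).
Proof.
  assert (h1 : forall M, (M <= N)%nat ->
    sum_f_R0 (fun n => Q ^ dist n N) M <= Q ^ (N - M) / (1 - Q)).
  { clear M. intros M. induction M as [|M IH]; intros hM.
    - simpl. unfold dist. simpl. rewrite Nat.sub_0_r.
      destruct (pow_in_unit Q hQ N). apply (Rmult_le_reg_r (1 - Q)); [lra|].
      unfold Rdiv. rewrite Rmult_assoc, Rinv_l; nra.
    - rewrite tech5. specialize (IH ltac:(lia)).
      replace (dist (S M) N) with (N - S M)%nat by (unfold dist; lia).
      replace (N - M)%nat with (S (N - S M)) in IH by lia.
      simpl in IH. apply (Rplus_le_compat_r (Q ^ (N - S M))) in IH.
      eapply Rle_trans; [exact IH|]. right. field. lra. }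
  assert (h2 : forall k, sum_f_R0 (fun n => Q ^ dist n N) (N + k) <=
                 (1 + Q * (1 - Q ^ k)) / (1 - Q)).
  { induction k as [|k IH].
    - rewrite Nat.add_0_r. eapply Rle_trans; [apply h1; lia|].
      rewrite Nat.sub_diag. simpl. right; field; lra.
    - replace (N + S k)%nat with (S (N + k)) by lia. rewrite tech5.
      replace (dist (S (N + k)) N) with (S k) by (unfold dist; lia).
      apply (Rplus_le_compat_r (Q ^ S k)) in IH.
      eapply Rle_trans; [exact IH|]. right. simpl. field. lra. }
  destruct (Nat.le_ge_cases M N) as [h|h].
  - eapply Rle_trans; [apply h1, h|].
    apply Rmult_le_compat_r; [left; apply Rinv_0_lt_compat; lra|].
    destruct (pow_in_unit Q hQ (N - M)). lra.
  - replace M with (N + (M - N))%nat by lia. eapply Rle_trans; [apply h2|].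
    apply Rmult_le_compat_r; [left; apply Rinv_0_lt_compat; lra|].
    destruct (pow_in_unit Q hQ (M - N)). nra.
Qed.

(** Series over all indices in which one parity vanishes have to be compared with
    sums over j. *)
Lemma sum_parity (f : nat -> R) (w K : nat) : (w <= 1)%nat ->
  (forall n, Nat.odd (n + w) = true -> f n = 0) ->
  sum_f_R0 f (2 * K + 1) = sum_f_R0 (fun j => f (2 * j + w)%nat) K.
Proof.
  intros hw hf.
  assert (hstep : forall j, f (2 * j)%nat + f (2 * j + 1)%nat = f (2 * j + w)%nat).
  { intros j. destruct w as [|[|w]]; [| |lia].
    - rewrite (hf (2 * j + 1)%nat), Nat.add_0_r; [ring|].
      apply Nat.odd_spec. exists j. lia.
    - rewrite (hf (2 * j)%nat); [ring|]. apply Nat.odd_spec. exists j. lia. }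
  induction K as [|K IH].
  - simpl. exact (hstep 0%nat).
  - replace (2 * S K + 1)%nat with (S (S (2 * K + 1))) by lia.
    rewrite !tech5, IH, Rplus_assoc. f_equal.
    rewrite <- hstep. f_equal; f_equal; lia.
Qed.

Lemma power_ratio_bound (P w : R) (hP : 0 < P < 1) (hw : P ^ 2 <= w <= / P ^ 2) (n N : nat) :
  0 < w ^ n / w ^ N <= / P ^ (2 * dist n N).
Proof.
  assert (hP2 : 0 < P ^ 2) by (apply pow_lt; lra).
  assert (hw0 : 0 < w) by lra.
  assert (hwi : / w <= / P ^ 2) by (apply Rinv_le_contravar; lra).
  split; [apply Rdiv_lt_0_compat; apply pow_lt; lra|].
  rewrite pow_mult, <- pow_inv.
  unfold dist. destruct (Nat.le_ge_cases n N) as [h|h].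
  - replace N with (n + (N - n))%nat at 1 by lia.
    replace (n - N + (N - n))%nat with (N - n)%nat by lia.
    rewrite pow_add. replace (w ^ n / (w ^ n * w ^ (N - n))) with ((/ w) ^ (N - n)).
    + apply pow_incr. split; [left; apply Rinv_0_lt_compat; lra|exact hwi].
    + rewrite pow_inv. field. split; apply pow_nonzero; lra.
  - replace n with (N + (n - N))%nat at 1 by lia.
    replace (n - N + (N - n))%nat with (n - N)%nat by lia.
    rewrite pow_add. replace (w ^ N * w ^ (n - N) / w ^ N) with (w ^ (n - N)).
    + apply pow_incr. lra.
    + field. apply pow_nonzero; lra.
Qed.

(** A relative error growing like P^(-4d) at distance d from the centre, and the
    factor (w^n / w^N), are both absorbed by the Gaussian weight P^(d^2). *)
Lemma gaussian_weight_bound (P w e K : R) (n N : nat) (hP : 0 < P < 1)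
  (hw : P ^ 2 <= w <= / P ^ 2) (he : 0 <= e) (hK : 0 <= K)
  (h : e * P ^ (4 * dist n N + 4) <= K * P ^ (4 * N)) :
  P ^ (dist n N * dist n N) * (w ^ n / w ^ N) * e
    <= K / P ^ 20 * P ^ (4 * N) * (P ^ 2) ^ dist n N.
Proof.
  destruct (power_ratio_bound P w hP hw n N) as [h1 h2].
  set (d := dist n N) in *.
  assert (hp : forall k, 0 < P ^ k) by (intros; apply pow_lt; lra).
  apply Rle_trans with (P ^ (d * d) * / P ^ (2 * d) * e).
  { apply Rmult_le_compat_r; [exact he|]. apply Rmult_le_compat_l; [left; apply hp|exact h2]. }
  assert (h3 : P ^ (d * d + 16) <= P ^ (8 * d)).
  { apply pow_anti; [exact hP|].
    (* d^2 + 16 >= 8 d *)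
    pose proof (Z.square_nonneg (Z.of_nat d - 4)). nia. }
  apply (Rmult_le_reg_r (P ^ 20 * P ^ (2 * d) * P ^ (4 * d + 4))).
  { apply Rmult_lt_0_compat; [apply Rmult_lt_0_compat|]; apply hp. }
  replace (P ^ (d * d) * / P ^ (2 * d) * e * (P ^ 20 * P ^ (2 * d) * P ^ (4 * d + 4)))
    with ((P ^ (d * d) * P ^ 20) * (e * P ^ (4 * d + 4))).
  2:{ field. apply Rgt_not_eq, hp. }
  replace (K / P ^ 20 * P ^ (4 * N) * (P ^ 2) ^ d * (P ^ 20 * P ^ (2 * d) * P ^ (4 * d + 4)))
    with ((P ^ (2 * d) * P ^ (2 * d) * P ^ (4 * d + 4)) * (K * P ^ (4 * N))).
  2:{ rewrite <- pow_mult. field. lra. }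
  apply Rmult_le_compat.
  - left; apply Rmult_lt_0_compat; apply hp.
  - apply Rmult_le_pos; [exact he|left; apply hp].
  - rewrite <- !pow_add.
    replace (d * d + 20)%nat with (d * d + 16 + 4)%nat by lia.
    replace (2 * d + 2 * d + (4 * d + 4))%nat with (8 * d + 4)%nat by lia.
    rewrite (pow_add P (d * d + 16)), (pow_add P (8 * d)).
    apply Rmult_le_compat_r; [left; apply hp|exact h3].
  - exact h.
Qed.

(** The terms of the power series of the free solution at w P^(1-2N), multiplied by
    P^(N^2) w^(-N) (q; q)_N; see [free_theta].  The largest ones are near n = N. *)
Definition theta_term (P : R) (tau N : nat) (w : R) (n : nat) : R :=
  chi (n + tau) * (P ^ (dist n N * dist n N) * (w ^ n / w ^ N) *
                   (poch (P ^ 4) N / poch (P ^ 4) n)).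

(** The coefficient that the q-binomial theorem puts in place of
    (q; q)_N / (q; q)_n. *)
Definition gauss_coef (P : R) (D n : nat) : R :=
  poch (P ^ 8) D * qbin (P ^ 8) D (Nat.div2 n).

Lemma pow_in_open_unit (P : R) (hP : 0 < P < 1) (k : nat) : (0 < k)%nat -> 0 < P ^ k < 1.
Proof.
  intros h. destruct k as [|k]; [lia|]. apply pow_S_lt_1, hP.
Qed.

Lemma poch_ratio_close (q : R) (hq : 0 < q < 1) :
  exists K, 0 <= K /\ forall n N,
    Rabs (poch q N / poch q n - 1) <= K * (q ^ n + q ^ N).
Proof.
  destruct (poch_lower q hq) as [c [hc hlow]].
  exists (/ (1 - q) * (1 + / c)).
  assert (hq1 : 0 < / (1 - q)) by (apply Rinv_0_lt_compat; lra).
  assert (hc1 : 0 < / c) by (apply Rinv_0_lt_compat; lra).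
  split; [nra|]. intros n N.
  assert (hn : 0 < q ^ n) by (apply pow_lt; lra).
  assert (hN : 0 < q ^ N) by (apply pow_lt; lra).
  destruct (Nat.le_ge_cases n N) as [h|h].
  - destruct (poch_ratio_bound q hq n N h) as [h1 h2].
    rewrite Rabs_left1 by lra. unfold Rdiv in h2.
    set (a := / (1 - q)) in *. set (b := / c) in *.
    assert (0 < a * b) by nra. assert (0 < a * q ^ N) by nra.
    assert (0 < a * b * (q ^ n + q ^ N)) by nra. nra.
  - destruct (poch_ratio_bound q hq N n h) as [h1 h2].
    pose proof (poch_pos q hq n). pose proof (poch_pos q hq N). pose proof (hlow n).
    replace (poch q N / poch q n - 1)
      with ((1 - poch q n / poch q N) * (poch q N * / poch q n)) by (field; lra).
    assert (/ poch q n <= / c) by (apply Rinv_le_contravar; lra).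
    assert (0 < / poch q n) by (apply Rinv_0_lt_compat; lra).
    rewrite Rabs_right.
    + apply Rle_trans with (q ^ N / (1 - q) * / c).
      * apply Rmult_le_compat; [lra|nra|exact h2|nra].
      * unfold Rdiv. set (a := / (1 - q)) in *. set (b := / c) in *.
        assert (0 < a * b) by nra. assert (0 < a * (q ^ n + q ^ N)) by nra.
        assert (0 < a * b * q ^ n) by nra. nra.
    + apply Rle_ge, Rmult_le_pos; [lra|nra].
Qed.

Lemma qbin_close (r : R) (hr : 0 < r < 1) (D j : nat) : (j <= D)%nat ->
  Rabs (poch r D * qbin r D j - 1) <= (r ^ j + r ^ (D - j)) / (1 - r).
Proof.
  intros h.
  pose proof (qbin_poch r D j h) as hb.
  pose proof (poch_pos r hr j). pose proof (poch_pos r hr (D - j)).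
  pose proof (poch_pos r hr D).
  destruct (poch_ratio_bound r hr j D h) as [a1 a2].
  destruct (poch_ratio_bound r hr (D - j) D ltac:(lia)) as [b1 b2].
  replace (poch r D * qbin r D j)
    with ((poch r D / poch r j) * (poch r D / poch r (D - j))).
  2:{ rewrite <- hb at 2. field. lra. }
  assert (0 < poch r D / poch r j) by (apply Rdiv_lt_0_compat; lra).
  assert (0 < poch r D / poch r (D - j)) by (apply Rdiv_lt_0_compat; lra).
  set (u := poch r D / poch r j) in *. set (v := poch r D / poch r (D - j)) in *.
  rewrite Rabs_left1 by nra.
  unfold Rdiv in *. nra.
Qed.

(** Both coefficients are close to 1 as long as the index and its mirror image are
    large.  At distance d from N this costs a factor P^(-4d), and beyond 2N the
    bound is trivial. *)
Lemma gauss_coef_close (P : R) (hP : 0 < P < 1) :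
  exists K, 0 <= K /\ forall n w j, (w <= 1)%nat ->
    let N := (2 * n + 1 + w)%nat in
    let i := (2 * j + w)%nat in
    Rabs (poch (P ^ 4) N / poch (P ^ 4) i - gauss_coef P (2 * n + 1) i) *
      P ^ (4 * dist i N + 4) <= K * P ^ (4 * N).
Proof.
  pose proof (pow_in_open_unit P hP 4 ltac:(lia)) as h4.
  pose proof (pow_in_open_unit P hP 8 ltac:(lia)) as h8.
  destruct (poch_ratio_close (P ^ 4) h4) as [K1 [hK1 hc]].
  assert (hr : 0 < / (1 - P ^ 8)) by (apply Rinv_0_lt_compat; lra).
  exists (2 * K1 + (1 + 2 * / (1 - P ^ 8))). split; [lra|].
  intros n w j hw N i.
  set (D := (2 * n + 1)%nat).
  assert (hdiv : Nat.div2 i = j).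
  { unfold i. destruct w as [|[|w]]; [| |lia].
    - rewrite Nat.add_0_r. apply Nat.div2_double.
    - replace (2 * j + 1)%nat with (S (2 * j)) by lia. apply Nat.div2_succ_double. }
  unfold gauss_coef. rewrite hdiv.
  set (W := P ^ (4 * dist i N + 4)).
  assert (hW : 0 < W) by (apply pow_lt; lra).
  assert (hmono : forall k, (4 * N <= k + (4 * dist i N + 4))%nat ->
            P ^ k * W <= P ^ (4 * N)).
  { intros k hk. unfold W. rewrite <- pow_add. apply pow_anti; [exact hP|exact hk]. }
  pose proof (pow_lt P (4 * N) ltac:(lra)) as hN.
  assert (A1 : Rabs (poch (P ^ 4) N / poch (P ^ 4) i - 1) * W <= 2 * K1 * P ^ (4 * N)).
  { apply Rle_trans with (K1 * ((P ^ 4) ^ i + (P ^ 4) ^ N) * W).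
    - apply Rmult_le_compat_r; [lra|apply hc].
    - rewrite <- !pow_mult.
      pose proof (hmono (4 * i)%nat ltac:(unfold dist; lia)).
      pose proof (hmono (4 * N)%nat ltac:(lia)). nra. }
  assert (A2 : Rabs (poch (P ^ 8) D * qbin (P ^ 8) D j - 1) * W <=
               (1 + 2 * / (1 - P ^ 8)) * P ^ (4 * N)).
  { destruct (Nat.le_gt_cases j D) as [hj|hj].
    - apply Rle_trans with (((P ^ 8) ^ j + (P ^ 8) ^ (D - j)) / (1 - P ^ 8) * W).
      + apply Rmult_le_compat_r; [lra|apply qbin_close; assumption].
      + rewrite <- !pow_mult.
        pose proof (hmono (8 * j)%nat ltac:(unfold dist, i, N; lia)).
        pose proof (hmono (8 * (D - j))%nat ltac:(unfold dist, i, N, D in *; lia)).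
        unfold Rdiv. nra.
    - rewrite qbin_out, Rmult_0_r by exact hj.
      replace (0 - 1) with (- (1)) by ring. rewrite Rabs_Ropp, Rabs_R1.
      pose proof (hmono 0%nat ltac:(unfold dist, i, N, D in *; lia)).
      simpl (P ^ 0) in *. nra. }
  replace (poch (P ^ 4) N / poch (P ^ 4) i - poch (P ^ 8) D * qbin (P ^ 8) D j)
    with ((poch (P ^ 4) N / poch (P ^ 4) i - 1) -
          (poch (P ^ 8) D * qbin (P ^ 8) D j - 1)) by ring.
  eapply Rle_trans; [apply Rmult_le_compat_r; [lra|apply Rabs_triang]|].
  rewrite Rabs_Ropp. lra.
Qed.

(** Matching exponents in the q-binomial theorem for r = P^8 and
    y = w^2 / r^n shows that the theta sum with Gaussian coefficients is
    [centered_product]. *)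
Lemma gauss_sum (P w : R) (hP : 0 < P < 1) (hw : 0 < w) (tau n o K : nat) :
  (o <= 1)%nat -> Nat.odd (o + tau) = false -> (2 * n + 1 <= K)%nat ->
  let N := (2 * n + 1 + o)%nat in
  sum_f_R0 (fun i => chi (i + tau) * (P ^ (dist i N * dist i N) * (w ^ i / w ^ N) *
                                      gauss_coef P (2 * n + 1) i)) (2 * K + 1) =
  poch (P ^ 8) (2 * n + 1) *
    (chi (o + tau) * ((-1) ^ n * P * (/ w - w) * rprod (theta_factor P w) n)).
Proof.
  intros ho hpar hK N. set (D := (2 * n + 1)%nat) in *.
  rewrite (sum_parity _ o K ho).
  2:{ intros i hi. rewrite chi_odd; [ring|].
      rewrite Nat.odd_add in *. destruct (Nat.odd i), (Nat.odd o), (Nat.odd tau);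
        simpl in *; congruence. }
  rewrite <- (centered_product P w ltac:(lra) hw n). fold D.
  rewrite q_binomial.
  set (y := w ^ 2 / (P ^ 8) ^ n).
  rewrite <- Rmult_assoc, <- Rmult_assoc, scal_sum.
  assert (htail : forall f : nat -> R, (forall j, (D < j)%nat -> f j = 0) ->
            sum_f_R0 f K = sum_f_R0 f D).
  { intros f hf. replace K with (D + (K - D))%nat by lia.
    induction (K - D)%nat as [|k IHk]; [rewrite Nat.add_0_r; reflexivity|].
    rewrite Nat.add_succ_r, tech5, IHk, hf by lia. ring. }
  assert (hdiv : forall j, Nat.div2 (2 * j + o) = j).
  { intros j. destruct o as [|[|o]]; [| |lia].
    - rewrite Nat.add_0_r. apply Nat.div2_double.
    - replace (2 * j + 1)%nat with (S (2 * j)) by lia. apply Nat.div2_succ_double. }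
  rewrite htail.
  2:{ intros j hj. unfold gauss_coef. rewrite hdiv, qbin_out by exact hj. ring. }
  apply sum_eq. intros j _. unfold gauss_coef. rewrite hdiv.
  replace (2 * j + o + tau)%nat with (2 * j + (o + tau))%nat by lia.
  rewrite chi_double.
  assert (hpw : forall k, P ^ k <> 0) by (intros; apply pow_nonzero; lra).
  assert (hww : forall k, w ^ k <> 0) by (intros; apply pow_nonzero; lra).
  assert (hE : forall j, rprod (fun i => - (y * (P ^ 8) ^ i)) j * P ^ (4 * j * D) =
             (-1) ^ j * w ^ (2 * j) * P ^ (4 * j * j)).
  { clear j. intros j. induction j as [|j IH]; [simpl; ring|].
    change (rprod (fun i => - (y * (P ^ 8) ^ i)) (S j))
      with (rprod (fun i => - (y * (P ^ 8) ^ i)) j * - (y * (P ^ 8) ^ j)).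
    replace (4 * S j * D)%nat with (4 * j * D + 4 * D)%nat by lia.
    rewrite pow_add.
    transitivity ((rprod (fun i => - (y * (P ^ 8) ^ i)) j * P ^ (4 * j * D)) *
                  (- (y * (P ^ 8) ^ j) * P ^ (4 * D))); [ring|].
    rewrite IH. unfold y.
    replace (4 * S j * S j)%nat with (4 * j * j + 8 * j + 4)%nat by lia.
    replace (2 * S j)%nat with (2 * j + 2)%nat by lia.
    replace (4 * D)%nat with (8 * n + 4)%nat by (unfold D; lia).
    rewrite !pow_add, <- !pow_mult.
    change ((-1) ^ S j) with (-1 * (-1) ^ j).
    field. apply hpw. }
  specialize (hE j).
  assert (hdist : dist (2 * j + o) N = dist (2 * j) D) by (unfold dist, N, D; lia).
  rewrite hdist.
  assert (hd : P ^ (dist (2 * j) D * dist (2 * j) D) * P ^ (4 * j * D) =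
               P ^ (4 * j * j) * P ^ (D * D)).
  { rewrite <- !pow_add. f_equal. pose proof (dist_sq (2 * j) D). lia. }
  replace (w ^ (2 * j + o) / w ^ N) with (w ^ (2 * j) / w ^ D).
  2:{ unfold N. rewrite !pow_add. field. repeat split; apply hww. }
  apply (Rmult_eq_reg_r (P ^ (4 * j * D))); [|apply hpw].
  set (E := rprod (fun i => - (y * (P ^ 8) ^ i)) j) in *.
  set (G := P ^ (dist (2 * j) D * dist (2 * j) D)) in *.
  transitivity ((-1) ^ j * chi (o + tau) * (w ^ (2 * j) / w ^ D) *
                (poch (P ^ 8) D * qbin (P ^ 8) D j) * (G * P ^ (4 * j * D))); [ring|].
  rewrite hd.
  transitivity (qbin (P ^ 8) D j * (E * P ^ (4 * j * D)) *
                (poch (P ^ 8) D * chi (o + tau) * (P ^ (D * D) / w ^ D))); [|ring].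
  rewrite hE. field. apply hww.
Qed.

(** For w^2 between P^4 and P^(-4), each of the two factors of index i is at least
    1 - P^(4 (i + 1)), so the product is at least ((q; q)_n)^2. *)
Lemma theta_product_lower (P : R) (hP : 0 < P < 1) :
  exists c, 0 < c /\ forall w n, P ^ 2 <= w <= / P ^ 2 ->
    c <= rprod (theta_factor P w) n.
Proof.
  pose proof (pow_in_open_unit P hP 4 ltac:(lia)) as h4.
  destruct (poch_lower (P ^ 4) h4) as [c [hc hlow]].
  exists (c * c). split; [nra|]. intros w n hw.
  assert (hmain : poch (P ^ 4) n * poch (P ^ 4) n <= rprod (theta_factor P w) n).
  { induction n as [|n IH]; [unfold poch; simpl; lra|].
    rewrite poch_S. change (rprod (theta_factor P w) (S n))
      with (rprod (theta_factor P w) n * theta_factor P w n).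
    pose proof (poch_pos (P ^ 4) h4 n) as hp.
    pose proof (pow_S_lt_1 (P ^ 4) h4 n) as hq.
    assert (hP2 : 0 < P ^ 2) by (apply pow_lt; lra).
    assert (hw2 : w ^ 2 <= / P ^ 4).
    { replace (/ P ^ 4) with ((/ P ^ 2) ^ 2) by (field; lra). apply pow_incr. lra. }
    assert (hw2' : P ^ 4 <= w ^ 2).
    { replace (P ^ 4) with ((P ^ 2) ^ 2) by ring. apply pow_incr. lra. }
    assert (hwi : / w ^ 2 <= / P ^ 4) by (apply Rinv_le_contravar; lra).
    assert (h8 : (P ^ 8) ^ S n * / P ^ 4 <= (P ^ 4) ^ S n).
    { apply (Rmult_le_reg_r (P ^ 4)); [lra|].
      rewrite Rmult_assoc, Rinv_l, Rmult_1_r by lra.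
      rewrite <- !pow_mult, <- pow_add. apply pow_anti; [exact hP|lia]. }
    assert (h80 : 0 < (P ^ 8) ^ S n) by (repeat apply pow_lt; lra).
    assert (ha : 1 - (P ^ 4) ^ S n <= 1 - (P ^ 8) ^ S n * w ^ 2) by nra.
    assert (hb : 1 - (P ^ 4) ^ S n <= 1 - (P ^ 8) ^ S n / w ^ 2) by (unfold Rdiv; nra).
    unfold theta_factor.
    set (t := 1 - (P ^ 4) ^ S n) in *.
    replace (poch (P ^ 4) n * t * (poch (P ^ 4) n * t))
      with ((poch (P ^ 4) n * poch (P ^ 4) n) * (t * t)) by ring.
    assert (0 < t) by (unfold t; lra).
    apply Rmult_le_compat; [nra|nra|exact IH|].
    apply Rmult_le_compat; lra. }
  pose proof (hlow n). pose proof (poch_pos (P ^ 4) h4 n). nra.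
Qed.

(** The parity condition is what makes the central term of the series vanish and
    the two sides cancel at w = 1.  The sign [sg] depends only on [N] and [tau], so
    it is common to the whole window; the sign change at w = 1 relies on this. *)
Lemma theta_estimate (P : R) (hP : 0 < P < 1) :
  exists C c, 0 <= C /\ 0 < c /\
  forall tau n o, (o <= 1)%nat -> Nat.odd (o + tau) = false ->
  let N := (2 * n + 1 + o)%nat in
  exists sg, (sg = 1 \/ sg = -1) /\
  forall w V : R, P ^ 2 <= w <= / P ^ 2 -> is_series (theta_term P tau N w) V ->
  exists A, c <= A /\ Rabs (sg * V - A * (w - / w)) <= C * P ^ (4 * N).
Proof.
  destruct (gauss_coef_close P hP) as [K [hK hclose]].
  destruct (theta_product_lower P hP) as [c1 [hc1 hlow1]].
  pose proof (pow_in_open_unit P hP 8 ltac:(lia)) as h8.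
  pose proof (pow_in_open_unit P hP 2 ltac:(lia)) as h2.
  destruct (poch_lower (P ^ 8) h8) as [c2 [hc2 hlow2]].
  exists (K / P ^ 20 * (2 / (1 - P ^ 2))), (c2 * P * c1).
  assert (hK20 : 0 <= K / P ^ 20) by (apply Rdiv_le_0_compat; [lra|apply pow_lt; lra]).
  split; [apply Rmult_le_pos; [lra|apply Rdiv_le_0_compat; lra]|].
  split; [repeat apply Rmult_lt_0_compat; lra|].
  intros tau n o ho hpar N.
  exists (- (chi (o + tau) * (-1) ^ n)).
  assert (hsg : - (chi (o + tau) * (-1) ^ n) = 1 \/ - (chi (o + tau) * (-1) ^ n) = -1).
  { assert (hn : (-1) ^ n = 1 \/ (-1) ^ n = -1).
    { induction n as [|n IH]; [left; reflexivity|]. simpl.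
      destruct IH as [-> | ->]; [right|left]; ring. }
    destruct (chi_even _ hpar) as [-> | ->]; destruct hn as [-> | ->]; lra. }
  split; [exact hsg|]. intros w V hw hV.
  assert (hw0 : 0 < w) by lra.
  exists (poch (P ^ 8) (2 * n + 1) * P * rprod (theta_factor P w) n).
  split.
  { pose proof (hlow2 (2 * n + 1)%nat). pose proof (hlow1 w n hw).
    apply Rmult_le_compat; [nra|lra| |lra]. apply Rmult_le_compat_r; lra. }
  set (sg := - (chi (o + tau) * (-1) ^ n)) in *.
  set (A := poch (P ^ 8) (2 * n + 1) * P * rprod (theta_factor P w) n).
  replace (sg * V - A * (w - / w)) with (sg * (V - sg * A * (w - / w))).
  2:{ transitivity (sg * V - sg * sg * A * (w - / w)); [ring|].
      replace (sg * sg) with 1 by (destruct hsg as [-> | ->]; ring). ring. }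
  replace (Rabs (sg * (V - sg * A * (w - / w)))) with (Rabs (V - sg * A * (w - / w))).
  2:{ rewrite Rabs_mult. destruct hsg as [-> | ->]; [rewrite Rabs_R1|rewrite (Rabs_left (-1))]; lra. }
  set (L := sg * A * (w - / w)).
  set (B := K / P ^ 20 * (2 / (1 - P ^ 2)) * P ^ (4 * N)).
  assert (hsum : forall k, (2 * n + 1 <= k)%nat ->
     Rabs (sum_f_R0 (theta_term P tau N w) (2 * k + 1) - L) <= B).
  { intros k hk.
    assert (hL : L = sum_f_R0 (fun i => chi (i + tau) * (P ^ (dist i N * dist i N) *
              (w ^ i / w ^ N) * gauss_coef P (2 * n + 1) i)) (2 * k + 1)).
    { unfold N. rewrite (gauss_sum P w hP hw0 tau n o k ho hpar hk).
      unfold L, sg, A. ring. }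
    rewrite hL, <- minus_sum.
    eapply Rle_trans; [apply Rsum_abs|].
    apply Rle_trans with
      (sum_f_R0 (fun i => (P ^ 2) ^ dist i N * (K / P ^ 20 * P ^ (4 * N))) (2 * k + 1)).
    - apply sum_Rle. intros i _. unfold theta_term.
      rewrite <- Rmult_minus_distr_l, <- Rmult_minus_distr_l, !Rabs_mult.
      assert (hpos : 0 <= (P ^ 2) ^ dist i N * (K / P ^ 20 * P ^ (4 * N))).
      { apply Rmult_le_pos; [apply pow_le; lra|].
        apply Rmult_le_pos; [lra|apply pow_le; lra]. }
      destruct (Nat.odd (i + tau)) eqn:hodd.
      + rewrite (chi_odd _ hodd), Rabs_R0, Rmult_0_l. exact hpos.
      + assert (hi : exists j, i = (2 * j + o)%nat).
        { rewrite Nat.odd_add in *.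
          exists (Nat.div2 i). pose proof (Nat.div2_odd i) as hd.
          destruct o as [|[|o]]; [| |lia]; simpl (Nat.odd _) in hpar;
          destruct (Nat.odd i), (Nat.odd tau); simpl in *; try discriminate; lia. }
        destruct hi as [j ->].
        eapply Rle_trans.
        { apply Rmult_le_compat_r; [|apply chi_abs_le].
          repeat apply Rmult_le_pos; apply Rabs_pos. }
        rewrite Rmult_1_l.
        pose proof (power_ratio_bound P w hP hw (2 * j + o) N) as [hr _].
        rewrite (Rabs_right (P ^ _)) by (apply Rle_ge, pow_le; lra).
        rewrite (Rabs_right (w ^ _ / _)) by lra.
        eapply Rle_trans.
        { apply gaussian_weight_bound; [exact hP|exact hw|apply Rabs_pos|exact hK|].
          apply (hclose n o j ho). }
        fold N. right; ring.
    - rewrite <- scal_sum. unfold B.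
      pose proof (sum_pow_dist (P ^ 2) h2 N (2 * k + 1)).
      assert (0 <= K / P ^ 20 * P ^ (4 * N)) by (apply Rmult_le_pos; [lra|apply pow_le; lra]).
      nra. }
  assert (hlim : is_lim_seq (fun k => Rabs (sum_f_R0 (theta_term P tau N w) (2 * k + 1) - L))
                   (Rabs (V - L))).
  { apply (is_lim_seq_abs _ (V - L)). apply is_lim_seq_minus'; [|apply is_lim_seq_const].
    apply (is_lim_seq_subseq (sum_f_R0 (theta_term P tau N w)) V (fun k => (2 * k + 1)%nat)).
    - apply eventually_subseq. intros; lia.
    - apply (is_lim_seq_ext (sum_n (theta_term P tau N w))); [|exact hV].
      intros m. apply sum_n_Reals. }
  refine (is_lim_seq_le_loc _ _ (Rabs (V - L)) B _ hlim (is_lim_seq_const B)).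
  exists (2 * n + 1)%nat. intros k hk. apply hsum, hk.
Qed.

(** * Real three-term recurrences *)

(** The sum of two consecutive absolute values satisfies a first-order inequality. *)
Lemma second_order_bound (Q G E L : R) (a : nat -> R) (hQ : 0 < Q < 1)
  (hG : 0 <= G) (hE : 0 <= E) (ha : forall j, 0 <= a j)
  (hrec : forall j, a j <= G * Q ^ j * a (S j) + a (S (S j)) + E * Q ^ j)
  (hlim : is_lim_seq (fun j => a j + a (S j)) L) :
  forall j, a j <= exp (G / (1 - Q)) * (L + E * Q ^ j / (1 - Q)).
Proof.
  intros j. apply Rle_trans with (a j + a (S j)); [pose proof (ha (S j)); lra|].
  refine (gronwall Q G E L (fun j => a j + a (S j)) hQ hG hE _ _ hlim j).
  - intros i. pose proof (ha i). pose proof (ha (S i)). lra.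
  - intros i. pose proof (hrec i). pose proof (ha (S (S i))).
    destruct (pow_in_unit Q hQ i). assert (hGQ : 0 <= G * Q ^ i) by (apply Rmult_le_pos; lra).
    pose proof (Rmult_le_pos _ _ hGQ (ha (S (S i)))). cbv beta. lra.
Qed.

Definition sol (g : nat -> R) (tau : nat) (Y : nat -> R) : Prop :=
  (forall j, Y j = g j * Y (S j) - Y (S (S j))) /\
  is_lim_seq (fun j => Y j - chi (j + tau)) 0.

Lemma sol_shift (g : nat -> R) (tau J : nat) (Y : nat -> R) : sol g tau Y ->
  sol (fun j => g (J + j)%nat) (J + tau) (fun j => Y (J + j)%nat).
Proof.
  intros [h1 h2]. split.
  - intros j. rewrite !Nat.add_succ_r. apply h1.
  - apply (is_lim_seq_ext (fun j => Y (j + J)%nat - chi (j + J + tau))).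
    + intros j. rewrite (Nat.add_comm J j), (Nat.add_assoc j J tau). reflexivity.
    + apply (is_lim_seq_incr_n (fun j => Y j - chi (j + tau)) J), h2.
Qed.

Lemma chi_sol (tau : nat) : sol (fun _ => 0) tau (fun j => chi (j + tau)).
Proof.
  split.
  - intros j. simpl. rewrite ?chi_SS. ring.
  - apply (is_lim_seq_ext (fun _ => 0)); [intros; ring|apply is_lim_seq_const].
Qed.

Lemma sol_norm_limit (g : nat -> R) (tau : nat) (Y : nat -> R) : sol g tau Y ->
  is_lim_seq (fun j => Rabs (Y j) + Rabs (Y (S j))) 1.
Proof.
  intros [_ h].
  assert (h' : is_lim_seq (fun j => Rabs (Y j) - Rabs (chi (j + tau))) 0).
  { apply (proj2 (is_lim_seq_abs_0 _)).
    apply (is_lim_seq_le_le (fun _ => 0) _ (fun j => Rabs (Y j - chi (j + tau)))).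
    - intros j. split; [apply Rabs_pos|apply Rabs_triang_inv2].
    - apply is_lim_seq_const.
    - apply (proj1 (is_lim_seq_abs_0 _)), h. }
  apply (is_lim_seq_ext (fun j => (Rabs (Y j) - Rabs (chi (j + tau))) +
           ((Rabs (Y (S j)) - Rabs (chi (S j + tau))) + 1))).
  - intros j. pose proof (chi_abs_consecutive (j + tau)).
    simpl (S j + tau)%nat. lra.
  - replace (Finite 1) with (Finite (0 + (0 + 1))) by (f_equal; ring).
    apply is_lim_seq_plus'; [exact h'|].
    apply is_lim_seq_plus'; [|apply is_lim_seq_const].
    apply (is_lim_seq_incr_1 (fun j => Rabs (Y j) - Rabs (chi (j + tau)))), h'.
Qed.

Lemma sol_bound (Q G : R) (g : nat -> R) (tau : nat) (Y : nat -> R) (hQ : 0 < Q < 1)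
  (hG : 0 <= G) (hg : forall j, Rabs (g j) <= G * Q ^ j) (hY : sol g tau Y) :
  forall j, Rabs (Y j) <= exp (G / (1 - Q)).
Proof.
  intros j.
  eapply Rle_trans.
  - apply (second_order_bound Q G 0 1 (fun j => Rabs (Y j)) hQ hG (Rle_refl 0)).
    + intros; apply Rabs_pos.
    + intros i. rewrite (proj1 hY i) at 1.
      eapply Rle_trans; [apply Rabs_triang|]. rewrite Rabs_Ropp, Rabs_mult.
      pose proof (hg i). pose proof (Rabs_pos (Y (S i))). nra.
    + apply (sol_norm_limit g tau), hY.
  - right. field. lra.
Qed.

(** The recurrence is reversible, so two small consecutive terms would force a small
    limit, whereas the limit pattern has norm 1. *)
Lemma sol_lower (Q G : R) (g : nat -> R) (tau : nat) (Y : nat -> R) (hQ : 0 < Q < 1)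
  (hG : 0 <= G) (hg : forall j, Rabs (g j) <= G * Q ^ j) (hY : sol g tau Y) :
  1 <= exp (G / (1 - Q)) * (Rabs (Y 0%nat) + Rabs (Y 1%nat)).
Proof.
  apply (gronwall_forward Q G 1 (fun j => Rabs (Y j) + Rabs (Y (S j))) hQ hG).
  - intros j. pose proof (Rabs_pos (Y j)). pose proof (Rabs_pos (Y (S j))). lra.
  - intros j. replace (Y (S (S j))) with (g j * Y (S j) - Y j) by (rewrite (proj1 hY j); ring).
    pose proof (Rabs_triang (g j * Y (S j)) (- Y j)) as h. rewrite Rabs_Ropp, Rabs_mult in h.
    unfold Rminus. pose proof (hg j). pose proof (Rabs_pos (Y (S j))). pose proof (Rabs_pos (Y j)).
    destruct (pow_in_unit Q hQ j). assert (0 <= G * Q ^ j) by (apply Rmult_le_pos; lra).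
    nra.
  - apply (sol_norm_limit g tau), hY.
Qed.

(** The difference of two solutions with the same limit pattern solves an
    inhomogeneous recurrence with limit zero. *)
Lemma sol_diff (Q G E : R) (g g' : nat -> R) (tau : nat) (Y Y' : nat -> R) (hQ : 0 < Q < 1)
  (hG : 0 <= G) (hE : 0 <= E)
  (hg : forall j, Rabs (g j) <= G * Q ^ j) (hg' : forall j, Rabs (g' j) <= G * Q ^ j)
  (hd : forall j, Rabs (g j - g' j) <= E * Q ^ j)
  (hY : sol g tau Y) (hY' : sol g' tau Y') :
  forall j, Rabs (Y j - Y' j) <= exp (G / (1 - Q)) ^ 2 / (1 - Q) * E * Q ^ j.
Proof.
  intros j.
  assert (hB : 0 < exp (G / (1 - Q))) by apply exp_pos.
  assert (hlim : is_lim_seq (fun j => Rabs (Y j - Y' j)) 0).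
  { apply (proj1 (is_lim_seq_abs_0 _)).
    apply (is_lim_seq_ext (fun j => (Y j - chi (j + tau)) - (Y' j - chi (j + tau))));
      [intros; ring|].
    replace (Finite 0) with (Finite (0 - 0)) by (f_equal; ring).
    apply is_lim_seq_minus'; [apply hY|apply hY']. }
  eapply Rle_trans.
  - apply (second_order_bound Q G (E * exp (G / (1 - Q))) 0
             (fun j => Rabs (Y j - Y' j)) hQ hG).
    + apply Rmult_le_pos; lra.
    + intros; apply Rabs_pos.
    + intros i. rewrite (proj1 hY i), (proj1 hY' i) at 1.
      replace (g i * Y (S i) - Y (S (S i)) - (g' i * Y' (S i) - Y' (S (S i))))
        with (g i * (Y (S i) - Y' (S i)) + ((- (Y (S (S i)) - Y' (S (S i)))) +
              (g i - g' i) * Y' (S i))) by ring.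
      eapply Rle_trans; [apply Rabs_triang|].
      eapply Rle_trans; [apply Rplus_le_compat_l, Rabs_triang|].
      rewrite Rabs_Ropp, !Rabs_mult.
      pose proof (hg i). pose proof (hd i).
      pose proof (sol_bound Q G g' tau Y' hQ hG hg' hY' (S i)).
      pose proof (Rabs_pos (Y (S i) - Y' (S i))). pose proof (Rabs_pos (Y' (S i))).
      pose proof (Rabs_pos (g i - g' i)).
      assert (Rabs (g i - g' i) * Rabs (Y' (S i)) <= (E * Q ^ i) * exp (G / (1 - Q)))
        by (apply Rmult_le_compat; assumption).
      nra.
    + replace (Finite 0) with (Finite (0 + 0)) by (f_equal; ring). apply is_lim_seq_plus'; [exact hlim|].
      apply (is_lim_seq_incr_1 (fun j => Rabs (Y j - Y' j))), hlim.
  - right. field. lra.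
Qed.

(** The value of Y_i / Y_(i+1) for the solution that starts with Y_0 = 0, computed
    forwards as a continued fraction. *)
Fixpoint ratio (g : nat -> R) (i : nat) : R :=
  match i with
  | 0%nat => 0
  | S i' => / (g i' - ratio g i')
  end.

(** The bound 2 on the coefficients makes the continued fraction well defined; it is
    the hyperbolic regime of the recurrence. *)
Lemma ratio_range (g : nat -> R) (J : nat) (hg : forall i, (i < J)%nat -> 2 <= g i) :
  forall i, (i <= J)%nat -> 0 <= ratio g i <= 1.
Proof.
  induction i as [|i IH]; intros h; simpl; [lra|].
  pose proof (IH ltac:(lia)). pose proof (hg i ltac:(lia)).
  split; [left; apply Rinv_0_lt_compat; lra|].
  rewrite <- Rinv_1. apply Rinv_le_contravar; lra.
Qed.

Lemma ratio_anti (g g' : nat -> R) (J : nat) (hg' : forall i, (i < J)%nat -> 2 <= g' i)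
  (hle : forall i, (i < J)%nat -> g' i <= g i) :
  forall i, (i <= J)%nat -> ratio g i <= ratio g' i.
Proof.
  induction i as [|i IH]; intros h; simpl; [lra|].
  pose proof (IH ltac:(lia)). pose proof (hg' i ltac:(lia)). pose proof (hle i ltac:(lia)).
  pose proof (ratio_range g' J hg' i ltac:(lia)).
  apply Rinv_le_contravar; lra.
Qed.

(** This vanishes exactly when the solution agrees at [J] with the one
    starting from Y_0 = 0.  Unlike Y_0, which carries a huge factor, it has moderate
    size. *)
Definition mismatch (g Y : nat -> R) (J : nat) : R := Y J - ratio g J * Y (S J).

(** One step of the recurrence multiplies the mismatch by g_i - ratio g i, which is
    positive in the hyperbolic regime. *)
Lemma mismatch_product (g : nat -> R) (tau : nat) (Y : nat -> R) (hY : sol g tau Y) (J : nat)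
  (hg : forall i, (i < J)%nat -> 2 <= g i) :
  forall i, (i <= J)%nat -> Y 0%nat = rprod (fun i => g i - ratio g i) i * mismatch g Y i.
Proof.
  induction i as [|i IH]; intros h.
  - unfold mismatch. simpl. ring.
  - rewrite IH by lia. unfold mismatch. simpl (rprod _ (S i)). simpl (ratio g (S i)).
    rewrite (proj1 hY i).
    pose proof (ratio_range g J hg i ltac:(lia)). pose proof (hg i ltac:(lia)).
    field. lra.
Qed.

Lemma rprod_pos (f : nat -> R) (n : nat) : (forall i, (i < n)%nat -> 0 < f i) -> 0 < rprod f n.
Proof.
  induction n as [|n IH]; intros h; simpl; [lra|].
  apply Rmult_lt_0_compat; [apply IH; intros; apply h; lia|apply h; lia].
Qed.

Lemma rprod_le (f g : nat -> R) (n : nat) :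
  (forall i, (i < n)%nat -> 0 <= f i <= g i) -> 0 <= rprod f n <= rprod g n.
Proof.
  induction n as [|n IH]; intros h; simpl; [lra|].
  specialize (IH ltac:(intros; apply h; lia)). pose proof (h n ltac:(lia)).
  split; [apply Rmult_le_pos; lra|apply Rmult_le_compat; lra].
Qed.

Lemma ratio_factor_pos (g : nat -> R) (J : nat) (hg : forall i, (i < J)%nat -> 2 <= g i) :
  0 < rprod (fun i => g i - ratio g i) J.
Proof.
  apply rprod_pos. intros i hi.
  pose proof (ratio_range g J hg i ltac:(lia)). pose proof (hg i hi). lra.
Qed.

Lemma almost_decreasing (Q c : R) (a : nat -> R) (hQ : 0 < Q < 1) 
  (h : forall i, a (S i) - c * Q ^ i <= a i) (k i : nat) :
    a (i + k)%nat - c * (Q ^ i - Q ^ (i + k)) / (1 - Q) <= a i.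
Proof.
  induction k as [|k IH].
  - rewrite Nat.add_0_r. replace (c * (Q ^ i - Q ^ i) / (1 - Q)) with 0 by (field; lra). lra.
  - rewrite Nat.add_succ_r. pose proof (h (i + k)%nat).
    replace (c * (Q ^ i - Q ^ S (i + k)) / (1 - Q))
      with (c * (Q ^ i - Q ^ (i + k)) / (1 - Q) + c * Q ^ (i + k)) by (simpl; field; lra).
    lra.
Qed.

Lemma almost_decreasing_limit (Q c : R) (a : nat -> R) (hQ : 0 < Q < 1) (hc : 0 <= c)
  (h : forall i, a (S i) - c * Q ^ i <= a i) (hl : is_lim_seq a 0) (i : nat) :
    - (c * Q ^ i / (1 - Q)) <= a i.
Proof.
  assert (hl' : is_lim_seq (fun k => a (k + i)%nat - c * Q ^ i / (1 - Q)) (0 - c * Q ^ i / (1 - Q))).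
  { apply is_lim_seq_minus'; [apply (is_lim_seq_incr_n a i), hl|apply is_lim_seq_const]. }
  replace (- (c * Q ^ i / (1 - Q))) with (0 - c * Q ^ i / (1 - Q)) by ring.
  refine (is_lim_seq_le _ (fun _ => a i) _ (a i) _ hl' (is_lim_seq_const _)).
  intros k. simpl. eapply Rle_trans; [|apply (almost_decreasing Q c a hQ h k i)].
  rewrite (Nat.add_comm k i). apply Rplus_le_compat_l, Ropp_le_contravar.
  apply Rmult_le_compat_r; [left; apply Rinv_0_lt_compat; lra|].
  apply Rmult_le_compat_l; [exact hc|]. destruct (pow_in_unit Q hQ (i + k)). lra.
Qed.

Lemma geometric_limit (Q c : R) (hQ : 0 < Q < 1) : is_lim_seq (fun n => c * Q ^ n) 0.
Proof.
  replace (Finite 0) with (Rbar_mult c 0) by (simpl; f_equal; ring).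
  apply is_lim_seq_scal_l, is_lim_seq_geom. rewrite Rabs_right; lra.
Qed.

(** The Casoratian W_j = Y_j Y'_(j+1) - Y'_j Y_(j+1) tends to zero at infinity, and
    W_j - W_(j+1) = (g_j - g'_j) Y_(j+1) Y'_(j+1).  If g and g' are close, then Y' is
    close to Y, so these increments are essentially e Q^j Y_(j+1)^2; they cannot
    all be small, since Y does not tend to zero. *)
Lemma casoratian_lower (Q G : R) (hQ : 0 < Q < 1) (hG : 0 <= G) :
  exists d : R, 0 < d /\
  forall (tau : nat) (g g' Y Y' : nat -> R) (e : R),
    sol g tau Y -> sol g' tau Y' ->
    (forall j, Rabs (g j) <= G * Q ^ j) -> (forall j, Rabs (g' j) <= G * Q ^ j) ->
    0 < e <= d -> (forall j, g j - g' j = e * Q ^ j) ->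
    0 < Y 0%nat * Y' 1%nat - Y' 0%nat * Y 1%nat /\ 
    forall j, Rabs (Y j - Y' j) < / (2 * exp (G / (1 - Q))).
Proof.
  set (B := exp (G / (1 - Q))).
  assert (hB : 1 <= B).
  { unfold B. rewrite <- exp_0 at 1. apply exp_le, Rdiv_le_0_compat; lra. }
  set (c := B ^ 2 / (1 - Q)).
  assert (hc : 0 < c) by (unfold c; apply Rdiv_lt_0_compat; nra).
  assert (hh : 0 < / (2 * (c * (G + 1)))) by (apply Rinv_0_lt_compat; nra).
  destruct (pow_small Q hQ _ hh) as [j0 hj0].
  assert (hp : 0 < Q ^ S j0) by (apply pow_lt; lra).
  (* From j0 on, Y is within 1/2 of its limit pattern.  The bound d1 keeps the
     perturbation of the increments below half of one increment of size e Q^(j0+1) / 4,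
     and d2 gives the closeness of Y and Y'. *)
  set (d1 := Q ^ S j0 / 8 * (1 - Q) / (B * c)).
  assert (hd1 : 0 < d1).
  { unfold d1. apply Rdiv_lt_0_compat; nra. }
  set (d2 := / (2 * B) / (2 * c)).
  assert (hd2 : 0 < d2).
  { unfold d2. apply Rdiv_lt_0_compat; [apply Rinv_0_lt_compat; lra|lra]. }
  exists (Rmin d1 d2). split; [apply Rmin_glb_lt; assumption|].
  intros tau g g' Y Y' e hY hY' hg hg' [he hed] hgg.
  pose proof (Rmin_l d1 d2). pose proof (Rmin_r d1 d2).
  pose proof (sol_bound Q G g tau Y hQ hG hg hY) as hYb.
  pose proof (sol_bound Q G g' tau Y' hQ hG hg' hY') as hYb'.
  assert (hdiff : forall j, Rabs (Y j - Y' j) <= c * e * Q ^ j).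
  { apply (sol_diff Q G e g g' tau Y Y' hQ hG (Rlt_le _ _ he) hg hg').
    - intros j. rewrite hgg, Rabs_right; [lra|].
      apply Rle_ge, Rmult_le_pos; [lra|apply pow_le; lra].
    - exact hY.
    - exact hY'. }
  assert (hdiff1 : forall j, Rabs (Y j - Y' j) <= c * e).
  { intros j. eapply Rle_trans; [apply hdiff|].
    destruct (pow_in_unit Q hQ j). assert (0 < c * e) by nra. nra. }
  assert (hce : c * e <= / (2 * B) / 2).
  { apply Rle_trans with (c * d2); [apply Rmult_le_compat_l; lra|].
    unfold d2. right. field. lra. }
  split.
  2:{ intros j. eapply Rle_lt_trans; [apply hdiff1|].
      assert (0 < / (2 * B)) by (apply Rinv_0_lt_compat; lra). fold B. lra. }
  set (W := fun j => Y j * Y' (S j) - Y' j * Y (S j)).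
  assert (hW : forall j, W j = e * Q ^ j * (Y (S j) * Y' (S j)) + W (S j)).
  { intros j. unfold W. rewrite (proj1 hY j), (proj1 hY' j), <- hgg. ring. }
  assert (hprod : forall j, Y (S j) ^ 2 - B * (c * e) <= Y (S j) * Y' (S j)).
  { intros j. pose proof (hdiff1 (S j)) as h1. pose proof (hYb (S j)) as h2. fold B in h2.
    replace (Y (S j) * Y' (S j)) with (Y (S j) ^ 2 - Y (S j) * (Y (S j) - Y' (S j))) by ring.
    assert (Y (S j) * (Y (S j) - Y' (S j)) <= B * (c * e)); [|lra].
    eapply Rle_trans; [apply Rle_abs|]. rewrite Rabs_mult.
    apply Rmult_le_compat; auto using Rabs_pos. }
  assert (hWlim : is_lim_seq W 0).
  { apply (proj2 (is_lim_seq_abs_0 _)).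
    apply (is_lim_seq_le_le (fun _ => 0) _ (fun j => (2 * B * c * e) * Q ^ j)).
    - intros j. split; [apply Rabs_pos|]. unfold W.
      replace (Y j * Y' (S j) - Y' j * Y (S j))
        with ((Y j - Y' j) * Y (S j) + (- (Y j * (Y (S j) - Y' (S j))))) by ring.
      eapply Rle_trans; [apply Rabs_triang|]. rewrite Rabs_Ropp, !Rabs_mult.
      pose proof (hdiff j). pose proof (hdiff (S j)) as h2. pose proof (hYb j) as h3.
      pose proof (hYb (S j)) as h4. fold B in h3, h4.
      destruct (pow_in_unit Q hQ j).
      assert (hce0 : 0 < c * e) by nra.
      assert (h2' : Rabs (Y (S j) - Y' (S j)) <= c * e * Q ^ j).
      { eapply Rle_trans; [exact h2|]. apply Rmult_le_compat_l; [lra|]. simpl. nra. }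
      assert (Rabs (Y j - Y' j) * Rabs (Y (S j)) <= (c * e * Q ^ j) * B)
        by (apply Rmult_le_compat; auto using Rabs_pos).
      assert (Rabs (Y j) * Rabs (Y (S j) - Y' (S j)) <= B * (c * e * Q ^ j))
        by (apply Rmult_le_compat; auto using Rabs_pos).
      lra.
    - apply is_lim_seq_const.
    - apply geometric_limit, hQ. }
  set (k := e * (B * (c * e))).
  assert (hk : 0 <= k) by (unfold k; apply Rmult_le_pos; [lra|]; apply Rmult_le_pos; [lra|]; apply Rmult_le_pos; lra).
  assert (hstep : forall i, W (S i) - k * Q ^ i <= W i).
  { intros i. rewrite (hW i). unfold k.
    assert (h1 : 0 <= e * Q ^ i) by (apply Rmult_le_pos; [lra|apply pow_le; lra]).
    pose proof (Rmult_le_pos _ _ h1 (pow2_ge_0 (Y (S i)))).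
    pose proof (Rmult_le_compat_l _ _ _ h1 (hprod i)). lra. }
  (* Of two consecutive terms of the limit pattern one has absolute value 1. *)
  assert (hbig : exists i, (i <= S j0)%nat /\ 1 / 4 <= Y (S i) ^ 2).
  { assert (hchi : forall j, (j0 <= j)%nat -> Rabs (Y j - chi (j + tau)) <= 1 / 2).
    { intros j hj. eapply Rle_trans.
      - apply (sol_diff Q G G g (fun _ => 0) tau Y (fun j => chi (j + tau)) hQ hG hG hg).
        + intros i. rewrite Rabs_R0. apply Rmult_le_pos; [lra|apply pow_le; lra].
        + intros i. rewrite Rminus_0_r. apply hg.
        + exact hY.
        + apply chi_sol.
      - fold B. fold c. specialize (hj0 j hj).
        assert (0 < Q ^ j) by (apply pow_lt; lra).
        apply Rle_trans with (c * (G + 1) * / (2 * (c * (G + 1)))).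
        + apply Rmult_le_compat; try nra.
        + right. field. nra. }
    assert (hone : forall i, (j0 <= i)%nat -> chi (S i + tau) <> 0 -> 1 / 4 <= Y (S i) ^ 2).
    { intros i hi hne. pose proof (hchi (S i) ltac:(lia)) as hc1.
      destruct (Nat.odd (S i + tau)) eqn:ho; [elim hne; apply chi_odd, ho|].
      apply Rabs_le_between in hc1.
      destruct (chi_even _ ho) as [he1|he1]; rewrite he1 in hc1; nra. }
    destruct (Req_dec (chi (S j0 + tau)) 0) as [h0|h0].
    - exists (S j0). split; [lia|]. apply hone; [lia|].
      intros h1. pose proof (chi_abs_consecutive (S j0 + tau)) as h2.
      simpl in h0, h1, h2. rewrite h0, h1, Rabs_R0 in h2. lra.
    - exists j0. split; [lia|]. apply hone; [lia|exact h0]. }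
  destruct hbig as [i [hi hbig]].
  assert (hQi : Q ^ S j0 <= Q ^ i) by (apply pow_anti; assumption).
  pose proof (almost_decreasing Q k W hQ hstep i 0) as ha. rewrite Nat.add_0_l in ha.
  pose proof (almost_decreasing_limit Q k W hQ hk hstep hWlim (S i)) as hb.
  pose proof (hW i) as hWi. pose proof (hprod i) as hpi.
  change (0 < W 0%nat).
  assert (hQi0 : 0 < Q ^ i) by (apply pow_lt; lra).
  assert (h1 : e * Q ^ i * (1 / 4 - B * (c * e)) <= e * Q ^ i * (Y (S i) * Y' (S i))).
  { apply Rmult_le_compat_l; [apply Rmult_le_pos; lra|lra]. }
  assert (h2 : k * (Q ^ 0 - Q ^ i) / (1 - Q) + k * Q ^ i + k * Q ^ S i / (1 - Q) = k / (1 - Q)).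
  { simpl. field. lra. }
  assert (h3 : k / (1 - Q) <= e * (Q ^ S j0 / 8)).
  { unfold k. apply (Rmult_le_reg_r (1 - Q)); [lra|].
    unfold Rdiv at 1. rewrite (Rmult_assoc _ (/ (1 - Q))), Rinv_l, Rmult_1_r by lra.
    rewrite (Rmult_assoc e). apply Rmult_le_compat_l; [lra|].
    apply Rle_trans with (B * (c * d1)).
    - apply Rmult_le_compat_l; [lra|]. apply Rmult_le_compat_l; lra.
    - unfold d1. right. field. lra. }
  replace (e * Q ^ i * (1 / 4 - B * (c * e))) with (e * Q ^ i / 4 - k * Q ^ i) in h1
    by (unfold k; field).
  assert (h4 : e * Q ^ S j0 <= e * Q ^ i) by (apply Rmult_le_compat_l; lra).
  assert (0 < e * Q ^ S j0) by (apply Rmult_lt_0_compat; lra).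
  lra.
Qed.

(** If Y_0 = Y'_0 = 0, the Casoratian at [J] is
    (ratio g J - ratio g' J) Y_(J+1) Y'_(J+1), where the first factor is nonpositive
    because the continued fraction decreases with g.  By [casoratian_lower] this is
    positive, so Y_(J+1) and Y'_(J+1) have opposite signs; being close they are
    both small, against [sol_lower]. *)
Lemma zeros_separated (Q G : R) (hQ : 0 < Q < 1) (hG : 0 <= G) :
  exists d : R, 0 < d /\
  forall (J tau : nat) (g g' Y Y' : nat -> R) (e : R),
    sol g tau Y -> sol g' tau Y' ->
    (forall i, (i < J)%nat -> 2 <= g i /\ 2 <= g' i) ->
    (forall j, Rabs (g (J + j)%nat) <= G * Q ^ j) ->
    (forall j, Rabs (g' (J + j)%nat) <= G * Q ^ j) ->
    0 < e -> (forall j, g j - g' j = e * Q ^ j) -> e * Q ^ J <= d ->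
    Y 0%nat = 0 -> Y' 0%nat = 0 -> False.
Proof.
  destruct (casoratian_lower Q G hQ hG) as [d [hd hmain]].
  exists d. split; [exact hd|].
  intros J tau g g' Y Y' e hY hY' hbig hg hg' he hgg hed h0 h0'.
  assert (hQJ : 0 < Q ^ J) by (apply pow_lt; lra).
  destruct (hmain (J + tau)%nat _ _ _ _ (e * Q ^ J)
     (sol_shift g tau J Y hY) (sol_shift g' tau J Y' hY') hg hg') as [hW hclose].
  { split; [apply Rmult_lt_0_compat; lra|exact hed]. }
  { intros j. rewrite hgg, pow_add. ring. }
  assert (hb1 : forall i, (i < J)%nat -> 2 <= g i) by (intros; apply hbig; assumption).
  assert (hb2 : forall i, (i < J)%nat -> 2 <= g' i) by (intros; apply hbig; assumption).
  assert (hm : mismatch g Y J = 0).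
  { pose proof (mismatch_product g tau Y hY J hb1 J (Nat.le_refl _)) as h.
    rewrite h0 in h. symmetry in h. apply Rmult_integral in h.
    pose proof (ratio_factor_pos g J hb1). destruct h; [lra|assumption]. }
  assert (hm' : mismatch g' Y' J = 0).
  { pose proof (mismatch_product g' tau Y' hY' J hb2 J (Nat.le_refl _)) as h.
    rewrite h0' in h. symmetry in h. apply Rmult_integral in h.
    pose proof (ratio_factor_pos g' J hb2). destruct h; [lra|assumption]. }
  unfold mismatch in hm, hm'.
  assert (hr : ratio g J <= ratio g' J).
  { apply (ratio_anti g g' J hb2); [|lia]. intros i _.
    pose proof (hgg i). assert (0 < e * Q ^ i); [|lra].
    apply Rmult_lt_0_compat; [exact he|apply pow_lt; lra]. }
  pose proof (ratio_range g J hb1 J (Nat.le_refl _)) as ht.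
  cbv beta in hW, hclose. rewrite Nat.add_0_r, Nat.add_1_r in hW.
  replace (Y J) with (ratio g J * Y (S J)) in hW by lra.
  replace (Y' J) with (ratio g' J * Y' (S J)) in hW by lra.
  assert (hneg : Y (S J) * Y' (S J) < 0) by nra.
  pose proof (hclose 1%nat) as hc1. rewrite Nat.add_1_r in hc1.
  pose proof (sol_lower Q G _ _ _ hQ hG hg (sol_shift g tau J Y hY)) as hl.
  cbv beta in hl. rewrite Nat.add_0_r, Nat.add_1_r in hl.
  set (B := exp (G / (1 - Q))) in *. assert (hB : 0 < B) by apply exp_pos.
  assert (h1 : Rabs (Y (S J)) < / (2 * B)).
  { eapply Rle_lt_trans; [|exact hc1].
    destruct (Rle_lt_dec 0 (Y (S J))) as [h|h].
    - assert (Y' (S J) < 0) by nra. rewrite !Rabs_right; lra.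
    - assert (0 < Y' (S J)) by nra. rewrite !Rabs_left; lra. }
  assert (h2 : Rabs (Y J) <= Rabs (Y (S J))).
  { replace (Y J) with (ratio g J * Y (S J)) by lra.
    rewrite Rabs_mult, (Rabs_right (ratio g J)) by lra.
    pose proof (Rabs_pos (Y (S J))). nra. }
  assert (h3 : B * (Rabs (Y J) + Rabs (Y (S J))) < B * (2 * / (2 * B))).
  { apply Rmult_lt_compat_l; lra. }
  replace (B * (2 * / (2 * B))) with 1 in h3 by (field; lra). lra.
Qed.

(** * The recurrence without potential *)

(** Coefficients of the power series that solves the recurrence with zero
    potential. *)
Definition free_coef (P : R) (n : nat) : R := P ^ (n * (n - 1)) / poch (P ^ 4) n.

Lemma free_coef_S (P : R) (hP : 0 < P < 1) (n : nat) :
  free_coef P (S n) * (1 - (P ^ 4) ^ S n) = (P ^ 2) ^ n * free_coef P n.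
Proof.
  unfold free_coef. rewrite poch_S.
  pose proof (pow_in_open_unit P hP 4 ltac:(lia)) as h4.
  pose proof (poch_pos (P ^ 4) h4 n). pose proof (pow_S_lt_1 (P ^ 4) h4 n).
  replace (S n * (S n - 1))%nat with (2 * n + n * (n - 1))%nat by (destruct n; simpl; lia).
  rewrite pow_add, (pow_mult P 2 n). field. lra.
Qed.

Lemma free_coef_pos (P : R) (hP : 0 < P < 1) (n : nat) : 0 < free_coef P n.
Proof.
  pose proof (pow_in_open_unit P hP 4 ltac:(lia)) as h4.
  unfold free_coef. apply Rdiv_lt_0_compat; [apply pow_lt; lra|apply poch_pos, h4].
Qed.

Lemma free_abs_convergent (P : R) (hP : 0 < P < 1) (x : R) : 0 < x ->
  ex_series (fun n => free_coef P n * x ^ n).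
Proof.
  intros hx.
  pose proof (pow_in_open_unit P hP 4 ltac:(lia)) as h4.
  pose proof (pow_in_open_unit P hP 2 ltac:(lia)) as h2.
  assert (hpos : forall n, 0 < free_coef P n * x ^ n).
  { intros n. apply Rmult_lt_0_compat; [apply free_coef_pos, hP|apply pow_lt, hx]. }
  apply (ex_series_ext (fun n => Rabs (free_coef P n * x ^ n))).
  { intros n. apply Rabs_right. pose proof (hpos n); lra. }
  apply (ex_series_DAlembert _ 0); [lra|intros n; apply Rgt_not_eq, hpos|].
  apply (is_lim_seq_le_le (fun _ => 0) _ (fun n => (x / (1 - P ^ 4)) * (P ^ 2) ^ n)).
  - intros n. split; [apply Rabs_pos|].
    pose proof (free_coef_S P hP n) as hS. pose proof (pow_S_lt_1 (P ^ 4) h4 n) as hq.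
    pose proof (free_coef_pos P hP n) as hc.
    replace (free_coef P (S n) * x ^ S n / (free_coef P n * x ^ n))
      with (x / (1 - (P ^ 4) ^ S n) * (P ^ 2) ^ n).
    + assert (hle : (P ^ 4) ^ S n <= P ^ 4).
      { pose proof (pow_in_unit (P ^ 4) h4 n) as hn.
        change ((P ^ 4) ^ S n) with (P ^ 4 * (P ^ 4) ^ n). nra. }
      assert (h0 : 0 < x / (1 - (P ^ 4) ^ S n) * (P ^ 2) ^ n).
      { apply Rmult_lt_0_compat; [apply Rdiv_lt_0_compat; lra|apply pow_lt; lra]. }
      rewrite Rabs_right by lra.
      apply Rmult_le_compat_r; [apply pow_le; lra|].
      apply Rmult_le_compat_l; [lra|]. apply Rinv_le_contravar; lra.
    + replace (free_coef P (S n)) with ((P ^ 2) ^ n * free_coef P n / (1 - (P ^ 4) ^ S n)).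
      * change (x ^ S n) with (x * x ^ n). field.
        repeat split; try lra. apply pow_nonzero; lra.
      * rewrite <- hS. field. lra.
  - apply is_lim_seq_const.
  - apply geometric_limit, h2.
Qed.

(** The phase [tau] selects the terms of one parity, with alternating signs, of the
    q-exponential series with coefficients [free_coef]; shifting the phase by one is
    what the recurrence does, which is why a single formula serves all indices. *)
Definition free (P : R) (tau : nat) (x : R) : R :=
  Series (fun n => chi (n + tau) * (free_coef P n * x ^ n)).

Lemma free_convergent (P : R) (hP : 0 < P < 1) (tau : nat) (x : R) : 0 < x ->
  ex_series (fun n => chi (n + tau) * (free_coef P n * x ^ n)).
Proof.
  intros hx. apply (@ex_series_le R_AbsRing R_CompleteNormedModule _ (fun n => free_coef P n * x ^ n)).
  - intros n. change (Rabs (chi (n + tau) * (free_coef P n * x ^ n)) <= free_coef P n * x ^ n).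
    assert (0 < free_coef P n * x ^ n)
      by (apply Rmult_lt_0_compat; [apply free_coef_pos, hP|apply pow_lt, hx]).
    rewrite Rabs_mult, (Rabs_right (free_coef P n * x ^ n)) by lra.
    pose proof (chi_abs_le (n + tau)). nra.
  - apply free_abs_convergent; assumption.
Qed.

(** The factor 1 - q^(n+1) produced by free tau x + free (tau + 2) (q x) cancels
    the last factor of (q; q)_(n+1), leaving the series of phase tau + 1. *)
Lemma free_recurrence (P : R) (hP : 0 < P < 1) (tau : nat) (x : R) : 0 < x ->
  free P tau x = x * free P (S tau) (P ^ 2 * x) - free P (S (S tau)) (P ^ 4 * x).
Proof.
  intros hx.
  assert (h2 : 0 < P ^ 2 * x) by (apply Rmult_lt_0_compat; [apply pow_lt|]; lra).
  assert (h4 : 0 < P ^ 4 * x) by (apply Rmult_lt_0_compat; [apply pow_lt|]; lra).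
  assert (hsum : free P tau x + free P (S (S tau)) (P ^ 4 * x) =
                 x * free P (S tau) (P ^ 2 * x)); [|lra].
  unfold free.
  rewrite <- Series_plus by (apply free_convergent; assumption).
  rewrite <- Series_scal_l.
  rewrite Series_incr_1.
  - replace (chi (0 + tau) * _ + _) with 0.
    2:{ simpl. ring. }
    rewrite Rplus_0_l. apply Series_ext. intros n.
    replace (S n + S (S tau))%nat with (S (S (S n + tau))) by lia.
    rewrite chi_SS.
    replace (n + S tau)%nat with (S n + tau)%nat by lia.
    rewrite !Rpow_mult_distr.
    transitivity (chi (S n + tau) * (free_coef P (S n) * (1 - (P ^ 4) ^ S n)) * x ^ S n); [ring|].
    rewrite free_coef_S by exact hP. change (x ^ S n) with (x * x ^ n). ring.
  - apply (ex_series_plus (V := R_NormedModule)); apply free_convergent; assumption.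
Qed.

Lemma free_near_zero (P : R) (hP : 0 < P < 1) (x : R) : 0 < x ->
  exists M, forall tau y, 0 < y <= x -> Rabs (free P tau y - chi tau) <= M * y.
Proof.
  intros hx.
  pose proof (free_abs_convergent P hP x hx) as hc.
  apply ex_series_incr_1 in hc.
  exists (Series (fun n => free_coef P (S n) * x ^ S n) / x).
  intros tau y hy. unfold free.
  rewrite Series_incr_1 by (apply free_convergent; [exact hP|lra]).
  replace (chi (0 + tau) * (free_coef P 0 * y ^ 0)) with (chi tau).
  2:{ unfold free_coef, poch. simpl. field. }
  replace (chi tau + Series (fun k => chi (S k + tau) * (free_coef P (S k) * y ^ S k)) - chi tau)
    with (Series (fun k => chi (S k + tau) * (free_coef P (S k) * y ^ S k))) by ring.
  assert (hterm : forall n, Rabs (chi (S n + tau) * (free_coef P (S n) * y ^ S n)) <=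
                   free_coef P (S n) * x ^ S n / x * y).
  { intros n. pose proof (free_coef_pos P hP (S n)) as hf.
    assert (hyn : 0 < y ^ n <= x ^ n) by (split; [apply pow_lt; lra|apply pow_incr; lra]).
    assert (h0 : 0 < free_coef P (S n) * y ^ S n)
      by (apply Rmult_lt_0_compat; [lra|apply pow_lt; lra]).
    rewrite Rabs_mult, (Rabs_right (free_coef P (S n) * _)) by lra.
    pose proof (chi_abs_le (S n + tau)).
    apply Rle_trans with (free_coef P (S n) * y ^ S n); [nra|].
    replace (free_coef P (S n) * x ^ S n / x * y) with (free_coef P (S n) * (y * x ^ n))
      by (simpl; field; lra).
    apply Rmult_le_compat_l; [lra|]. simpl. nra. }
  assert (hex : ex_series (fun n => free_coef P (S n) * x ^ S n / x * y)).
  { apply (ex_series_ext (fun n => scal (/ x * y) (free_coef P (S n) * x ^ S n))).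
    - intros n. unfold scal; simpl; unfold mult; simpl. unfold Rdiv. ring.
    - apply (@ex_series_scal R_AbsRing R_NormedModule). exact hc. }
  eapply Rle_trans; [apply Series_Rabs|].
  - apply (@ex_series_le R_AbsRing R_CompleteNormedModule _ (fun n => free_coef P (S n) * x ^ S n / x * y)); [|exact hex].
    intros n. change (Rabs (Rabs (chi (S n + tau) * (free_coef P (S n) * y ^ S n))) <=
                   free_coef P (S n) * x ^ S n / x * y).
    rewrite Rabs_Rabsolu. apply hterm.
  - eapply Rle_trans.
    + apply Series_le; [|exact hex]. intros n. split; [apply Rabs_pos|apply hterm].
    + rewrite Series_scal_r. unfold Rdiv. rewrite Series_scal_r. apply Rle_refl.
Qed.

Lemma free_sol (P : R) (hP : 0 < P < 1) (tau : nat) (x : R) : 0 < x ->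
  sol (fun j => x * (P ^ 2) ^ j) tau (fun j => free P (j + tau) (x * (P ^ 2) ^ j)).
Proof.
  intros hx.
  pose proof (pow_in_open_unit P hP 2 ltac:(lia)) as h2.
  split.
  - intros j. rewrite (free_recurrence P hP).
    + simpl (S j + tau)%nat. simpl (S (S j) + tau)%nat.
      replace (P ^ 2 * (x * (P ^ 2) ^ j)) with (x * (P ^ 2) ^ S j)
        by (change ((P ^ 2) ^ S j) with (P ^ 2 * (P ^ 2) ^ j); ring).
      replace (P ^ 4 * (x * (P ^ 2) ^ j)) with (x * (P ^ 2) ^ S (S j))
        by (change ((P ^ 2) ^ S (S j)) with (P ^ 2 * (P ^ 2 * (P ^ 2) ^ j)); ring).
      reflexivity.
    + apply Rmult_lt_0_compat; [exact hx|apply pow_lt; lra].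
  - destruct (free_near_zero P hP x hx) as [M hM].
    apply (proj2 (is_lim_seq_abs_0 _)).
    apply (is_lim_seq_le_le (fun _ => 0) _ (fun j => (M * x) * (P ^ 2) ^ j)).
    + intros j. split; [apply Rabs_pos|].
      rewrite Rmult_assoc. apply hM.
      destruct (pow_in_unit (P ^ 2) h2 j). nra.
    + apply is_lim_seq_const.
    + apply geometric_limit, h2.
Qed.

Lemma free_theta (P : R) (hP : 0 < P < 1) (tau N : nat) (w : R) : 0 < w ->
  is_series (theta_term P tau N w)
    (poch (P ^ 4) N * P ^ (N * N) / w ^ N * free P tau (w * P / P ^ (2 * N))).
Proof.
  intros hw.
  assert (hx : 0 < w * P / P ^ (2 * N)).
  { apply Rdiv_lt_0_compat; [nra|apply pow_lt; lra]. }
  set (x := w * P / P ^ (2 * N)) in *.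
  apply (is_series_ext (fun n => scal (poch (P ^ 4) N * P ^ (N * N) / w ^ N)
            (chi (n + tau) * (free_coef P n * x ^ n)))).
  - intros n. change (poch (P ^ 4) N * P ^ (N * N) / w ^ N *
      (chi (n + tau) * (free_coef P n * x ^ n)) = theta_term P tau N w n).
    unfold theta_term, free_coef.
    pose proof (pow_in_open_unit P hP 4 ltac:(lia)) as h4.
    pose proof (poch_pos (P ^ 4) h4 n).
    assert (hpw : forall k, P ^ k <> 0) by (intros; apply pow_nonzero; lra).
    assert (hww : w ^ N <> 0) by (apply pow_nonzero; lra).
    assert (hd : P ^ (dist n N * dist n N) * P ^ (2 * n * N) =
                 P ^ (N * N) * P ^ (n * (n - 1)) * P ^ n).
    { rewrite <- !pow_add. f_equal. pose proof (dist_sq n N). destruct n; simpl in *; nia. }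
    unfold x, Rdiv. rewrite !Rpow_mult_distr, pow_inv, <- pow_mult.
    replace (2 * N * n)%nat with (2 * n * N)%nat by lia.
    apply (Rmult_eq_reg_r (P ^ (2 * n * N))); [|apply hpw].
    transitivity (poch (P ^ 4) N * / w ^ N * chi (n + tau) * / poch (P ^ 4) n * w ^ n *
       (P ^ (N * N) * P ^ (n * (n - 1)) * P ^ n)).
    + field. repeat split; auto; lra.
    + rewrite <- hd. ring.
  - apply (is_series_scal_l (V := R_NormedModule)).
    apply Series_correct, free_convergent; assumption.
Qed.

(** * Comparison with the theta product in a window *)

Definition coef (P b : R) (s : nat -> R) (lam : R) (j : nat) : R :=
  b * (P ^ 2) ^ j * (lam - s j).

(** In the window of [N] the products lam b Q^i are large up to index N - L and
    bounded afterwards, with bounds depending on [L] only. *)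
Lemma window_scale (P b lam : R) (L N : nat) (hP : 0 < P < 1) (hb : 0 < b)
  (hL : 8 * P ^ (2 * L) <= P) (hLN : (L <= N)%nat)
  (hw : P ^ 2 <= lam * b * P ^ (2 * N) / P <= / P ^ 2) :
  0 < lam * b /\ P ^ 3 <= lam * b * P ^ (2 * N) /\
  (forall i, (i < N - L)%nat -> 8 <= lam * b * (P ^ 2) ^ i) /\
  lam * b * (P ^ 2) ^ (N - L) <= / (P * P ^ (2 * L)).
Proof.
  assert (hp : forall k, 0 < P ^ k) by (intros; apply pow_lt; lra).
  set (x := lam * b) in *. destruct hw as [h1 h2].
  apply (Rmult_le_compat_r P) in h1; [|lra]. apply (Rmult_le_compat_r P) in h2; [|lra].
  replace (x * P ^ (2 * N) / P * P) with (x * P ^ (2 * N)) in h1, h2 by (field; lra).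
  replace (P ^ 2 * P) with (P ^ 3) in h1 by ring.
  replace (/ P ^ 2 * P) with (/ P) in h2 by (field; lra).
  assert (hx : 0 < x).
  { apply (Rmult_lt_reg_r (P ^ (2 * N))); [apply hp|]. rewrite Rmult_0_l.
    pose proof (hp 3%nat). lra. }
  split; [exact hx|]. split; [exact h1|]. split.
  - intros i hi. rewrite <- pow_mult.
    replace (2 * N)%nat with (2 * i + 2 * (N - i))%nat in h1 by lia.
    rewrite pow_add in h1.
    assert (h3 : P ^ (2 * (N - i)) <= P ^ (2 * L + 2)) by (apply pow_anti; [exact hP|lia]).
    rewrite (pow_add P (2 * L) 2) in h3.
    assert (h4 : 8 * P ^ (2 * (N - i)) <= P ^ 3).
    { pose proof (hp 2%nat). replace (P ^ 3) with (P * P ^ 2) by ring. nra. }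
    pose proof (hp (2 * i)%nat) as hi0.
    assert (h5 : 8 * P ^ 3 <= (x * P ^ (2 * i)) * P ^ 3).
    { assert (0 < x * P ^ (2 * i)) by nra.
      apply Rle_trans with (8 * (x * P ^ (2 * i) * P ^ (2 * (N - i)))); [lra|nra]. }
    pose proof (hp 3%nat). nra.
  - rewrite <- pow_mult.
    replace (2 * N)%nat with (2 * (N - L) + 2 * L)%nat in h2 by lia.
    rewrite pow_add in h2. pose proof (hp (2 * L)%nat).
    apply (Rmult_le_reg_r (P ^ (2 * L))); [lra|].
    rewrite Rinv_mult, Rmult_assoc, (Rmult_assoc (/ P)), Rinv_l by lra. lra.
Qed.

Lemma window_coef (P b smax lam : R) (L N : nat) (s : nat -> R) (hP : 0 < P < 1) (hb : 0 < b)
  (hS : 0 <= smax) (hs : forall j, Rabs (s j) <= smax)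
  (hL : 8 * P ^ (2 * L) <= P) (hLN : (L <= N)%nat) (hN : 2 * smax * b * P ^ (2 * N) <= P ^ 3)
  (hw : P ^ 2 <= lam * b * P ^ (2 * N) / P <= / P ^ 2) :
  2 * smax <= lam /\
  (forall i, lam * b * (P ^ 2) ^ i / 2 <= coef P b s lam i) /\
  (forall j, Rabs (coef P b s lam (N - L + j)) <= 2 / (P * P ^ (2 * L)) * (P ^ 2) ^ j).
Proof.
  destruct (window_scale P b lam L N hP hb hL hLN hw) as [h1 [h2 [h3 h4]]].
  pose proof (pow_in_open_unit P hP 2 ltac:(lia)) as hP2.
  assert (hlam : 2 * smax <= lam).
  { apply (Rmult_le_reg_r (b * P ^ (2 * N))).
    - apply Rmult_lt_0_compat; [lra|apply pow_lt; lra].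
    - lra. }
  split; [exact hlam|].
  assert (hp : forall i, 0 < b * (P ^ 2) ^ i).
  { intros i. apply Rmult_lt_0_compat; [lra|apply pow_lt; lra]. }
  split.
  - intros i. unfold coef. pose proof (hp i). pose proof (hs i) as hi.
    apply Rabs_le_between in hi. nra.
  - intros j. unfold coef. rewrite Rabs_mult, (Rabs_right (b * _)) by (pose proof (hp (N - L + j)%nat); lra).
    assert (hi : Rabs (lam - s (N - L + j)%nat) <= 2 * lam).
    { pose proof (hs (N - L + j)%nat) as hi. apply Rabs_le_between in hi.
      apply Rabs_le. lra. }
    rewrite pow_add. pose proof (pow_lt (P ^ 2) j ltac:(lra)).
    apply Rle_trans with (2 * (lam * b * (P ^ 2) ^ (N - L)) * (P ^ 2) ^ j).
    + pose proof (hp (N - L)%nat).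
      replace (2 * (lam * b * (P ^ 2) ^ (N - L)) * (P ^ 2) ^ j)
        with (b * ((P ^ 2) ^ (N - L) * (P ^ 2) ^ j) * (2 * lam)) by ring.
      apply Rmult_le_compat_l; [|exact hi].
      replace (b * ((P ^ 2) ^ (N - L) * (P ^ 2) ^ j)) with (b * (P ^ 2) ^ (N - L) * (P ^ 2) ^ j) by ring.
      nra.
    + apply Rmult_le_compat_r; [lra|]. unfold Rdiv. lra.
Qed.

(** A step of the continued fraction divides the error by at least 8, and an error e
    relative to the coefficient x enters with a factor at most 8 / x. *)
Lemma ratio_close (g f : nat -> R) (e : R) (J : nat) (he : 0 <= e)
  (hf : forall i, (i < J)%nat -> 8 <= f i)
  (hg : forall i, (i < J)%nat -> f i / 2 <= g i)
  (hd : forall i, (i < J)%nat -> Rabs (g i - f i) <= f i * e) :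
  forall i, (i <= J)%nat -> Rabs (ratio g i - ratio f i) <= 4 * e.
Proof.
  assert (hg2 : forall i, (i < J)%nat -> 2 <= g i).
  { intros i hi. pose proof (hf i hi). pose proof (hg i hi). lra. }
  assert (hf2 : forall i, (i < J)%nat -> 2 <= f i).
  { intros i hi. pose proof (hf i hi). lra. }
  induction i as [|i IH]; intros hi.
  - simpl. rewrite Rminus_0_r, Rabs_R0. lra.
  - specialize (IH ltac:(lia)).
    pose proof (ratio_range g J hg2 i ltac:(lia)).
    pose proof (ratio_range f J hf2 i ltac:(lia)).
    pose proof (hf i hi) as h1. pose proof (hg i hi) as h2. pose proof (hd i hi) as h3.
    simpl (ratio _ (S i)).
    set (t := ratio g i) in *. set (u := ratio f i) in *.
    set (x := f i) in *. set (y := g i) in *.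
    replace (/ (y - t) - / (x - u)) with ((((t - u) - (y - x)) / ((y - t) * (x - u)))).
    2:{ field. split; lra. }
    assert (hden : x * x / 8 <= (y - t) * (x - u)).
    { replace (x * x / 8) with ((x / 4) * (x / 2)) by field.
      apply Rmult_le_compat; lra. }
    assert (hden0 : 0 < (y - t) * (x - u)) by nra.
    unfold Rdiv. rewrite Rabs_mult, Rabs_inv, (Rabs_right ((y - t) * (x - u))) by lra.
    apply (Rmult_le_reg_r ((y - t) * (x - u))); [lra|].
    rewrite Rmult_assoc, Rinv_l, Rmult_1_r by lra.
    pose proof (Rabs_triang (t - u) (- (y - x))) as h4. rewrite Rabs_Ropp in h4.
    apply Rle_trans with (4 * e + x * e); [unfold Rminus at 1; lra|].
    apply Rle_trans with (4 * e * (x * x / 8)); [|apply Rmult_le_compat_l; lra].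
    assert (4 + x <= 4 * (x * x / 8)) by nra. nra.
Qed.

Lemma rprod_scale (c : R) (f : nat -> R) (n : nat) :
  rprod (fun i => c * f i) n = c ^ n * rprod f n.
Proof.
  induction n as [|n IH]; simpl; [ring|]. rewrite IH. ring.
Qed.

Lemma rprod_pow (P : R) (n : nat) : rprod (fun i => (P ^ 2) ^ i) n = P ^ (n * (n - 1)).
Proof.
  induction n as [|n IH]; [reflexivity|].
  change (rprod (fun i => (P ^ 2) ^ i) (S n))
    with (rprod (fun i => (P ^ 2) ^ i) n * (P ^ 2) ^ n).
  rewrite IH, <- pow_mult, <- pow_add. f_equal. destruct n; simpl; lia.
Qed.

(** Y_0 is a positive factor times its mismatch at J = N - L, and likewise for the
    free solution.  The two mismatches differ by O(1/lam) = O(Q^N), and for the free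
    one the factor is comparable with the normalization of the theta series. *)
Lemma window_estimate (P b smax : R) (L : nat) (hP : 0 < P < 1) (hb : 0 < b) (hS : 0 <= smax)
  (hL : 8 * P ^ (2 * L) <= P) :
  exists C c, 0 <= C /\ 0 < c /\
  forall tau n o, (o <= 1)%nat -> Nat.odd (o + tau) = false ->
  let N := (2 * n + 1 + o)%nat in
  (L <= N)%nat -> 2 * smax * b * P ^ (2 * N) <= P ^ 3 ->
  exists sg, (sg = 1 \/ sg = -1) /\
  forall lam s Y,
    let w := lam * b * P ^ (2 * N) / P in
    P ^ 2 <= w <= / P ^ 2 -> (forall j, Rabs (s j) <= smax) ->
    sol (coef P b s lam) tau Y ->
    exists m A, 0 < m /\ c <= A /\
      Rabs (sg * m * Y 0%nat - A * (w - / w)) <= C * P ^ (2 * N).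
Proof.
  destruct (theta_estimate P hP) as [C0 [c [hC0 [hc htheta]]]].
  pose proof (pow_in_open_unit P hP 2 ltac:(lia)) as h2.
  pose proof (pow_in_open_unit P hP 4 ltac:(lia)) as h4.
  assert (hp : forall k, 0 < P ^ k) by (intros; apply pow_lt; lra).
  set (G := 2 / (P * P ^ (2 * L))).
  assert (hG : 0 < G).
  { unfold G. apply Rdiv_lt_0_compat; [lra|]. apply Rmult_lt_0_compat; [lra|apply hp]. }
  set (B := exp (G / (1 - P ^ 2))). assert (hB : 0 < B) by apply exp_pos.
  set (D := B ^ 2 / (1 - P ^ 2) * G).
  assert (hD : 0 < D).
  { unfold D. apply Rmult_lt_0_compat; [apply Rdiv_lt_0_compat|]; nra. }
  (* D bounds the differences of the two solutions at J and J + 1, and 4 the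
     difference of the ratios, all in units of smax / lam. *)
  set (C1 := 2 * D + 4 * B).
  assert (hC1 : 0 < C1) by (unfold C1; lra).
  assert (hiP : forall k, 0 < / P ^ k) by (intros; apply Rinv_0_lt_compat, hp).
  exists (C0 + / P ^ (2 * L) * (C1 * (smax * b / P ^ 3))), c.
  assert (hcst : 0 <= / P ^ (2 * L) * (C1 * (smax * b / P ^ 3))).
  { apply Rmult_le_pos; [left; apply hiP|]. apply Rmult_le_pos; [lra|].
    apply Rmult_le_pos; [nra|left; apply hiP]. }
  split; [lra|]. split; [exact hc|].
  intros tau n o ho hpar N hLN hNS.
  destruct (htheta tau n o ho hpar) as [sg [hsg hth]]. fold N in hth.
  exists sg. split; [exact hsg|].
  intros lam s Y w hw hs hY.
  destruct (window_scale P b lam L N hP hb hL hLN hw) as [hx [hxN [hx8 hxJ]]].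
  destruct (window_coef P b smax lam L N s hP hb hS hs hL hLN hNS hw) as [hlam [hgl hgu]].
  set (x := lam * b) in *. set (J := (N - L)%nat) in *.
  assert (hlam0 : 0 < lam) by (unfold x in hx; nra).
  assert (hw0 : 0 < w) by (pose proof (hp 2%nat); lra).
  assert (hxw : w * P / P ^ (2 * N) = x).
  { unfold w. field. split; [lra|apply pow_nonzero; lra]. }
  set (g := coef P b s lam) in *. set (f := fun j => x * (P ^ 2) ^ j).
  set (Yf := fun j => free P (j + tau) (x * (P ^ 2) ^ j)).
  assert (hYf : sol f tau Yf) by (apply free_sol; assumption).
  set (e := smax / lam). assert (he : 0 <= e) by (apply Rdiv_le_0_compat; lra).
  assert (hf0 : forall j, 0 < f j).
  { intros j. apply Rmult_lt_0_compat; [exact hx|apply pow_lt; lra]. }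
  assert (hgf : forall j, Rabs (g j - f j) <= f j * e).
  { intros j.
    replace (g j - f j) with (- (f j * (s j / lam))) by (unfold g, f, coef, x; field; lra).
    rewrite Rabs_Ropp, Rabs_mult, (Rabs_right (f j)) by (pose proof (hf0 j); lra).
    apply Rmult_le_compat_l; [pose proof (hf0 j); lra|].
    unfold e, Rdiv. rewrite Rabs_mult, Rabs_inv, (Rabs_right lam) by lra.
    apply Rmult_le_compat_r; [left; apply Rinv_0_lt_compat; lra|apply hs]. }
  assert (hfJ : forall j, f (J + j)%nat <= G * (P ^ 2) ^ j).
  { intros j. unfold f. rewrite pow_add, <- Rmult_assoc.
    apply Rmult_le_compat_r; [apply pow_le; lra|].
    eapply Rle_trans; [exact hxJ|]. unfold G, Rdiv.
    pose proof (Rinv_0_lt_compat (P * P ^ (2 * L))) as hh.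
    specialize (hh ltac:(apply Rmult_lt_0_compat; [lra|apply hp])). lra. }
  assert (hfJ' : forall j, Rabs (f (J + j)%nat) <= G * (P ^ 2) ^ j).
  { intros j. rewrite Rabs_right by (pose proof (hf0 (J + j)%nat); lra). apply hfJ. }
  assert (hdiff : forall j, Rabs (Y (J + j)%nat - Yf (J + j)%nat) <= D * e).
  { intros j. eapply Rle_trans.
    - apply (sol_diff (P ^ 2) G (G * e) _ _ (J + tau)
               (fun j => Y (J + j)%nat) (fun j => Yf (J + j)%nat) h2 (Rlt_le _ _ hG)
               ltac:(apply Rmult_le_pos; lra) hgu hfJ').
      + intros i. eapply Rle_trans; [apply hgf|].
        pose proof (hfJ i). nra.
      + apply (sol_shift g tau J Y hY).
      + apply (sol_shift f tau J Yf hYf).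
    - fold B. destruct (pow_in_unit (P ^ 2) h2 j). unfold D.
      replace (B ^ 2 / (1 - P ^ 2) * (G * e) * (P ^ 2) ^ j) with (D * e * (P ^ 2) ^ j)
        by (unfold D; ring). fold D.
      assert (0 <= D * e) by nra. nra. }
  assert (hf8 : forall i, (i < J)%nat -> 8 <= f i) by (intros i hi; apply hx8, hi).
  assert (hf2 : forall i, (i < J)%nat -> 2 <= f i) by (intros i hi; pose proof (hf8 i hi); lra).
  assert (hg2 : forall i, (i < J)%nat -> 2 <= g i).
  { intros i hi. pose proof (hf8 i hi). pose proof (hgl i). unfold f in *. lra. }
  assert (hrc : Rabs (ratio g J - ratio f J) <= 4 * e).
  { apply (ratio_close g f e J he hf8); [intros i _; apply hgl|intros i _; apply hgf|lia]. }
  assert (hmm : Rabs (mismatch g Y J - mismatch f Yf J) <= C1 * e).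
  { unfold mismatch.
    pose proof (hdiff 0%nat) as d0. pose proof (hdiff 1%nat) as d1.
    rewrite Nat.add_0_r in d0. rewrite Nat.add_1_r in d1.
    pose proof (ratio_range g J hg2 J (Nat.le_refl _)) as ht.
    pose proof (sol_bound (P ^ 2) G _ _ _ h2 (Rlt_le _ _ hG) hfJ' (sol_shift f tau J Yf hYf) 1%nat) as hb1.
    cbv beta in hb1. rewrite Nat.add_1_r in hb1. fold B in hb1.
    replace (Y J - ratio g J * Y (S J) - (Yf J - ratio f J * Yf (S J)))
      with ((Y J - Yf J) + (- (ratio g J * (Y (S J) - Yf (S J))) +
            - ((ratio g J - ratio f J) * Yf (S J)))) by ring.
    eapply Rle_trans; [apply Rabs_triang|].
    eapply Rle_trans; [apply Rplus_le_compat_l, Rabs_triang|].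
    rewrite !Rabs_Ropp, !Rabs_mult, (Rabs_right (ratio g J)) by lra.
    assert (k1 : ratio g J * Rabs (Y (S J) - Yf (S J)) <= D * e).
    { pose proof (Rabs_pos (Y (S J) - Yf (S J))). nra. }
    assert (k2 : Rabs (ratio g J - ratio f J) * Rabs (Yf (S J)) <= 4 * e * B).
    { apply Rmult_le_compat; auto using Rabs_pos. }
    unfold C1. lra. }
  set (Pf := rprod (fun i => f i - ratio f i) J).
  set (Pg := rprod (fun i => g i - ratio g i) J).
  assert (hPf : 0 < Pf) by (apply ratio_factor_pos, hf2).
  assert (hPg : 0 < Pg) by (apply ratio_factor_pos, hg2).
  set (kap := poch (P ^ 4) N * P ^ (N * N) / w ^ N).
  pose proof (poch_pos (P ^ 4) h4 N) as hpoch.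
  assert (hkap : 0 < kap).
  { unfold kap. apply Rdiv_lt_0_compat; [|apply pow_lt, hw0].
    apply Rmult_lt_0_compat; [lra|apply hp]. }
  assert (hM : kap * Pf <= / P ^ (2 * L)).
  { assert (h5 : Pf <= rprod f J).
    { apply rprod_le. intros i hi. pose proof (ratio_range f J hf2 i ltac:(lia)).
      pose proof (hf2 i hi). lra. }
    unfold f in h5. rewrite (rprod_scale x), rprod_pow in h5.
    apply Rle_trans with (kap * (x ^ J * P ^ (J * (J - 1)))).
    { apply Rmult_le_compat_l; [lra|exact h5]. }
    assert (h6 : kap * (x ^ J * P ^ (J * (J - 1))) =
                 poch (P ^ 4) N * (P ^ (dist J N * dist J N) * (w ^ J / w ^ N))).
    { assert (hd : P ^ (dist J N * dist J N) * P ^ (2 * J * N) =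
                 P ^ (N * N) * P ^ (J * (J - 1)) * P ^ J).
      { rewrite <- !pow_add. f_equal. pose proof (dist_sq J N). destruct J; simpl in *; nia. }
      apply (Rmult_eq_reg_r (P ^ (2 * J * N))); [|apply Rgt_not_eq, hp].
      transitivity (poch (P ^ 4) N * (w ^ J / w ^ N) *
                    (P ^ (dist J N * dist J N) * P ^ (2 * J * N))); [|ring].
      rewrite hd. unfold kap. rewrite <- hxw. unfold Rdiv.
      rewrite !Rpow_mult_distr, pow_inv, <- pow_mult.
      replace (2 * N * J)%nat with (2 * J * N)%nat by lia.
      field. split; apply pow_nonzero; lra. }
    rewrite h6. pose proof (power_ratio_bound P w hP hw J N) as [h7 h8].
    replace (dist J N) with L in * by (unfold dist, J; lia).
    destruct (pow_in_unit P hP (L * L)) as [h9 h10].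
    rewrite <- (Rmult_1_l (/ P ^ (2 * L))).
    apply Rmult_le_compat; [lra|nra|lra|]. nra. }
  destruct (hth w (kap * Yf 0%nat) hw) as [A [hA hest]].
  { unfold Yf. simpl (0 + tau)%nat. rewrite Rmult_1_r, <- hxw.
    apply free_theta; assumption. }
  exists (kap * Pf / Pg), A.
  split; [apply Rdiv_lt_0_compat; [apply Rmult_lt_0_compat|]; assumption|].
  split; [exact hA|].
  rewrite (mismatch_product f tau Yf hYf J hf2 J (Nat.le_refl _)) in hest. fold Pf in hest.
  rewrite (mismatch_product g tau Y hY J hg2 J (Nat.le_refl _)). fold Pg.
  set (mg := mismatch g Y J) in *. set (mf := mismatch f Yf J) in *.
  replace (sg * (kap * Pf / Pg) * (Pg * mg) - A * (w - / w))
    with ((sg * (kap * (Pf * mf)) - A * (w - / w)) + sg * (kap * Pf * (mg - mf)))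
    by (field; lra).
  eapply Rle_trans; [apply Rabs_triang|].
  assert (hsg1 : Rabs sg = 1).
  { destruct hsg as [-> | ->]; [apply Rabs_R1|rewrite Rabs_left; lra]. }
  rewrite (Rabs_mult sg), hsg1, Rmult_1_l, Rabs_mult, (Rabs_right (kap * Pf)).
  2:{ apply Rle_ge, Rlt_le, Rmult_lt_0_compat; assumption. }
  rewrite Rmult_plus_distr_r. apply Rplus_le_compat.
  - eapply Rle_trans; [exact hest|]. apply Rmult_le_compat_l; [lra|].
    apply pow_anti; [exact hP|lia].
  - rewrite (Rmult_assoc (/ P ^ (2 * L))). apply Rmult_le_compat; [| |exact hM|].
    + left; apply Rmult_lt_0_compat; assumption.
    + apply Rabs_pos.
    + eapply Rle_trans; [exact hmm|]. rewrite Rmult_assoc. apply Rmult_le_compat_l; [lra|].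
      unfold e. apply (Rmult_le_reg_r (lam * P ^ 3)).
      { apply Rmult_lt_0_compat; [lra|apply hp]. }
      replace (smax / lam * (lam * P ^ 3)) with (smax * P ^ 3) by (field; lra).
      replace (smax * b / P ^ 3 * P ^ (2 * N) * (lam * P ^ 3))
        with (smax * (x * P ^ (2 * N))) by (unfold x; field; lra).
      apply Rmult_le_compat_l; [exact hS|exact hxN].
Qed.

(** * Positive zeros *)

Lemma coef_diff (P b : R) (s : nat -> R) (l l' : R) (j : nat) :
  coef P b s l j - coef P b s l' j = b * (l - l') * (P ^ 2) ^ j.
Proof. unfold coef. ring. Qed.

Lemma coef_bound (P b smax M l : R) (s : nat -> R) (hP : 0 < P < 1) (hb : 0 < b)
  (hs : forall j, Rabs (s j) <= smax) (hl : Rabs l <= M) (j : nat) :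
  Rabs (coef P b s l j) <= b * (M + smax) * (P ^ 2) ^ j.
Proof.
  unfold coef. pose proof (pow_lt (P ^ 2) j ltac:(apply pow_lt; lra)).
  assert (0 < b * (P ^ 2) ^ j) by nra.
  rewrite Rabs_mult, (Rabs_right (b * _)) by lra.
  replace (b * (M + smax) * (P ^ 2) ^ j) with (b * (P ^ 2) ^ j * (M + smax)) by ring.
  apply Rmult_le_compat_l; [lra|].
  unfold Rminus. eapply Rle_trans; [apply Rabs_triang|]. rewrite Rabs_Ropp.
  pose proof (hs j). lra.
Qed.

Lemma value_continuous (P b smax : R) (s : nat -> R) (tau : nat) (Y : R -> nat -> R)
  (hP : 0 < P < 1) (hb : 0 < b) (hs : forall j, Rabs (s j) <= smax)
  (hY : forall l, sol (coef P b s l) tau (Y l)) : continuity (fun l => Y l 0%nat).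
Proof.
  intros l0.
  pose proof (pow_in_open_unit P hP 2 ltac:(lia)) as h2.
  pose proof (Rabs_pos l0). pose proof (Rle_trans _ _ _ (Rabs_pos _) (hs 0%nat)).
  set (G := b * (Rabs l0 + 1 + smax)).
  assert (hG : 0 <= G) by (unfold G; apply Rmult_le_pos; lra).
  set (C := exp (G / (1 - P ^ 2)) ^ 2 / (1 - P ^ 2) * b).
  assert (hC : 0 < C).
  { unfold C. apply Rmult_lt_0_compat; [|lra]. apply Rdiv_lt_0_compat; [|lra].
    apply pow_lt, exp_pos. }
  intros eps heps.
  exists (Rmin 1 (eps / C)). split; [apply Rmin_glb_lt; [lra|apply Rdiv_lt_0_compat; lra]|].
  intros l [_ hl]. simpl in hl |- *. unfold Rdist in *.
  pose proof (Rmin_l 1 (eps / C)). pose proof (Rmin_r 1 (eps / C)).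
  eapply Rle_lt_trans.
  - apply (sol_diff (P ^ 2) G (b * Rabs (l - l0)) (coef P b s l) (coef P b s l0) tau
             (Y l) (Y l0) h2 hG).
    + apply Rmult_le_pos; [lra|apply Rabs_pos].
    + intros j. apply coef_bound; auto.
      pose proof (Rabs_triang_inv l l0). lra.
    + intros j. apply coef_bound; auto. lra.
    + intros j. rewrite coef_diff, !Rabs_mult, (Rabs_right b), (Rabs_right (_ ^ j)); [lra| |lra].
      apply Rle_ge, pow_le; lra.
    + apply hY.
    + apply hY.
  - simpl (_ ^ 0). rewrite Rmult_1_r, <- Rmult_assoc. fold C.
    apply Rlt_le_trans with (C * (eps / C)); [apply Rmult_lt_compat_l; lra|].
    right. field. lra.
Qed.

(** Consecutive windows of the same parity overlap at their end points. *)
Lemma covering (P X : R) (hP : 0 < P < 1) (hX : P ^ 2 <= X) :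
  exists m : nat, P ^ 2 <= X * P ^ (4 * m) <= / P ^ 2.
Proof.
  assert (hp : forall k, 0 < P ^ k) by (intros; apply pow_lt; lra).
  assert (hstep : forall n : nat, X * P ^ (4 * n) <= / P ^ 2 ->
            exists m : nat, P ^ 2 <= X * P ^ (4 * m) <= / P ^ 2).
  { induction n as [|n IH]; intros h.
    - exists 0%nat. split; [|exact h]. simpl (P ^ (4 * 0)). lra.
    - destruct (Rle_lt_dec (X * P ^ (4 * n)) (/ P ^ 2)) as [h'|h']; [exact (IH h')|].
      exists (S n). split; [|exact h].
      replace (4 * S n)%nat with (4 * n + 4)%nat by lia.
      rewrite pow_add, <- Rmult_assoc.
      replace (P ^ 2) with (/ P ^ 2 * P ^ 4) by (field; lra).
      apply Rmult_le_compat_r; [left; apply hp|lra]. }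
  pose proof (hp 2%nat). assert (hX0 : 0 < X) by lra.
  destruct (pow_small P hP (/ P ^ 2 / X)) as [n hn].
  { apply Rdiv_lt_0_compat; [apply Rinv_0_lt_compat|]; lra. }
  apply (hstep n). specialize (hn (4 * n)%nat ltac:(lia)).
  apply (Rmult_lt_compat_l X) in hn; [|lra].
  replace (X * (/ P ^ 2 / X)) with (/ P ^ 2) in hn by (field; lra). lra.
Qed.

(** The value of lam at the centre w = 1 of the window with N = 2n + 1 + o. *)
Definition mu (P b : R) (o n : nat) : R := P / (P ^ (2 * (2 * n + 1 + o)) * b).

Lemma mu_pos (P b : R) (hP : 0 < P < 1) (hb : 0 < b) (o n : nat) : 0 < mu P b o n.
Proof.
  unfold mu. apply Rdiv_lt_0_compat; [lra|].
  apply Rmult_lt_0_compat; [apply pow_lt|]; lra.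
Qed.

(** In a window [window_estimate] confines the zeros to w = 1 + O(Q^N), produces a
    sign change there, and [zeros_separated] leaves only one. *)
Theorem positive_zeros (P b smax : R) (s : nat -> R) (tau o : nat) (Y : R -> nat -> R)
  (hP : 0 < P < 1) (hb : 0 < b) (hs : forall j, Rabs (s j) <= smax)
  (ho : (o <= 1)%nat) (hpar : Nat.odd (o + tau) = false)
  (hY : forall l, sol (coef P b s l) tau (Y l)) :
  exists (z : nat -> R) (K : R) (n0 : nat),
    (forall n, (n0 <= n)%nat -> Y (z n) 0%nat = 0 /\
       Rabs (z n / mu P b o n - 1) <= K * P ^ (4 * n)) /\
    exists M, forall l, M <= l -> Y l 0%nat = 0 -> exists n, (n0 <= n)%nat /\ l = z n.
Proof.
  assert (hp : forall k, 0 < P ^ k) by (intros; apply pow_lt; lra).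
  pose proof (pow_in_open_unit P hP 2 ltac:(lia)) as h2.
  pose proof (Rle_trans _ _ _ (Rabs_pos _) (hs 0%nat)) as hsm.
  destruct (pow_small P hP (P / 8) ltac:(lra)) as [L hLs].
  assert (hL : 8 * P ^ (2 * L) <= P) by (pose proof (hLs (2 * L)%nat ltac:(lia)); lra).
  clear hLs.
  destruct (window_estimate P b smax L hP hb hsm hL) as [C [c [hC [hc hwin]]]].
  set (G := 2 / (P * P ^ (2 * L))).
  assert (hG : 0 < G).
  { unfold G. apply Rdiv_lt_0_compat; [lra|]. apply Rmult_lt_0_compat; [lra|apply hp]. }
  destruct (zeros_separated (P ^ 2) G h2 (Rlt_le _ _ hG)) as [d [hd hsep]].
  (* At w = 1 + K u or 1 - K u the main term exceeds the error C u by u. *)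
  set (K := (C + 1) / c).
  assert (hK : 0 < K) by (unfold K; apply Rdiv_lt_0_compat; lra).
  set (e1 := P ^ 3 / (2 * smax * b + 1)).
  set (e2 := (1 - P ^ 2) / K).
  set (e3 := d / (2 * K * (P / P ^ (2 * L)))).
  assert (hsb : 0 <= smax * b) by nra.
  assert (hPL : 0 < P / P ^ (2 * L)) by (apply Rdiv_lt_0_compat; [lra|apply hp]).
  assert (he1 : 0 < e1) by (unfold e1; apply Rdiv_lt_0_compat; [apply hp|lra]).
  assert (he2 : 0 < e2) by (unfold e2; apply Rdiv_lt_0_compat; lra).
  assert (hKP : 0 < 2 * K * (P / P ^ (2 * L))) by (apply Rmult_lt_0_compat; lra).
  assert (he3 : 0 < e3) by (unfold e3; apply Rdiv_lt_0_compat; lra).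
  destruct (pow_small P hP (Rmin e1 (Rmin e2 e3))) as [n1 hn1].
  { repeat apply Rmin_glb_lt; assumption. }
  set (n0 := (n1 + L)%nat).
  set (Nn := fun n => (2 * n + 1 + o)%nat).
  (* The window has to be so far out that the potential is negligible, that
     1 + K u and 1 - K u lie in it, and that its zeros are too close together to be
     distinct. *)
  assert (hsmall : forall n, (n0 <= n)%nat ->
     2 * smax * b * P ^ (2 * Nn n) <= P ^ 3 /\ K * P ^ (2 * Nn n) <= 1 - P ^ 2 /\
     2 * K * (P / P ^ (2 * L)) * P ^ (2 * Nn n) <= d).
  { intros n hn. pose proof (hn1 (2 * Nn n)%nat ltac:(unfold Nn, n0 in *; lia)) as h.
    pose proof (Rmin_l e1 (Rmin e2 e3)). pose proof (Rmin_r e1 (Rmin e2 e3)).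
    pose proof (Rmin_l e2 e3). pose proof (Rmin_r e2 e3). pose proof (hp (2 * Nn n)%nat).
    set (u := P ^ (2 * Nn n)) in *. split; [|split].
    - apply Rle_trans with ((2 * smax * b + 1) * e1).
      + apply Rmult_le_compat; lra.
      + right. unfold e1. field. lra.
    - apply Rle_trans with (K * e2); [apply Rmult_le_compat_l; lra|].
      right. unfold e2. field. lra.
    - apply Rle_trans with (2 * K * (P / P ^ (2 * L)) * e3); [apply Rmult_le_compat_l; lra|].
      right. unfold e3. set (v := P / P ^ (2 * L)) in *. field. lra. }
  set (w := fun n l => l * b * P ^ (2 * Nn n) / P).
  assert (hwmu : forall n l, w n l = l / mu P b o n).
  { intros n l. unfold w, mu, Nn. field. pose proof (hp (2 * (2 * n + 1 + o))%nat).
    repeat split; try lra. }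
  assert (hloc : forall n l, (n0 <= n)%nat -> P ^ 2 <= w n l <= / P ^ 2 -> Y l 0%nat = 0 ->
            Rabs (w n l - 1) <= K * P ^ (2 * Nn n)).
  { intros n l hn hw h0. destruct (hsmall n hn) as [k1 _].
    destruct (hwin tau n o ho hpar ltac:(unfold n0 in *; lia) k1) as [sg [hsg hest]].
    destruct (hest l s (Y l) hw hs (hY l)) as [m [A [hm [hA hh]]]].
    fold (Nn n) in hh. change (l * b * P ^ (2 * Nn n) / P) with (w n l) in hh.
    rewrite h0, Rmult_0_r in hh. unfold Rminus at 1 in hh.
    rewrite Rplus_0_l, Rabs_Ropp, Rabs_mult, (Rabs_right A) in hh by lra.
    set (v := w n l) in *. assert (hv : 0 < v) by lra.
    assert (hvv : Rabs (v - 1) <= Rabs (v - / v)).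
    { replace (v - / v) with ((v - 1) * (1 + / v)) by (field; lra).
      rewrite Rabs_mult. pose proof (Rinv_0_lt_compat v hv).
      rewrite (Rabs_right (1 + / v)) by lra. pose proof (Rabs_pos (v - 1)). nra. }
    pose proof (Rabs_pos (v - / v)). pose proof (hp (2 * Nn n)%nat) as hu.
    set (u := P ^ (2 * Nn n)) in *.
    assert (h5 : c * Rabs (v - / v) <= C * u) by nra.
    unfold K. apply (Rmult_le_reg_l c); [lra|].
    replace (c * ((C + 1) / c * u)) with (C * u + u) by (field; lra).
    assert (c * Rabs (v - 1) <= c * Rabs (v - / v)) by (apply Rmult_le_compat_l; lra).
    lra. }
  assert (huniq : forall n l l', (n0 <= n)%nat -> P ^ 2 <= w n l <= / P ^ 2 ->
            P ^ 2 <= w n l' <= / P ^ 2 -> Y l 0%nat = 0 -> Y l' 0%nat = 0 -> ~ l' < l).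
  { intros n l l' hn hw hw' h0 h0' hlt. destruct (hsmall n hn) as [k1 [k2 k3]].
    pose proof (hloc n l hn hw h0) as a1. pose proof (hloc n l' hn hw' h0') as a2.
    destruct (window_scale P b l L (Nn n) hP hb hL ltac:(unfold Nn, n0 in *; lia) hw)
      as [_ [_ [b1 _]]].
    destruct (window_coef P b smax l L (Nn n) s hP hb hsm hs hL
                ltac:(unfold Nn, n0 in *; lia) k1 hw) as [_ [b2 b3]].
    destruct (window_scale P b l' L (Nn n) hP hb hL ltac:(unfold Nn, n0 in *; lia) hw')
      as [_ [_ [c1 _]]].
    destruct (window_coef P b smax l' L (Nn n) s hP hb hsm hs hL
                ltac:(unfold Nn, n0 in *; lia) k1 hw') as [_ [c2 c3]].
    apply (hsep (Nn n - L)%nat tau _ _ (Y l) (Y l') (b * (l - l')) (hY l) (hY l')).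
    - intros i hi. pose proof (b1 i hi). pose proof (b2 i). pose proof (c1 i hi).
      pose proof (c2 i). lra.
    - exact b3.
    - exact c3.
    - apply Rmult_lt_0_compat; lra.
    - intros j. apply coef_diff.
    - assert (hww : b * (l - l') * (P ^ 2) ^ (Nn n - L) =
                    (w n l - w n l') * (P / P ^ (2 * L))).
      { unfold w. rewrite <- pow_mult.
        replace (2 * Nn n)%nat with (2 * (Nn n - L) + 2 * L)%nat by (unfold Nn, n0 in *; lia).
        rewrite pow_add. pose proof (hp (2 * L)%nat). field. lra. }
      rewrite hww. eapply Rle_trans; [|exact k3].
      apply Rabs_le_between in a1. apply Rabs_le_between in a2.
      replace (2 * K * (P / P ^ (2 * L)) * P ^ (2 * Nn n))
        with (2 * (K * P ^ (2 * Nn n)) * (P / P ^ (2 * L))) by ring.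
      apply Rmult_le_compat_r; lra.
    - exact h0.
    - exact h0'. }
  assert (hex : forall n, exists l, (n0 <= n)%nat ->
            P ^ 2 <= w n l <= / P ^ 2 /\ Y l 0%nat = 0).
  { intros n. destruct (Nat.le_gt_cases n0 n) as [hn|hn]; [|exists 0; lia].
    destruct (hsmall n hn) as [k1 [k2 _]].
    destruct (hwin tau n o ho hpar ltac:(unfold n0 in *; lia) k1) as [sg [hsg hest]].
    set (u := P ^ (2 * Nn n)) in *. assert (hu : 0 < u) by apply hp.
    assert (hKu : 0 < K * u) by (apply Rmult_lt_0_compat; lra).
    assert (hPi : 1 + (1 - P ^ 2) <= / P ^ 2).
    { apply (Rmult_le_reg_r (P ^ 2)); [lra|]. rewrite Rinv_l by lra. nra. }
    pose proof (mu_pos P b hP hb o n) as hmu.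
    assert (hwl : forall v, w n (v * mu P b o n) = v).
    { intros v. rewrite hwmu. field. lra. }
    assert (hcK : c * (K * u) = C * u + u) by (unfold K; field; lra).
    set (lp := (1 + K * u) * mu P b o n). set (lm := (1 - K * u) * mu P b o n).
    assert (hlp : 0 < sg * Y lp 0%nat).
    { destruct (hest lp s (Y lp)) as [m [A [hm [hA hh]]]]; [|exact hs|apply hY|].
      - change (P ^ 2 <= w n lp <= / P ^ 2). unfold lp. rewrite hwl. lra.
      - fold (Nn n) in hh. fold u in hh.
        change (lp * b * u / P) with (w n lp) in hh. unfold lp in hh at 2 3.
        rewrite hwl in hh. apply Rabs_le_between in hh.
        assert (h6 : K * u <= 1 + K * u - / (1 + K * u)).
        { assert (/ (1 + K * u) <= / 1) by (apply Rinv_le_contravar; lra).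
          rewrite Rinv_1 in H. lra. }
        assert (h7 : c * (K * u) <= A * (1 + K * u - / (1 + K * u)))
          by (apply Rmult_le_compat; lra).
        apply (Rmult_lt_reg_l m); [exact hm|]. rewrite Rmult_0_r.
        replace (m * (sg * Y lp 0%nat)) with (sg * m * Y lp 0%nat) by ring. lra. }
    assert (hlm : sg * Y lm 0%nat < 0).
    { destruct (hest lm s (Y lm)) as [m [A [hm [hA hh]]]]; [|exact hs|apply hY|].
      - change (P ^ 2 <= w n lm <= / P ^ 2). unfold lm. rewrite hwl. lra.
      - fold (Nn n) in hh. fold u in hh.
        change (lm * b * u / P) with (w n lm) in hh. unfold lm in hh at 2 3.
        rewrite hwl in hh. apply Rabs_le_between in hh.
        assert (h6 : K * u <= / (1 - K * u) - (1 - K * u)).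
        { assert (1 <= / (1 - K * u)); [|lra]. rewrite <- Rinv_1 at 1.
          apply Rinv_le_contravar; lra. }
        assert (h7 : c * (K * u) <= A * (/ (1 - K * u) - (1 - K * u)))
          by (apply Rmult_le_compat; lra).
        apply (Rmult_lt_reg_l m); [exact hm|]. rewrite Rmult_0_r.
        replace (m * (sg * Y lm 0%nat)) with (sg * m * Y lm 0%nat) by ring. lra. }
    assert (hcont : continuity (fun l => sg * Y l 0%nat)).
    { apply (continuity_scal (fun l => Y l 0%nat)).
      apply (value_continuous P b smax s tau Y); assumption. }
    assert (hlt : lm < lp) by (unfold lm, lp; apply Rmult_lt_compat_r; lra).
    destruct (IVT _ lm lp hcont hlt hlm hlp) as [l [[hl1 hl2] hl0]].
    exists l. intros _. split.
    - rewrite hwmu. split.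
      + apply Rle_trans with (lm / mu P b o n).
        * unfold lm. replace ((1 - K * u) * mu P b o n / mu P b o n) with (1 - K * u)
            by (field; lra). lra.
        * apply Rmult_le_compat_r; [left; apply Rinv_0_lt_compat|]; lra.
      + apply Rle_trans with (lp / mu P b o n).
        * apply Rmult_le_compat_r; [left; apply Rinv_0_lt_compat|]; lra.
        * unfold lp. replace ((1 + K * u) * mu P b o n / mu P b o n) with (1 + K * u)
            by (field; lra). lra.
    - apply Rmult_integral in hl0. destruct hl0 as [hl0|hl0]; [|exact hl0].
      destruct hsg; lra. }
  destruct (functional_choice _ hex) as [z hz].
  exists z, K, n0. split.
  - intros n hn. destruct (hz n hn) as [hzw hz0]. split; [exact hz0|].
    rewrite <- hwmu. eapply Rle_trans; [apply hloc; assumption|].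
    apply Rmult_le_compat_l; [lra|]. apply pow_anti; [exact hP|unfold Nn; lia].
  - set (k := b * P ^ (2 * (1 + o)) / P).
    assert (hk : 0 < k).
    { unfold k. apply Rdiv_lt_0_compat; [|lra]. apply Rmult_lt_0_compat; [lra|apply hp]. }
    assert (hwk : forall n l, w n l = l * k * P ^ (4 * n)).
    { intros n l. unfold w, k, Nn.
      replace (2 * (2 * n + 1 + o))%nat with (2 * (1 + o) + 4 * n)%nat by lia.
      rewrite pow_add. field. lra. }
    exists ((/ P ^ 2 / P ^ (4 * n0) + 1) / k). intros l hl h0.
    assert (hlk : / P ^ 2 / P ^ (4 * n0) + 1 <= l * k).
    { apply (Rmult_le_compat_r k) in hl; [|lra].
      replace ((/ P ^ 2 / P ^ (4 * n0) + 1) / k * k) with (/ P ^ 2 / P ^ (4 * n0) + 1) in hl;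
        [exact hl|].
      unfold Rdiv. rewrite (Rmult_assoc (_ + 1)), Rinv_l by lra. ring. }
    assert (hq : 0 < / P ^ 2 / P ^ (4 * n0)).
    { apply Rdiv_lt_0_compat; [apply Rinv_0_lt_compat|]; apply hp. }
    destruct (covering P (l * k) hP ltac:(lra)) as [n hn].
    rewrite <- hwk in hn.
    assert (hnn : (n0 <= n)%nat).
    { destruct (Nat.le_gt_cases n0 n) as [h|h]; [exact h|exfalso].
      assert (h3 : P ^ (4 * n0) <= P ^ (4 * n)) by (apply pow_anti; [exact hP|lia]).
      destruct hn as [_ hn]. rewrite hwk in hn.
      pose proof (hp (4 * n0)%nat) as q1. pose proof (hp (4 * n)%nat) as q2.
      assert (h4 : / P ^ 2 < l * k * P ^ (4 * n0)).
      { apply Rlt_le_trans with ((/ P ^ 2 / P ^ (4 * n0) + 1) * P ^ (4 * n0)).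
        - replace ((/ P ^ 2 / P ^ (4 * n0) + 1) * P ^ (4 * n0))
            with (/ P ^ 2 + P ^ (4 * n0)); [lra|].
          pose proof (hp 2%nat). field. split; [lra|]. apply pow_nonzero; lra.
        - apply Rmult_le_compat_r; lra. }
      assert (l * k * P ^ (4 * n0) <= l * k * P ^ (4 * n)) by (apply Rmult_le_compat_l; lra).
      lra. }
    exists n. split; [exact hnn|].
    destruct (hz n hnn) as [hzw hz0].
    destruct (Rtotal_order l (z n)) as [h|[h|h]]; [exfalso|exact h|exfalso].
    + exact (huniq n (z n) l hnn hzw hn hz0 h0 h).
    + exact (huniq n l (z n) hnn hn hzw h0 hz0 h).
Qed.

(** * From real zeros to the spectrum *)

(** Each half-open cell of length [d] contains at most one point. *)
Lemma separated_finite (Zr : R -> Prop) (a d : R) (hd : 0 < d)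
  (hsep : forall l l', Zr l -> Zr l' -> l' < l -> d < l - l') (k : nat) :
  exists ls : list R, forall l, Zr l -> a <= l < a + INR k * d -> In l ls.
Proof.
  induction k as [|k [ls IH]].
  - exists nil. intros l _ h. simpl in h. lra.
  - destruct (classic (exists l, Zr l /\ a + INR k * d <= l < a + INR (S k) * d))
      as [[l0 [h0 h1]]|hno].
    + exists (l0 :: ls). intros l hl h. rewrite S_INR in *.
      destruct (Rlt_le_dec l (a + INR k * d)) as [h2|h2]; [right; apply IH; [exact hl|lra]|].
      left. destruct (Rtotal_order l0 l) as [h3|[h3|h3]]; [|exact h3|].
      * pose proof (hsep l l0 hl h0 h3). lra.
      * pose proof (hsep l0 l h0 hl h3). lra.
    + exists ls. intros l hl h. apply IH; [exact hl|].
      split; [apply h|]. apply Rnot_le_lt. intros h2. apply hno. exists l.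
      split; [exact hl|]. split; [exact h2|apply h].
Qed.

Lemma bounded_zeros_finite (P b smax : R) (s : nat -> R) (tau : nat) (Y : R -> nat -> R)
  (hP : 0 < P < 1) (hb : 0 < b) (hs : forall j, Rabs (s j) <= smax)
  (hY : forall l, sol (coef P b s l) tau (Y l)) (M : R) (hM : 0 <= M) :
  exists ls : list R, forall l, Rabs l <= M -> Y l 0%nat = 0 -> In l ls.
Proof.
  pose proof (pow_in_open_unit P hP 2 ltac:(lia)) as h2.
  pose proof (Rle_trans _ _ _ (Rabs_pos _) (hs 0%nat)) as hsm.
  destruct (zeros_separated (P ^ 2) (b * (M + smax)) h2) as [d [hd hsep]].
  { apply Rmult_le_pos; lra. }
  set (Zr := fun l => Rabs l <= M /\ Y l 0%nat = 0).
  assert (hdb : 0 < d / b) by (apply Rdiv_lt_0_compat; lra).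
  destruct (archimed_cor1 (d / b / (2 * M + 1))) as [k [hk hk0]].
  { apply Rdiv_lt_0_compat; lra. }
  destruct (separated_finite Zr (- M) (d / b) hdb) with (k := k) as [ls hls].
  - intros l l' [hl h0] [hl' h0'] hlt. apply Rnot_le_lt. intros hle.
    apply (hsep 0%nat tau _ _ (Y l) (Y l') (b * (l - l')) (hY l) (hY l')).
    + intros i hi. lia.
    + intros j. apply coef_bound; assumption.
    + intros j. apply coef_bound; assumption.
    + apply Rmult_lt_0_compat; lra.
    + intros j. apply coef_diff.
    + simpl (_ ^ 0). rewrite Rmult_1_r. apply (Rmult_le_compat_l b) in hle; [|lra].
      replace (b * (d / b)) with d in hle by (field; lra). exact hle.
    + exact h0.
    + exact h0'.
  - exists ls. intros l hl h0. apply hls; [split; assumption|].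
    apply Rabs_le_between in hl. split; [lra|].
    assert (hkp : 0 < INR k) by (apply lt_0_INR, hk0).
    assert (2 * M + 1 < INR k * (d / b)).
    { apply (Rmult_lt_compat_l (INR k)) in hk; [|exact hkp].
      rewrite Rinv_r in hk by lra.
      apply (Rmult_lt_compat_r (2 * M + 1)) in hk; [|lra].
      replace (INR k * (d / b / (2 * M + 1)) * (2 * M + 1)) with (INR k * (d / b)) in hk
        by (field; lra). lra. }
    lra.
Qed.

(** Alternating signs exchange lam and -lam; the extra sign (-1)^tau keeps
    the limit pattern, which lives on the indices of the parity of tau. *)
Lemma sol_reflect (P b l : R) (s : nat -> R) (tau : nat) (Y : nat -> R) :
  sol (coef P b s (- l)) tau Y ->
  sol (coef P b (fun j => - s j) l) tau (fun j => (-1) ^ (j + tau) * Y j).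
Proof.
  intros [h1 h2]. split.
  - intros j. rewrite (h1 j) at 1. unfold coef. simpl ((-1) ^ (S j + tau)).
    simpl ((-1) ^ (S (S j) + tau)). ring.
  - apply (proj2 (is_lim_seq_abs_0 _)).
    apply (is_lim_seq_ext (fun j => Rabs (Y j - chi (j + tau)))).
    + intros j.
      assert (hch : (-1) ^ (j + tau) * chi (j + tau) = chi (j + tau)).
      { generalize (j + tau)%nat. intros m. destruct (Nat.odd m) eqn:hm.
        - rewrite chi_odd by exact hm. ring.
        - rewrite <- Nat.negb_even in hm. apply Bool.negb_false_iff, Nat.even_spec in hm.
          destruct hm as [i ->]. rewrite pow_mult.
          replace ((-1) ^ 2) with 1 by ring. rewrite pow1. ring. }
      rewrite <- hch at 2. rewrite <- Rmult_minus_distr_l, Rabs_mult, pow_1_abs. ring.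
    + apply (proj1 (is_lim_seq_abs_0 _)), h2.
Qed.

(** The exceptions are the zeros in a bounded interval and the finitely many terms of
    the two sequences below their common first rank.  The numbering is shifted by one
    from the windows. *)
Lemma asymptotics_of_real_zeros (E : C -> Prop) (P b smax kap : R) (s : nat -> R)
  (tau o : nat) (Y : R -> nat -> R) (mu' eps : nat -> R)
  (hP : 0 < P < 1) (hb : 0 < b) (hs : forall j, Rabs (s j) <= smax)
  (ho : (o <= 1)%nat) (hpar : Nat.odd (o + tau) = false)
  (hY : forall l, sol (coef P b s l) tau (Y l))
  (hE : forall z : C, E z <-> exists l : R, z = RtoC l /\ Y l 0%nat = 0)
  (hmu : forall n, mu' (S n) = mu P b o n)
  (heps : forall n, P ^ (4 * n) <= kap * eps (S n)) :
  eigenvalues_asymp E mu' eps.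
Proof.
  destruct (positive_zeros P b smax s tau o Y hP hb hs ho hpar hY)
    as [zp [K1 [n1 [hz1 [M1 hM1]]]]].
  set (Y' := fun l j => (-1) ^ (j + tau) * Y (- l) j).
  assert (hY' : forall l, sol (coef P b (fun j => - s j) l) tau (Y' l)).
  { intros l. apply sol_reflect, hY. }
  assert (hs' : forall j, Rabs (- s j) <= smax) by (intros j; rewrite Rabs_Ropp; apply hs).
  destruct (positive_zeros P b smax (fun j => - s j) tau o Y' hP hb hs' ho hpar hY')
    as [zn [K2 [n2 [hz2 [M2 hM2]]]]].
  assert (hY'0 : forall l, Y' l 0%nat = 0 <-> Y (- l) 0%nat = 0).
  { intros l. unfold Y'. split; intros h.
    - apply Rmult_integral in h. destruct h as [h|h]; [|exact h].
      exfalso. revert h. apply pow_nonzero. lra.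
    - rewrite h. ring. }
  set (M := Rmax 0 (Rmax M1 M2)).
  pose proof (Rmax_l 0 (Rmax M1 M2)) as m0. pose proof (Rmax_r 0 (Rmax M1 M2)) as m1.
  pose proof (Rmax_l M1 M2) as m2. pose proof (Rmax_r M1 M2) as m3. fold M in m0, m1.
  destruct (bounded_zeros_finite P b smax s tau Y hP hb hs hY M m0) as [ls hls].
  set (N := S (Nat.max n1 n2)).
  set (lp := fun m => RtoC (zp (m - 1)%nat)). set (ln := fun m => RtoC (- zn (m - 1)%nat)).
  exists lp, ln, N, (map RtoC ls ++ map lp (seq 0 N) ++ map ln (seq 0 N)).
  assert (hrel : forall (z : nat -> R) (K : R) (n0 : nat),
     (forall n, (n0 <= n)%nat -> Rabs (z n / mu P b o n - 1) <= K * P ^ (4 * n)) ->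
     forall m, (S n0 <= m)%nat ->
       z (m - 1)%nat = mu' m * (1 + (z (m - 1)%nat / mu' m - 1)) /\
       Rabs (z (m - 1)%nat / mu' m - 1) <= Rmax K 0 * kap * eps m).
  { intros z K n0 h m hm. destruct m as [|m]; [lia|].
    replace (S m - 1)%nat with m by lia. rewrite hmu.
    pose proof (mu_pos P b hP hb o m). split; [field; lra|].
    eapply Rle_trans; [apply h; lia|].
    pose proof (pow_lt P (4 * m) ltac:(lra)).
    rewrite Rmult_assoc.
    apply Rmult_le_compat; [|lra|apply Rmax_l|apply heps].
    pose proof (h m ltac:(lia)). pose proof (Rabs_pos (z m / mu P b o m - 1)). nra. }
  split; [|split; [|split]].
  - intros m hm. unfold N in hm. split; apply hE.
    + exists (zp (m - 1)%nat). split; [reflexivity|]. apply hz1. lia.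
    + exists (- zn (m - 1)%nat). split; [reflexivity|]. apply hY'0, hz2. lia.
  - intros z hz. apply hE in hz. destruct hz as [l [-> h0]].
    destruct (Rle_lt_dec (Rabs l) M) as [hl|hl].
    + left. apply in_or_app. left. apply in_map, hls; assumption.
    + assert (hcase : M1 <= l \/ M2 <= - l).
      { destruct (Rle_lt_dec 0 l) as [h|h].
        - rewrite Rabs_right in hl; lra.
        - rewrite Rabs_left in hl; lra. }
      assert (hin : (exists m, RtoC l = lp m) \/ (exists m, RtoC l = ln m)).
      { destruct hcase as [h|h].
        - destruct (hM1 l h h0) as [n [_ hn]]. left. exists (S n). unfold lp.
          rewrite hn. f_equal. f_equal. lia.
        - destruct (hM2 (- l) h) as [n [_ hn]].
          + apply hY'0. rewrite Ropp_involutive. exact h0.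
          + right. exists (S n). unfold ln. replace (S n - 1)%nat with n by lia.
            rewrite <- hn, Ropp_involutive. reflexivity. }
      destruct hin as [[m hm]|[m hm]]; destruct (Nat.le_gt_cases N m) as [h|h].
      * right. exists m. auto.
      * left. apply in_or_app. right. apply in_or_app. left. rewrite hm.
        apply in_map, in_seq. lia.
      * right. exists m. auto.
      * left. apply in_or_app. right. apply in_or_app. right. rewrite hm.
        apply in_map, in_seq. lia.
  - exists (Rmax K1 0 * kap), N. intros m hm.
    destruct (hrel zp K1 n1 (fun n h => proj2 (hz1 n h)) m ltac:(unfold N in hm; lia)) as [e1 e2].
    exists (RtoC (zp (m - 1)%nat / mu' m - 1)). split.
    + unfold lp. rewrite <- RtoC_plus, <- RtoC_mult. f_equal. exact e1.
    + rewrite Cmod_R. exact e2.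
  - exists (Rmax K2 0 * kap), N. intros m hm.
    destruct (hrel zn K2 n2 (fun n h => proj2 (hz2 n h)) m ltac:(unfold N in hm; lia)) as [e1 e2].
    exists (RtoC (zn (m - 1)%nat / mu' m - 1)). split.
    + unfold ln. rewrite <- RtoC_plus, <- RtoC_mult. f_equal.
      rewrite e1 at 1. ring.
    + rewrite Cmod_R. exact e2.
Qed.

(** * Convergence of complex sequences *)

Definition cvg (f : nat -> C) (l : C) : Prop := is_lim_seq (fun n => Cmod (f n - l)) 0.

Lemma squeeze_zero (u v : nat -> R) : (forall n, 0 <= u n <= v n) ->
  is_lim_seq v 0 -> is_lim_seq u 0.
Proof.
  intros h hv. apply (is_lim_seq_le_le (fun _ => 0) u v); [exact h|apply is_lim_seq_const|exact hv].
Qed.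

Lemma cvg_bounded_by (f : nat -> C) (l : C) (v : nat -> R) :
  (forall n, Cmod (f n - l) <= v n) -> is_lim_seq v 0 -> cvg f l.
Proof.
  intros h hv. apply (squeeze_zero _ v); [|exact hv].
  intros n. split; [apply Cmod_ge_0|apply h].
Qed.

Lemma cvg_ext (f g : nat -> C) (l : C) : (forall n, f n = g n) -> cvg f l -> cvg g l.
Proof.
  intros h hf. apply (is_lim_seq_ext (fun n => Cmod (f n - l))); [|exact hf].
  intros n. rewrite h. reflexivity.
Qed.

Lemma cvg_const (l : C) : cvg (fun _ => l) l.
Proof.
  apply (is_lim_seq_ext (fun _ => 0)); [|apply is_lim_seq_const].
  intros _. unfold Cminus. rewrite Cplus_opp_r, Cmod_0. reflexivity.
Qed.

Lemma cvg_plus (f g : nat -> C) (l m : C) :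
  cvg f l -> cvg g m -> cvg (fun n => (f n + g n)%C) (l + m)%C.
Proof.
  intros hf hg. apply (cvg_bounded_by _ _ (fun n => Cmod (f n - l) + Cmod (g n - m))).
  - intros n. replace (f n + g n - (l + m))%C with ((f n - l) + (g n - m))%C by ring.
    apply Cmod_triangle.
  - replace (Finite 0) with (Finite (0 + 0)) by (f_equal; ring).
    apply is_lim_seq_plus'; assumption.
Qed.

Lemma cvg_mult (f g : nat -> C) (l m : C) :
  cvg f l -> cvg g m -> cvg (fun n => (f n * g n)%C) (l * m)%C.
Proof.
  intros hf hg.
  apply (cvg_bounded_by _ _ (fun n => Cmod (f n - l) * Cmod (g n - m) +
            (Cmod m * Cmod (f n - l) + Cmod l * Cmod (g n - m)))).
  - intros n. rewrite <- !Cmod_mult.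
    replace (f n * g n - l * m)%C
      with ((f n - l) * (g n - m) + (m * (f n - l) + l * (g n - m)))%C by ring.
    eapply Rle_trans; [apply Cmod_triangle|]. apply Rplus_le_compat_l, Cmod_triangle.
  - replace (Finite 0) with (Finite (0 * 0 + (Cmod m * 0 + Cmod l * 0))) by (f_equal; ring).
    apply is_lim_seq_plus'; [apply is_lim_seq_mult'; assumption|].
    apply is_lim_seq_plus'; apply is_lim_seq_mult'; (assumption || apply is_lim_seq_const).
Qed.

Lemma cvg_opp (f : nat -> C) (l : C) : cvg f l -> cvg (fun n => (- f n)%C) (- l)%C.
Proof.
  intros hf. apply (is_lim_seq_ext (fun n => Cmod (f n - l))); [|exact hf].
  intros n. replace (- f n - - l)%C with (- (f n - l))%C by ring. symmetry. apply Cmod_opp.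
Qed.

Lemma cvg_incr (f : nat -> C) (l : C) (k : nat) : cvg f l -> cvg (fun n => f (n + k)%nat) l.
Proof. intros h. apply (is_lim_seq_incr_n (fun n => Cmod (f n - l)) k), h. Qed.

Lemma cvg_unique (f : nat -> C) (l m : C) : cvg f l -> cvg f m -> l = m.
Proof.
  intros hl hm.
  assert (h : cvg (fun n => (f n + - f n)%C) (l + - m)%C)
    by (apply cvg_plus; [exact hl|apply cvg_opp, hm]).
  assert (h' : is_lim_seq (fun _ => Cmod (l - m)) 0).
  { apply (is_lim_seq_ext (fun n => Cmod (f n + - f n - (l + - m)))); [|exact h].
    intros n. replace (f n + - f n - (l + - m))%C with (- (l - m))%C by ring. apply Cmod_opp. }
  apply is_lim_seq_unique in h'. rewrite Lim_seq_const in h'.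
  assert (h0 : Cmod (l - m) = 0) by congruence.
  apply Ceq_minus, Cmod_eq_0, h0.
Qed.

Lemma cvg_filterlim (f : nat -> C) (l : C) :
  cvg f l <-> filterlim f eventually (locally l).
Proof.
  split.
  - intros h P [eps hP].
    destruct (proj1 (is_lim_seq_Reals _ _) h eps (cond_pos eps)) as [N hN].
    exists N. intros n hn. apply hP. apply C_NormedModule_mixin_compat1.
    specialize (hN n hn). unfold R_dist, Rdist in hN.
    rewrite Rminus_0_r, Rabs_right in hN by (apply Rle_ge, Cmod_ge_0). exact hN.
  - intros h. apply is_lim_seq_Reals. intros eps heps.
    assert (hs : 0 < sqrt 2) by (apply sqrt_lt_R0; lra).
    assert (he : 0 < eps / sqrt 2) by (apply Rdiv_lt_0_compat; assumption).
    destruct (h (ball l (mkposreal _ he)) (locally_ball _ _)) as [N hN].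
    exists N. intros n hn. specialize (hN n hn).
    apply C_NormedModule_mixin_compat2 in hN. simpl in hN.
    unfold Rdist. rewrite Rminus_0_r, Rabs_right by (apply Rle_ge, Cmod_ge_0).
    replace (sqrt 2 * (eps / sqrt 2)) with eps in hN by (field; lra). exact hN.
Qed.

Lemma real_geometric_limit (Q B : R) (x : nat -> R) (hQ : 0 < Q < 1) (hB : 0 <= B)
  (h : forall k, Rabs (x (S k) - x k) <= B * Q ^ k) :
  exists l, forall k, Rabs (x k - l) <= B / (1 - Q) * Q ^ k.
Proof.
  assert (hd : forall n k, Rabs (x (n + k)%nat - x n) <= B * (Q ^ n - Q ^ (n + k)) / (1 - Q)).
  { intros n k. induction k as [|k IH].
    - rewrite Nat.add_0_r. replace (x n - x n) with 0 by ring. rewrite Rabs_R0.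
      right. field. lra.
    - rewrite Nat.add_succ_r.
      replace (x (S (n + k)) - x n) with ((x (S (n + k)) - x (n + k)%nat) + (x (n + k)%nat - x n))
        by ring.
      eapply Rle_trans; [apply Rabs_triang|]. pose proof (h (n + k)%nat).
      replace (B * (Q ^ n - Q ^ S (n + k)) / (1 - Q))
        with (B * Q ^ (n + k) + B * (Q ^ n - Q ^ (n + k)) / (1 - Q)) by (simpl; field; lra).
      lra. }
  assert (hd' : forall n k, Rabs (x (n + k)%nat - x n) <= B / (1 - Q) * Q ^ n).
  { intros n k. eapply Rle_trans; [apply hd|].
    unfold Rdiv. rewrite Rmult_assoc, (Rmult_comm _ (/ _)), <- Rmult_assoc.
    apply Rmult_le_compat_l.
    - apply Rmult_le_pos; [exact hB|left; apply Rinv_0_lt_compat; lra].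
    - destruct (pow_in_unit Q hQ (n + k)). lra. }
  assert (hc : ex_finite_lim_seq x).
  { apply ex_lim_seq_cauchy_corr. intros eps.
    assert (hb : 0 < eps / (2 * (B / (1 - Q)) + 1)).
    { assert (0 <= B / (1 - Q)) by (apply Rdiv_le_0_compat; lra).
      apply Rdiv_lt_0_compat; [apply cond_pos|lra]. }
    assert (hb0 : 0 <= B / (1 - Q)) by (apply Rdiv_le_0_compat; lra).
    destruct (pow_small Q hQ _ hb) as [N hN]. exists N. intros n m hn hm.
    pose proof (hd' N (n - N)%nat) as a1. pose proof (hd' N (m - N)%nat) as a2.
    replace (N + (n - N))%nat with n in a1 by lia.
    replace (N + (m - N))%nat with m in a2 by lia.
    specialize (hN N (Nat.le_refl _)).
    replace (x n - x m) with ((x n - x N) + - (x m - x N)) by ring.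
    eapply Rle_lt_trans; [apply Rabs_triang|]. rewrite Rabs_Ropp.
    assert (hq : (2 * (B / (1 - Q)) + 1) * Q ^ N < eps).
    { apply (Rmult_lt_compat_l (2 * (B / (1 - Q)) + 1)) in hN; [|lra].
      replace ((2 * (B / (1 - Q)) + 1) * (eps / (2 * (B / (1 - Q)) + 1))) with (pos eps) in hN
        by (field; split; lra). exact hN. }
    pose proof (pow_lt Q N ltac:(lra)). lra. }
  destruct hc as [l hl]. exists l. intros n.
  rewrite Rabs_minus_sym.
  refine (is_lim_seq_le (fun k => Rabs (x (k + n)%nat - x n)) (fun _ => B / (1 - Q) * Q ^ n)
            (Rabs (l - x n)) (B / (1 - Q) * Q ^ n) _ _ (is_lim_seq_const _)).
  - intros k. rewrite Nat.add_comm. apply hd'.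
  - apply (is_lim_seq_abs _ (l - x n)), is_lim_seq_minus'; [|apply is_lim_seq_const].
    apply (is_lim_seq_incr_n x n), hl.
Qed.

Lemma im_le_Cmod (c : C) : Rabs (Im c) <= Cmod c.
Proof.
  eapply Rle_trans; [|apply Rmax_Cmod]. apply Rmax_r.
Qed.

Lemma complex_geometric_limit (Q B : R) (z : nat -> C) (hQ : 0 < Q < 1) (hB : 0 <= B)
  (h : forall k, Cmod (z (S k) - z k) <= B * Q ^ k) :
  exists l, forall k, Cmod (z k - l) <= 2 * (B / (1 - Q)) * Q ^ k.
Proof.
  destruct (real_geometric_limit Q B (fun k => Re (z k)) hQ hB) as [a ha].
  { intros k. eapply Rle_trans; [|apply h]. change (Re (z (S k)) - Re (z k)) with (Re (z (S k) - z k)). apply re_le_Cmod. }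
  destruct (real_geometric_limit Q B (fun k => Im (z k)) hQ hB) as [b hb].
  { intros k. eapply Rle_trans; [|apply h]. change (Im (z (S k)) - Im (z k)) with (Im (z (S k) - z k)). apply im_le_Cmod. }
  exists (a, b). intros k. specialize (ha k). specialize (hb k).
  assert (hsq : sqrt 2 <= 2).
  { rewrite <- (sqrt_square 2) at 2 by lra. apply sqrt_le_1; lra. }
  eapply Rle_trans; [apply Cmod_2Rmax|].
  assert (h0 : 0 <= B / (1 - Q) * Q ^ k).
  { apply Rmult_le_pos; [apply Rdiv_le_0_compat; lra|apply pow_le; lra]. }
  rewrite Rmult_assoc. apply Rmult_le_compat; [apply sqrt_pos| |exact hsq|].
  - eapply Rle_trans; [apply Rabs_pos|apply Rmax_l].
  - apply Rmax_lub; [exact ha|exact hb].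
Qed.

(** * Complex three-term recurrences *)

(** The limit behaviour c0, c1, -c0, -c1 of a solution at infinity. *)
Definition pattern (c0 c1 : C) (j : nat) : C :=
  (c0 * RtoC (chi j) + c1 * RtoC (chi (j + 3)))%C.

Lemma chi_even_index (n : nat) : chi (2 * n) = (-1) ^ n.
Proof. rewrite <- (Nat.add_0_r (2 * n)), chi_double. simpl. ring. Qed.

Lemma pattern_even (c0 c1 : C) (n : nat) : pattern c0 c1 (2 * n) = (RtoC ((-1) ^ n) * c0)%C.
Proof.
  unfold pattern. rewrite chi_even_index, (chi_odd (2 * n + 3)); [ring|].
  apply Nat.odd_spec. exists (n + 1)%nat. lia.
Qed.

Lemma pattern_odd (c0 c1 : C) (n : nat) :
  pattern c0 c1 (2 * n + 1) = (RtoC ((-1) ^ n) * c1)%C.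
Proof.
  unfold pattern. rewrite (chi_odd (2 * n + 1)) by (apply Nat.odd_spec; exists n; reflexivity).
  replace (2 * n + 1 + 3)%nat with (2 * (n + 2))%nat by lia.
  rewrite chi_even_index, pow_add. replace ((-1) ^ 2) with 1 by ring. rewrite Rmult_1_r. ring.
Qed.

Lemma pattern_SS (c0 c1 : C) (j : nat) : pattern c0 c1 (S (S j)) = (- pattern c0 c1 j)%C.
Proof.
  unfold pattern. change (S (S j) + 3)%nat with (S (S (j + 3))).
  rewrite !chi_SS, !RtoC_opp. ring.
Qed.

Lemma pattern_bound (c0 c1 : C) (j : nat) : Cmod (pattern c0 c1 j) <= Cmod c0 + Cmod c1.
Proof.
  unfold pattern. eapply Rle_trans; [apply Cmod_triangle|]. rewrite !Cmod_mult, !Cmod_R.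
  pose proof (chi_abs_le j). pose proof (chi_abs_le (j + 3)).
  pose proof (Cmod_ge_0 c0). pose proof (Cmod_ge_0 c1). nra.
Qed.

Definition csol (g : nat -> C) (c0 c1 : C) (Y : nat -> C) : Prop :=
  (forall j, Y j = (g j * Y (S j) - Y (S (S j)))%C) /\
  is_lim_seq (fun j => Cmod (Y j - pattern c0 c1 j)) 0.

Lemma csol_lin (g : nat -> C) (c0 c1 d0 d1 al be : C) (Y X : nat -> C) :
  csol g c0 c1 Y -> csol g d0 d1 X ->
  csol g (al * c0 + be * d0)%C (al * c1 + be * d1)%C (fun j => (al * Y j + be * X j)%C).
Proof.
  intros [y1 y2] [x1 x2]. split.
  - intros j. rewrite (y1 j), (x1 j). ring.
  - apply (squeeze_zero _ (fun j => Cmod al * Cmod (Y j - pattern c0 c1 j) +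
                                    Cmod be * Cmod (X j - pattern d0 d1 j))).
    + intros j. split; [apply Cmod_ge_0|]. rewrite <- !Cmod_mult.
      replace (al * Y j + be * X j - pattern (al * c0 + be * d0) (al * c1 + be * d1) j)%C
        with (al * (Y j - pattern c0 c1 j) + be * (X j - pattern d0 d1 j))%C
        by (unfold pattern; ring).
      apply Cmod_triangle.
    + replace (Finite 0) with (Finite (Cmod al * 0 + Cmod be * 0)) by (f_equal; ring).
      apply is_lim_seq_plus'; apply is_lim_seq_mult'; (assumption || apply is_lim_seq_const).
Qed.

(** This is the uniqueness of a solution with a prescribed limit pattern. *)
Lemma csol_zero (Q G : R) (g : nat -> C) (Y : nat -> C) (hQ : 0 < Q < 1) (hG : 0 <= G)
  (hg : forall j, Cmod (g j) <= G * Q ^ j) (hY : csol g (RtoC 0) (RtoC 0) Y) :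
  forall j, Y j = RtoC 0.
Proof.
  intros j. apply Cmod_eq_0. apply Rle_antisym; [|apply Cmod_ge_0].
  destruct hY as [h1 h2].
  assert (hlim : is_lim_seq (fun j => Cmod (Y j)) 0).
  { apply (is_lim_seq_ext (fun j => Cmod (Y j - pattern (RtoC 0) (RtoC 0) j))); [|exact h2].
    intros i. f_equal. unfold pattern. ring. }
  eapply Rle_trans.
  - apply (second_order_bound Q G 0 0 (fun j => Cmod (Y j)) hQ hG (Rle_refl 0)).
    + intros; apply Cmod_ge_0.
    + intros i. rewrite (h1 i) at 1. unfold Cminus.
      eapply Rle_trans; [apply Cmod_triangle|]. rewrite Cmod_opp, Cmod_mult.
      pose proof (hg i). pose proof (Cmod_ge_0 (Y (S i))). nra.
    + replace (Finite 0) with (Finite (0 + 0)) by (f_equal; ring).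
      apply is_lim_seq_plus'; [exact hlim|].
      apply (is_lim_seq_incr_1 (fun j => Cmod (Y j))), hlim.
  - right. field. lra.
Qed.

Lemma csol_unique (Q G : R) (g : nat -> C) (c0 c1 : C) (Y X : nat -> C) (hQ : 0 < Q < 1)
  (hG : 0 <= G) (hg : forall j, Cmod (g j) <= G * Q ^ j)
  (hY : csol g c0 c1 Y) (hX : csol g c0 c1 X) : forall j, Y j = X j.
Proof.
  intros j. apply Ceq_minus.
  pose proof (csol_lin g _ _ _ _ (RtoC 1) (- RtoC 1)%C Y X hY hX) as h.
  replace (RtoC 1 * c0 + - RtoC 1 * c0)%C with (RtoC 0) in h by ring.
  replace (RtoC 1 * c1 + - RtoC 1 * c1)%C with (RtoC 0) in h by ring.
  pose proof (csol_zero Q G g _ hQ hG hg h j) as h0. cbv beta in h0. rewrite <- h0. ring.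
Qed.

Lemma csol_rate (Q G : R) (g : nat -> C) (c0 c1 : C) (Y : nat -> C) (hQ : 0 < Q < 1)
  (hG : 0 <= G) (hg : forall j, Cmod (g j) <= G * Q ^ j) (hY : csol g c0 c1 Y) :
  exists M, forall j, Cmod (Y j - pattern c0 c1 j) <= M * Q ^ j.
Proof.
  set (Lam := Cmod c0 + Cmod c1).
  assert (hL : 0 <= Lam).
  { unfold Lam. pose proof (Cmod_ge_0 c0). pose proof (Cmod_ge_0 c1). lra. }
  exists (exp (G / (1 - Q)) * (G * Lam / (1 - Q))). intros j.
  eapply Rle_trans.
  - apply (second_order_bound Q G (G * Lam) 0
             (fun j => Cmod (Y j - pattern c0 c1 j)) hQ hG).
    + apply Rmult_le_pos; assumption.
    + intros; apply Cmod_ge_0.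
    + intros i. pose proof (proj1 hY i) as hr.
      replace (Y i - pattern c0 c1 i)%C
        with (g i * (Y (S i) - pattern c0 c1 (S i)) +
              (- (Y (S (S i)) - pattern c0 c1 (S (S i))) + g i * pattern c0 c1 (S i)))%C.
      2:{ rewrite hr, pattern_SS. ring. }
      eapply Rle_trans; [apply Cmod_triangle|].
      eapply Rle_trans; [apply Rplus_le_compat_l, Cmod_triangle|].
      rewrite Cmod_opp, !Cmod_mult.
      pose proof (hg i) as h1. pose proof (pattern_bound c0 c1 (S i)) as h2. fold Lam in h2.
      pose proof (Cmod_ge_0 (Y (S i) - pattern c0 c1 (S i))).
      pose proof (Rmult_le_compat _ _ _ _ (Cmod_ge_0 _) (Cmod_ge_0 _) h1 h2).
      nra.
    + replace (Finite 0) with (Finite (0 + 0)) by (f_equal; ring).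
      apply is_lim_seq_plus'; [apply hY|].
      apply (is_lim_seq_incr_1 (fun j => Cmod (Y j - pattern c0 c1 j))), hY.
  - right. field. lra.
Qed.

(** The values at j and j + 1 obtained by starting the backward recurrence from the
    limit pattern [k] steps ahead. *)
Fixpoint truncated (g l : nat -> C) (k j : nat) : C * C :=
  match k with
  | 0%nat => (l j, l (S j))
  | S k' =>
      let (u, v) := truncated g l k' (S j) in ((g j * u - v)%C, u)
  end.

Lemma truncated_S (g l : nat -> C) (k j : nat) :
  truncated g l (S k) j =
    ((g j * fst (truncated g l k (S j)) - snd (truncated g l k (S j)))%C,
     fst (truncated g l k (S j))).
Proof. simpl. destruct (truncated g l k (S j)). reflexivity. Qed.

(** Truncated solutions converge geometrically, because starting one step later
    changes the starting values by O(Q^(j+k)) only. *)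
Lemma csol_exists (Q G : R) (g : nat -> C) (c0 c1 : C) (hQ : 0 < Q < 1) (hG : 0 <= G)
  (hg : forall j, Cmod (g j) <= G * Q ^ j) : exists Y, csol g c0 c1 Y.
Proof.
  set (l := pattern c0 c1). set (Lam := Cmod c0 + Cmod c1).
  assert (hL : 0 <= Lam).
  { unfold Lam. pose proof (Cmod_ge_0 c0). pose proof (Cmod_ge_0 c1). lra. }
  set (T := truncated g l). set (B := exp (G / (1 - Q))).
  assert (hB : 0 < B) by apply exp_pos.
  assert (hstep : forall k j,
     Cmod (fst (T (S k) j) - fst (T k j)) + Cmod (snd (T (S k) j) - snd (T k j)) <=
       exp (G * Q ^ j / (1 - Q)) * (G * Lam * Q ^ (j + k))).
  { induction k as [|k IH]; intros j.
    - unfold T. rewrite truncated_S. cbn [fst snd truncated].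
      replace (g j * l (S j) - l (S (S j)) - l j)%C with (g j * l (S j))%C.
      2:{ unfold l. rewrite pattern_SS. ring. }
      replace (l (S j) - l (S j))%C with (RtoC 0) by ring.
      rewrite Cmod_0, Cmod_mult, Rplus_0_r, Nat.add_0_r.
      pose proof (pattern_bound c0 c1 (S j)) as h2. fold Lam in h2. fold l in h2.
      pose proof (Rmult_le_compat _ _ _ _ (Cmod_ge_0 _) (Cmod_ge_0 _) (hg j) h2).
      assert (1 <= exp (G * Q ^ j / (1 - Q))).
      { rewrite <- exp_0 at 1. apply exp_le, Rdiv_le_0_compat; [|lra].
        apply Rmult_le_pos; [lra|apply pow_le; lra]. }
      assert (0 <= G * Lam * Q ^ j).
      { apply Rmult_le_pos; [apply Rmult_le_pos; lra|apply pow_le; lra]. }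
      nra.
    - specialize (IH (S j)). unfold T in *. rewrite (truncated_S g l (S k) j).
      rewrite (truncated_S g l k j). cbn [fst snd].
      set (a := fst (truncated g l (S k) (S j))) in *.
      set (b := snd (truncated g l (S k) (S j))) in *.
      set (a' := fst (truncated g l k (S j))) in *.
      set (b' := snd (truncated g l k (S j))) in *.
      replace (g j * a - b - (g j * a' - b'))%C with (g j * (a - a') + - (b - b'))%C by ring.
      pose proof (Cmod_triangle (g j * (a - a')) (- (b - b'))) as ht.
      rewrite Cmod_opp, Cmod_mult in ht.
      replace (j + S k)%nat with (S j + k)%nat by lia.
      set (X := G * Lam * Q ^ (S j + k)) in *.
      replace (G * Q ^ j / (1 - Q)) with (G * Q ^ j + G * Q ^ S j / (1 - Q))
        by (simpl; field; lra).
      rewrite exp_plus, Rmult_assoc.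
      pose proof (exp_ineq1_le (G * Q ^ j)) as he.
      set (Y := exp (G * Q ^ S j / (1 - Q)) * X) in *.
      pose proof (Cmod_ge_0 (a - a')) as ha0. pose proof (Cmod_ge_0 (b - b')) as hb0.
      pose proof (hg j) as hgj. pose proof (Cmod_ge_0 (g j)).
      assert (hGQ : 0 <= G * Q ^ j) by lra.
      apply Rle_trans with ((1 + G * Q ^ j) * (Cmod (a - a') + Cmod (b - b'))).
      + pose proof (Rmult_le_compat_r (Cmod (a - a')) _ _ ltac:(lra) hgj).
        pose proof (Rmult_le_pos _ _ hGQ hb0). lra.
      + apply Rmult_le_compat; lra. }
  assert (hlim : forall j, exists y, forall k,
            Cmod (fst (T k j) - y) <= 2 * (B * G * Lam * Q ^ j / (1 - Q)) * Q ^ k).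
  { intros j. pose proof (pow_in_unit Q hQ j) as hj.
    apply complex_geometric_limit; [exact hQ| |].
    - apply Rmult_le_pos; [|lra]. apply Rmult_le_pos; [apply Rmult_le_pos; lra|lra].
    - intros k. pose proof (hstep k j). pose proof (Cmod_ge_0 (snd (T (S k) j) - snd (T k j))).
      eapply Rle_trans; [|apply Rle_trans with (exp (G * Q ^ j / (1 - Q)) * (G * Lam * Q ^ (j + k)))].
      + instantiate (1 := Cmod (fst (T (S k) j) - fst (T k j))). apply Rle_refl.
      + lra.
      + rewrite pow_add.
        replace (B * G * Lam * Q ^ j * Q ^ k) with (B * (G * Lam * (Q ^ j * Q ^ k))) by ring.
        apply Rmult_le_compat_r.
        * pose proof (pow_in_unit Q hQ k).
          apply Rmult_le_pos; [apply Rmult_le_pos; lra|apply Rmult_le_pos; lra].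
        * apply exp_le. apply Rmult_le_compat_r; [left; apply Rinv_0_lt_compat; lra|nra]. }
  destruct (functional_choice _ hlim) as [Y hY].
  assert (hcv : forall j, cvg (fun k => fst (T k j)) (Y j)).
  { intros j. apply (cvg_bounded_by _ _ _ (hY j)). apply geometric_limit, hQ. }
  exists Y. split.
  - intros j.
    apply (cvg_unique (fun k => fst (T (k + 2)%nat j))); [apply (cvg_incr (fun k => fst (T k j))), hcv|].
    apply (cvg_ext (fun k => (g j * fst (T (k + 1)%nat (S j)) + - fst (T k (S (S j))))%C)).
    + intros k. unfold T. replace (k + 2)%nat with (S (S k)) by lia.
      replace (k + 1)%nat with (S k) by lia.
      rewrite (truncated_S g l (S k) j). cbn [fst snd].
      rewrite (truncated_S g l k (S j)). reflexivity.
    + apply cvg_plus.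
      * apply cvg_mult; [apply cvg_const|].
        apply (cvg_incr (fun k => fst (T k (S j)))), hcv.
      * apply cvg_opp, hcv.
  - apply (squeeze_zero _ (fun j => (2 * (B * G * Lam / (1 - Q))) * Q ^ j)).
    + intros j. split; [apply Cmod_ge_0|]. pose proof (hY j 0%nat) as h.
      simpl in h. fold l. rewrite <- Cmod_opp.
      replace (- (Y j - l j))%C with (l j - Y j)%C by ring.
      eapply Rle_trans; [exact h|]. right. field. lra.
    + apply geometric_limit, hQ.
Qed.

Definition ccoef (P b : R) (s : nat -> R) (lam : C) (j : nat) : C :=
  (RtoC (b * (P ^ 2) ^ j) * (lam - RtoC (s j)))%C.

Lemma ccoef_bound (P b smax : R) (s : nat -> R) (lam : C) (hP : 0 < P < 1) (hb : 0 < b)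
  (hs : forall j, Rabs (s j) <= smax) (j : nat) :
  Cmod (ccoef P b s lam j) <= b * (Cmod lam + smax) * (P ^ 2) ^ j.
Proof.
  unfold ccoef. pose proof (pow_lt (P ^ 2) j ltac:(apply pow_lt; lra)).
  assert (0 < b * (P ^ 2) ^ j) by nra.
  rewrite Cmod_mult, Cmod_R, (Rabs_right (b * _)) by lra.
  replace (b * (Cmod lam + smax) * (P ^ 2) ^ j)
    with (b * (P ^ 2) ^ j * (Cmod lam + smax)) by ring.
  apply Rmult_le_compat_l; [lra|].
  unfold Cminus. eapply Rle_trans; [apply Cmod_triangle|]. rewrite Cmod_opp, Cmod_R.
  pose proof (hs j). lra.
Qed.

Lemma pattern_limit_zero (Y : nat -> C) (c0 c1 : C) (J : nat) :
  is_lim_seq (fun j => Cmod (Y j - pattern c0 c1 j)) 0 ->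
  (forall j, (J <= j)%nat -> Y j = RtoC 0) -> c0 = RtoC 0 /\ c1 = RtoC 0.
Proof.
  intros h h0.
  assert (hsub : forall o, is_lim_seq (fun n => Cmod (pattern c0 c1 (2 * (n + J) + o))) 0).
  { intros o.
    apply (is_lim_seq_ext (fun n => Cmod (Y (2 * (n + J) + o)%nat - pattern c0 c1 (2 * (n + J) + o)))).
    - intros n. rewrite h0 by lia.
      replace (RtoC 0 - pattern c0 c1 (2 * (n + J) + o))%C
        with (- pattern c0 c1 (2 * (n + J) + o))%C by ring. apply Cmod_opp.
    - apply (is_lim_seq_subseq (fun j => Cmod (Y j - pattern c0 c1 j)) 0
               (fun n => (2 * (n + J) + o)%nat)); [|exact h].
      apply eventually_subseq. intros; lia. }
  assert (hc : forall c : C, is_lim_seq (fun n => Cmod (RtoC ((-1) ^ (n + J)) * c)) 0 -> c = RtoC 0).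
  { intros c hl. apply Cmod_eq_0.
    assert (hl' : is_lim_seq (fun _ => Cmod c) 0).
    { apply (is_lim_seq_ext (fun n => Cmod (RtoC ((-1) ^ (n + J)) * c))); [|exact hl].
      intros n. rewrite Cmod_mult, Cmod_R, pow_1_abs. ring. }
    apply is_lim_seq_unique in hl'. rewrite Lim_seq_const in hl'. congruence. }
  split; apply hc.
  - apply (is_lim_seq_ext (fun n => Cmod (pattern c0 c1 (2 * (n + J) + 0)))); [|apply hsub].
    intros n. rewrite Nat.add_0_r, pattern_even. reflexivity.
  - apply (is_lim_seq_ext (fun n => Cmod (pattern c0 c1 (2 * (n + J) + 1)))); [|apply hsub].
    intros n. rewrite pattern_odd. reflexivity.
Qed.

(** The quantity Im lam * Im (Y_j conj Y_(j+1)) is nonincreasing in j and tends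
    to zero, since the limit pattern is real.  If it vanishes at [J], it vanishes from
    there on, and its decrements (Im lam)^2 b Q^j |Y_(j+1)|^2 force Y to vanish. *)
Lemma zeros_are_real (P b smax : R) (s : nat -> R) (lam : C) (k0 k1 : R) (Y : nat -> C) (J : nat)
  (hP : 0 < P < 1) (hb : 0 < b) (hs : forall j, Rabs (s j) <= smax)
  (hk : k0 <> 0 \/ k1 <> 0) (hY : csol (ccoef P b s lam) (RtoC k0) (RtoC k1) Y)
  (h0 : Y J = RtoC 0) : Im lam = 0.
Proof.
  destruct (Req_dec (Im lam) 0) as [h|him]; [exact h|exfalso].
  set (pt := pattern (RtoC k0) (RtoC k1)) in *.
  set (V := fun j => Im (Y j * Cconj (Y (S j)))).
  set (V' := fun j => Im lam * V j).
  assert (hrec : forall j, V' j = b * (P ^ 2) ^ j * (Im lam) ^ 2 * (Cmod (Y (S j))) ^ 2 + V' (S j)).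
  { intros j. unfold V', V. rewrite (proj1 hY j). unfold ccoef. rewrite Cmod2_alt.
    destruct (Y (S j)) as [u v]. destruct (Y (S (S j))) as [u' v']. destruct lam as [lr li].
    unfold Cconj, Cmult, Cminus, Cplus, Copp, RtoC, Im, Re. simpl. ring. }
  assert (hpt : forall j, Im (pt j * Cconj (pt (S j))) = 0).
  { intros j. unfold pt, pattern, Cconj, Cmult, Cplus, RtoC, Im. simpl. ring. }
  assert (hmono : forall j, V' (S j) <= V' j).
  { intros j. rewrite (hrec j).
    assert (0 <= b * (P ^ 2) ^ j * Im lam ^ 2 * Cmod (Y (S j)) ^ 2); [|lra].
    apply Rmult_le_pos; [|apply pow2_ge_0]. apply Rmult_le_pos; [|apply pow2_ge_0].
    apply Rmult_le_pos; [lra|apply pow_le, pow_le; lra]. }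
  assert (hptb : forall j, Cmod (pt j) <= Rabs k0 + Rabs k1).
  { intros j. unfold pt. eapply Rle_trans; [apply pattern_bound|]. rewrite !Cmod_R. lra. }
  set (e := fun j => Cmod (Y j - pt j)).
  assert (hlimV : is_lim_seq V' 0).
  { apply (proj2 (is_lim_seq_abs_0 _)).
    set (Lam := Rabs k0 + Rabs k1) in *.
    apply (squeeze_zero _ (fun j => Rabs (Im lam) * (e j * e (S j) + (e j * Lam + Lam * e (S j))))).
    - intros j. split; [apply Rabs_pos|]. unfold V'. rewrite Rabs_mult.
      apply Rmult_le_compat_l; [apply Rabs_pos|]. unfold V.
      replace (Im (Y j * Cconj (Y (S j))))
        with (Im (Y j * Cconj (Y (S j)) - pt j * Cconj (pt (S j)))).
      2:{ change (Im (Y j * Cconj (Y (S j)) - pt j * Cconj (pt (S j))))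
            with (Im (Y j * Cconj (Y (S j))) - Im (pt j * Cconj (pt (S j)))).
          rewrite hpt. ring. }
      eapply Rle_trans; [apply im_le_Cmod|].
      replace (Y j * Cconj (Y (S j)) - pt j * Cconj (pt (S j)))%C
        with ((Y j - pt j) * Cconj (Y (S j) - pt (S j)) +
              ((Y j - pt j) * Cconj (pt (S j)) + pt j * Cconj (Y (S j) - pt (S j))))%C
        by (rewrite Cminus_conj; ring).
      eapply Rle_trans; [apply Cmod_triangle|].
      eapply Rle_trans; [apply Rplus_le_compat_l, Cmod_triangle|].
      rewrite !Cmod_mult, !Cmod_conj. fold (e j). fold (e (S j)).
      assert (0 <= e j) by apply Cmod_ge_0. assert (0 <= e (S j)) by apply Cmod_ge_0.
      pose proof (hptb j). pose proof (hptb (S j)). nra.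
    - assert (he : is_lim_seq e 0) by apply hY.
      assert (he' : is_lim_seq (fun j => e (S j)) 0) by (apply (is_lim_seq_incr_1 e), he).
      replace (Finite 0) with (Finite (Rabs (Im lam) * (0 * 0 + (0 * Lam + Lam * 0))))
        by (f_equal; ring).
      apply is_lim_seq_mult'; [apply is_lim_seq_const|].
      apply is_lim_seq_plus'; [apply is_lim_seq_mult'; assumption|].
      apply is_lim_seq_plus'; apply is_lim_seq_mult'; (assumption || apply is_lim_seq_const). }
  assert (hge : forall j, 0 <= V' j).
  { intros j. refine (is_lim_seq_le (fun k => V' (k + j)%nat) (fun _ => V' j) 0 (V' j) _ _ (is_lim_seq_const _)).
    - induction n as [|n IH]; [apply Rle_refl|]. eapply Rle_trans; [apply hmono|exact IH].
    - apply (is_lim_seq_incr_n V' j), hlimV. }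
  assert (hzero : forall k, V' (k + J)%nat = 0).
  { induction k as [|k IH].
    - simpl. unfold V', V. rewrite h0. unfold Cmult, Cconj, RtoC, Im. simpl. ring.
    - apply Rle_antisym; [|apply hge]. simpl. rewrite <- IH. apply hmono. }
  destruct (pattern_limit_zero Y (RtoC k0) (RtoC k1) (S J) (proj2 hY)) as [e0 e1].
  - intros j hj. pose proof (hrec (j - 1)%nat) as hr.
    pose proof (hzero (j - 1 - J)%nat) as z1. pose proof (hzero (j - J)%nat) as z2.
    replace (j - 1 - J + J)%nat with (j - 1)%nat in z1 by lia.
    replace (j - J + J)%nat with j in z2 by lia.
    replace (S (j - 1)) with j in hr by lia. rewrite z1, z2 in hr.
    apply Cmod_eq_0.
    assert (hpos : 0 < b * (P ^ 2) ^ (j - 1) * Im lam ^ 2).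
    { apply Rmult_lt_0_compat; [apply Rmult_lt_0_compat; [lra|apply pow_lt, pow_lt; lra]|].
      rewrite <- Rsqr_pow2. apply Rsqr_pos_lt, him. }
    assert (hm : b * (P ^ 2) ^ (j - 1) * Im lam ^ 2 * Cmod (Y j) ^ 2 = 0) by lra.
    apply Rmult_integral in hm. destruct hm as [hm|hm]; [lra|].
    replace (Cmod (Y j) ^ 2) with (Cmod (Y j) * Cmod (Y j)) in hm by ring.
    apply Rmult_integral in hm. tauto.
  - apply RtoC_inj in e0. apply RtoC_inj in e1. tauto.
Qed.

(** * Solutions of the system and their lattice sequences *)

(** The weight P = q^(1/4) on y1 balances the coefficients of the two equations into
    one geometric sequence of ratio Q = P^2; the signs put both equations in the form
    Y_j = g_j Y_(j+1) - Y_(j+2). *)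
Definition interlace (P q : R) (y1 y2 : R -> C) (x : R) (j : nat) : C :=
  if Nat.even j
  then (RtoC ((-1) ^ Nat.div2 j) * y2 (/ q * (x * q ^ Nat.div2 j))%R)%C
  else (RtoC (- (-1) ^ Nat.div2 j * P) * y1 (x * q ^ Nat.div2 j)%R)%C.

Definition potential (q : R) (p r : R -> R) (x : R) (j : nat) : R :=
  if Nat.even j then p (x * q ^ Nat.div2 j) else r (x * q ^ Nat.div2 j).

Definition scale (P q x : R) : R := x * (1 - q) / P.

Lemma parity_cases (j : nat) : (exists n, j = (2 * n)%nat) \/ (exists n, j = (2 * n + 1)%nat).
Proof. destruct (Nat.Even_or_Odd j) as [h|h]; [left|right]; exact h. Qed.

Lemma even_double (n : nat) : Nat.even (2 * n) = true.
Proof. apply Nat.even_spec. exists n. reflexivity. Qed.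

Lemma even_double_1 (n : nat) : Nat.even (2 * n + 1) = false.
Proof.
  rewrite <- Nat.negb_odd. apply Bool.negb_false_iff, Nat.odd_spec. exists n. reflexivity.
Qed.

Lemma div2_double_1 (n : nat) : Nat.div2 (2 * n + 1) = n.
Proof. rewrite Nat.add_1_r. apply Nat.div2_succ_double. Qed.

Lemma interlace_even (P q : R) (y1 y2 : R -> C) (x : R) (n : nat) :
  interlace P q y1 y2 x (2 * n) = (RtoC ((-1) ^ n) * y2 (/ q * (x * q ^ n))%R)%C.
Proof. unfold interlace. rewrite even_double, Nat.div2_double. reflexivity. Qed.

Lemma interlace_odd (P q : R) (y1 y2 : R -> C) (x : R) (n : nat) :
  interlace P q y1 y2 x (2 * n + 1) = (RtoC (- (-1) ^ n * P) * y1 (x * q ^ n)%R)%C.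
Proof. unfold interlace. rewrite even_double_1, div2_double_1. reflexivity. Qed.

Lemma potential_even (q : R) (p r : R -> R) (x : R) (n : nat) :
  potential q p r x (2 * n) = p (x * q ^ n).
Proof. unfold potential. rewrite even_double, Nat.div2_double. reflexivity. Qed.

Lemma potential_odd (q : R) (p r : R -> R) (x : R) (n : nat) :
  potential q p r x (2 * n + 1) = r (x * q ^ n).
Proof. unfold potential. rewrite even_double_1, div2_double_1. reflexivity. Qed.

Lemma lim_even_odd (u : nat -> R) (l : R) :
  is_lim_seq (fun n => u (2 * n)%nat) l -> is_lim_seq (fun n => u (2 * n + 1)%nat) l ->
  is_lim_seq u l.
Proof.
  intros h0 h1. apply is_lim_seq_Reals. apply is_lim_seq_Reals in h0, h1.
  intros eps heps. destruct (h0 eps heps) as [n0 hn0]. destruct (h1 eps heps) as [n1 hn1].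
  exists (2 * (n0 + n1) + 1)%nat. intros j hj.
  destruct (parity_cases j) as [[n ->]|[n ->]]; [apply hn0|apply hn1]; lia.
Qed.

Lemma lattice_limit (q b x : R) (f : R -> R) (hq : 0 < q < 1) (hx : 0 <= x <= b)
  (hf : continuous_at_zero b f) : is_lim_seq (fun n => f (x * q ^ n)) (f 0).
Proof.
  refine (filterlim_comp _ _ _ (fun n => x * q ^ n) f eventually _ (locally (f 0)) _ hf).
  intros Pr [d hd].
  assert (hl : is_lim_seq (fun n => x * q ^ n) 0) by (apply geometric_limit, hq).
  destruct (proj1 (is_lim_seq_Reals _ _) hl d (cond_pos d)) as [N hN].
  exists N. intros n hn. apply hd.
  - specialize (hN n hn). exact hN.
  - destruct (pow_in_unit q hq n). split; [apply Rmult_le_pos; lra|nra].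
Qed.

Lemma lim_bounded (u : nat -> R) (l : R) : is_lim_seq u l ->
  exists M, forall n, Rabs (u n) <= M.
Proof.
  intros h.
  destruct (filterlim_bounded (K := R_AbsRing) (V := R_NormedModule) u) as [M hM].
  - exists l. exact h.
  - exists M. exact hM.
Qed.

Lemma potential_bounded (q a x : R) (p r : R -> R) (hq : 0 < q < 1) (hx : 0 <= x <= a)
  (hp : continuous_at_zero a p) (hr : continuous_at_zero a r) :
  exists M, forall j, Rabs (potential q p r x j) <= M.
Proof.
  destruct (lim_bounded _ _ (lattice_limit q a x p hq hx hp)) as [M1 h1].
  destruct (lim_bounded _ _ (lattice_limit q a x r hq hx hr)) as [M2 h2].
  exists (Rmax M1 M2). intros j. unfold potential.
  destruct (Nat.even j).
  - eapply Rle_trans; [apply h1|apply Rmax_l].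
  - eapply Rle_trans; [apply h2|apply Rmax_r].
Qed.

Lemma RtoC_neq_0 (x : R) : x <> 0 -> RtoC x <> RtoC 0.
Proof. intros h h'. apply h, RtoC_inj, h'. Qed.

(** The common factor is x (1 - q) in both equations, because
    -1/q divided by 1 - 1/q is 1/(1 - q). *)
Lemma lattice_equations (q a x : R) (p r : R -> R) (lam : C) (y1 y2 : R -> C)
  (hq : 0 < q < 1) (hx : 0 < x <= a) (hy : is_solution q a p r lam y1 y2) :
  (y1 x - y1 (q * x)%R = RtoC (x * (1 - q)) * ((lam - RtoC (r x)) * y2 x))%C /\
  (y2 x - y2 (/ q * x)%R = RtoC (x * (1 - q)) * ((lam - RtoC (p x)) * y1 x))%C.
Proof.
  destruct hy as [_ [_ h]].
  destruct (h x ltac:(lra)) as [d1 [d2 [[h1 _] [[h2 _] [e1 e2]]]]].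
  specialize (h1 ltac:(lra)). specialize (h2 ltac:(lra)).
  assert (hxq : RtoC (x * (1 - q)) <> RtoC 0) by (apply RtoC_neq_0; nra).
  assert (hq0 : RtoC q <> RtoC 0) by (apply RtoC_neq_0; lra).
  split.
  - replace ((lam - RtoC (r x)) * y2 x)%C with d1.
    + rewrite h1. field. exact hxq.
    + transitivity (lam * y2 x - RtoC (r x) * y2 x)%C; [rewrite <- e2|]; ring.
  - replace ((lam - RtoC (p x)) * y1 x)%C with (- RtoC (1 / q) * d2)%C.
    + rewrite h2. replace (x * (1 - / q)) with (- (x * (1 - q)) / q) by (field; lra).
      rewrite !RtoC_div, !RtoC_opp by lra. field. split; assumption.
    + transitivity (lam * y1 x - RtoC (p x) * y1 x)%C; [rewrite <- e1|]; ring.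
Qed.

Lemma pow4_unit (P q : R) (hP : 0 < P < 1) (hqP : q = P ^ 4) : 0 < q < 1.
Proof. rewrite hqP. apply pow_in_open_unit; [exact hP|lia]. Qed.

Lemma scale_even (P q : R) (hP : 0 < P < 1) (hqP : q = P ^ 4) (x : R) (n : nat) :
  scale P q x * (P ^ 2) ^ (2 * n) * P = x * q ^ n * (1 - q).
Proof.
  unfold scale. rewrite hqP, <- !pow_mult.
  replace (2 * (2 * n))%nat with (4 * n)%nat by lia. field. lra.
Qed.

Lemma scale_odd (P q : R) (hP : 0 < P < 1) (hqP : q = P ^ 4) (x : R) (n : nat) :
  scale P q x * (P ^ 2) ^ (2 * n + 1) = x * q ^ n * (1 - q) * P.
Proof.
  rewrite pow_add, pow_1.
  replace (scale P q x * ((P ^ 2) ^ (2 * n) * P ^ 2))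
    with (scale P q x * (P ^ 2) ^ (2 * n) * P * P) by ring.
  rewrite (scale_even P q hP hqP). reflexivity.
Qed.

Lemma interlace_csol (P q a x : R) (p r : R -> R) (lam : C) (y1 y2 : R -> C)
  (hP : 0 < P < 1) (hqP : q = P ^ 4)
  (hx : 0 < x <= a) (hy : is_solution q a p r lam y1 y2) :
  csol (ccoef P (scale P q x) (potential q p r x) lam) (y2 0) (RtoC (- P) * y1 0)%C
    (interlace P q y1 y2 x).
Proof.
  pose proof (pow4_unit P q hP hqP) as hq.
  assert (hqn : forall n, 0 < x * q ^ n <= a).
  { intros n. destruct (pow_in_unit q hq n). split; [apply Rmult_lt_0_compat; lra|nra]. }
  split.
  - intros j. destruct (parity_cases j) as [[n ->]|[n ->]].
    + replace (S (2 * n)) with (2 * n + 1)%nat by lia.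
      replace (S (2 * n + 1)) with (2 * S n)%nat by lia.
      rewrite !interlace_even, interlace_odd. unfold ccoef. rewrite potential_even.
      destruct (lattice_equations q a _ p r lam y1 y2 hq (hqn n) hy) as [_ h2].
      replace (/ q * (x * q ^ S n)) with (x * q ^ n) by (simpl; field; lra).
      set (X := x * q ^ n) in *.
      replace (y2 (/ q * X)%R) with (y2 X - RtoC (X * (1 - q)) * ((lam - RtoC (p X)) * y1 X))%C
        by (rewrite <- h2; ring).
      unfold X at 2. rewrite <- (scale_even P q hP hqP). fold X.
      change ((-1) ^ S n) with (-1 * (-1) ^ n).
      replace (-1 * (-1) ^ n) with (- (-1) ^ n) by ring.
      rewrite !RtoC_mult, !RtoC_opp. ring.
    + replace (S (2 * n + 1)) with (2 * S n)%nat by lia.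
      replace (S (2 * S n)) with (2 * S n + 1)%nat by lia.
      rewrite interlace_even, !interlace_odd. unfold ccoef. rewrite potential_odd.
      destruct (lattice_equations q a _ p r lam y1 y2 hq (hqn n) hy) as [h1 _].
      replace (/ q * (x * q ^ S n)) with (x * q ^ n) by (simpl; field; lra).
      replace (x * q ^ S n) with (q * (x * q ^ n)) by (simpl; ring).
      rewrite (scale_odd P q hP hqP).
      set (X := x * q ^ n) in *.
      replace (y1 X) with (y1 (q * X)%R + RtoC (X * (1 - q)) * ((lam - RtoC (r X)) * y2 X))%C
        by (rewrite <- h1; ring).
      change ((-1) ^ S n) with (-1 * (-1) ^ n).
      replace (-1 * (-1) ^ n) with (- (-1) ^ n) by ring.
      rewrite !RtoC_mult, !RtoC_opp. ring.
  - destruct hy as [r1 [r2 _]]. apply lim_even_odd.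
    + assert (hx' : 0 <= / q * x <= a * / q).
      { pose proof (Rinv_0_lt_compat q ltac:(lra)). split; nra. }
      pose proof (proj2 (cvg_filterlim _ _) (r2 _ hx')) as h.
      apply (is_lim_seq_ext (fun n => Cmod (y2 (/ q * x * q ^ n)%R - y2 0))); [|exact h].
      intros n. rewrite interlace_even, pattern_even, <- Rmult_assoc.
      replace (RtoC ((-1) ^ n) * y2 (/ q * x * q ^ n)%R - RtoC ((-1) ^ n) * y2 0)%C
        with (RtoC ((-1) ^ n) * (y2 (/ q * x * q ^ n)%R - y2 0))%C by ring.
      rewrite Cmod_mult, Cmod_R, pow_1_abs. ring.
    + pose proof (proj2 (cvg_filterlim _ _) (r1 x ltac:(lra))) as h.
      apply (is_lim_seq_ext (fun n => P * Cmod (y1 (x * q ^ n)%R - y1 0))).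
      * intros n. rewrite interlace_odd, pattern_odd.
        replace (- (-1) ^ n * P) with ((-1) ^ n * - P) by ring. rewrite RtoC_mult.
        replace (RtoC ((-1) ^ n) * RtoC (- P) * y1 (x * q ^ n)%R -
                 RtoC ((-1) ^ n) * (RtoC (- P) * y1 0))%C
          with (RtoC ((-1) ^ n) * (RtoC (- P) * (y1 (x * q ^ n)%R - y1 0)))%C by ring.
        rewrite !Cmod_mult, !Cmod_R, pow_1_abs, Rabs_Ropp, Rabs_right by lra. ring.
      * replace (Finite 0) with (Finite (P * 0)) by (f_equal; ring).
        apply is_lim_seq_mult'; [apply is_lim_seq_const|exact h].
Qed.

(** Uniqueness for the initial value problem, as needed for linear relations between
    up to three solutions: relations at zero propagate along every lattice. *)
Lemma solutions_dependent (P q a : R) (p r : R -> R) (lam al be ga : C)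
  (y1 y2 z1 z2 w1 w2 : R -> C) (hP : 0 < P < 1) (hqP : q = P ^ 4)
  (hp : continuous_at_zero a p) (hr : continuous_at_zero a r)
  (hy : is_solution q a p r lam y1 y2) (hz : is_solution q a p r lam z1 z2)
  (hw : is_solution q a p r lam w1 w2)
  (h1 : (al * y1 0 + be * z1 0 + ga * w1 0 = RtoC 0)%C)
  (h2 : (al * y2 0 + be * z2 0 + ga * w2 0 = RtoC 0)%C) :
  (forall x, 0 <= x <= a -> (al * y1 x + be * z1 x + ga * w1 x = RtoC 0)%C) /\
  (forall x, 0 <= x <= a * / q -> (al * y2 x + be * z2 x + ga * w2 x = RtoC 0)%C).
Proof.
  pose proof (pow4_unit P q hP hqP) as hq.
  pose proof (pow_in_open_unit P hP 2 ltac:(lia)) as hP2.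
  assert (main : forall x, 0 < x <= a -> forall j,
            (al * interlace P q y1 y2 x j + be * interlace P q z1 z2 x j +
             ga * interlace P q w1 w2 x j = RtoC 0)%C).
  { intros x hx j.
    destruct (potential_bounded q a x p r hq ltac:(lra) hp hr) as [M hM].
    pose proof (Rle_trans _ _ _ (Rabs_pos _) (hM 0%nat)) as hM0.
    assert (hb : 0 < scale P q x).
    { unfold scale. apply Rdiv_lt_0_compat; [apply Rmult_lt_0_compat|]; lra. }
    pose proof (csol_lin _ _ _ _ _ al be _ _ (interlace_csol P q a x p r lam y1 y2 hP hqP hx hy)
                 (interlace_csol P q a x p r lam z1 z2 hP hqP hx hz)) as k1.
    pose proof (csol_lin _ _ _ _ _ (RtoC 1) ga _ _ k1
                 (interlace_csol P q a x p r lam w1 w2 hP hqP hx hw)) as k2.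
    match type of k2 with csol _ ?u ?v _ =>
      replace u with (RtoC 0) in k2 by (rewrite <- h2; ring);
      replace v with (RtoC 0) in k2
    end.
    2:{ transitivity (RtoC (- P) * (al * y1 0 + be * z1 0 + ga * w1 0))%C;
          [rewrite h1|]; ring. }
    rewrite <- (csol_zero (P ^ 2) (scale P q x * (Cmod lam + M)) _ _ hP2
                  ltac:(apply Rmult_le_pos; [lra|pose proof (Cmod_ge_0 lam); lra])
                  (ccoef_bound P _ M _ lam hP hb hM) k2 j).
    ring. }
  split.
  - intros x hx. destruct (Req_dec x 0) as [->|hne]; [exact h1|].
    pose proof (main x ltac:(lra) (2 * 0 + 1)%nat) as h. rewrite !interlace_odd in h.
    simpl (q ^ 0) in h. rewrite !Rmult_1_r in h.
    assert (hP0 : RtoC (- (-1) ^ 0 * P) <> RtoC 0) by (apply RtoC_neq_0; simpl; lra).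
    set (u := RtoC (- (-1) ^ 0 * P)) in *.
    replace (al * y1 x + be * z1 x + ga * w1 x)%C
      with ((al * (u * y1 x) + be * (u * z1 x) + ga * (u * w1 x)) / u)%C
      by (field; exact hP0).
    rewrite h. field. exact hP0.
  - intros x hx. destruct (Req_dec x 0) as [->|hne]; [exact h2|].
    assert (hqx : 0 < q * x <= a).
    { split; [apply Rmult_lt_0_compat; lra|].
      apply Rle_trans with (q * (a * / q)); [apply Rmult_le_compat_l; lra|].
      right. field. lra. }
    pose proof (main (q * x) hqx (2 * 0)%nat) as h. rewrite !interlace_even in h.
    replace (/ q * (q * x * q ^ 0)) with x in h by (simpl; field; lra).
    simpl ((-1) ^ 0) in h. rewrite <- h. ring.
Qed.

(** * Existence of solutions *)

(** The difference quotients D_n satisfy D_n = (1 - q) e_n + q D_(n+1) and are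
    bounded, so they inherit the limit of e. *)
Lemma difference_quotient_limit (q t M : R) (f e : nat -> C) (l e0 : C)
  (hq : 0 < q < 1) (ht : 0 < t)
  (hstep : forall n, (f n - f (S n))%C = (RtoC (t * q ^ n * (1 - q)) * e n)%C)
  (he : cvg e e0) (hM : forall n, Cmod (f n - l) <= M * q ^ n) :
  cvg (fun n => ((f n - l) / RtoC (t * q ^ n))%C) e0.
Proof.
  assert (htq : forall n, 0 < t * q ^ n).
  { intros n. apply Rmult_lt_0_compat; [lra|apply pow_lt; lra]. }
  assert (htq' : forall n, RtoC (t * q ^ n) <> RtoC 0).
  { intros n. apply RtoC_neq_0. pose proof (htq n). lra. }
  set (D := fun n => ((f n - l) / RtoC (t * q ^ n))%C).
  assert (hD : forall n, D n = (RtoC (1 - q) * e n + RtoC q * D (S n))%C).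
  { intros n. unfold D.
    replace (f n - l)%C with (RtoC (t * q ^ n * (1 - q)) * e n + (f (S n) - l))%C
      by (rewrite <- hstep; ring).
    replace (t * q ^ S n) with (t * q ^ n * q) by (simpl; ring).
    rewrite (RtoC_mult (t * q ^ n) q), (RtoC_mult (t * q ^ n) (1 - q)).
    assert (RtoC q <> RtoC 0) by (apply RtoC_neq_0; lra).
    specialize (htq' n). field. split; assumption. }
  set (A := fun n => Cmod (D n - e0)). set (B := M / t + Cmod e0).
  assert (hB : forall n, A n <= B).
  { intros n. unfold A, B. unfold Cminus at 1.
    eapply Rle_trans; [apply Cmod_triangle|]. rewrite Cmod_opp. apply Rplus_le_compat_r.
    unfold D. rewrite Cmod_div by apply htq'. rewrite Cmod_R, Rabs_right by (pose proof (htq n); lra).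
    apply (Rmult_le_reg_r (t * q ^ n)); [apply htq|].
    unfold Rdiv at 1. rewrite Rmult_assoc, Rinv_l, Rmult_1_r by (pose proof (htq n); lra).
    eapply Rle_trans; [apply hM|]. right. field. lra. }
  assert (hA : forall n, A n <= (1 - q) * Cmod (e n - e0) + q * A (S n)).
  { intros n. unfold A at 1. rewrite hD.
    replace (RtoC (1 - q) * e n + RtoC q * D (S n) - e0)%C
      with (RtoC (1 - q) * (e n - e0) + RtoC q * (D (S n) - e0))%C
      by (rewrite RtoC_minus; ring).
    eapply Rle_trans; [apply Cmod_triangle|].
    rewrite !Cmod_mult, !Cmod_R, !Rabs_right by lra. apply Rle_refl. }
  unfold cvg. apply is_lim_seq_Reals. intros eps heps.
  destruct (proj1 (is_lim_seq_Reals _ _) he (eps / 2) ltac:(lra)) as [N hN].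
  exists N. intros n hn. unfold Rdist. rewrite Rminus_0_r.
  change (Cmod ((f n - l) / RtoC (t * q ^ n) - e0)) with (A n).
  rewrite Rabs_right by (apply Rle_ge, Cmod_ge_0).
  assert (hk : forall k m, (N <= m)%nat -> A m <= eps / 2 + q ^ k * B).
  { induction k as [|k IH]; intros m hm.
    - simpl. pose proof (hB m). lra.
    - eapply Rle_trans; [apply hA|]. specialize (IH (S m) ltac:(lia)).
      specialize (hN m hm). unfold Rdist in hN.
      rewrite Rminus_0_r, Rabs_right in hN by (apply Rle_ge, Cmod_ge_0).
      apply (Rmult_le_compat_l q) in IH; [|lra].
      apply Rlt_le, (Rmult_le_compat_l (1 - q)) in hN; [|lra].
      simpl. lra. }
  apply Rle_lt_trans with (eps / 2); [|lra].
  refine (is_lim_seq_le (fun _ => A n) (fun k => eps / 2 + B * q ^ k) (A n) (eps / 2) _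
            (is_lim_seq_const _) _).
  - intros k. rewrite Rmult_comm. apply hk, hn.
  - replace (Finite (eps / 2)) with (Finite (eps / 2 + 0)) by (f_equal; ring).
    apply is_lim_seq_plus'; [apply is_lim_seq_const|apply geometric_limit, hq].
Qed.

(** For each x a recurrence solution with the pattern given by c1 and c2 is chosen.
    By uniqueness the choice at q x is the shift of the choice at x, and this
    compatibility is the system of equations; regularity and the equations at zero
    follow from the geometric rate of convergence. *)
Lemma solution_exists (P q a : R) (p r : R -> R) (lam c1 c2 : C)
  (hP : 0 < P < 1) (hqP : q = P ^ 4)
  (hp : continuous_at_zero a p) (hr : continuous_at_zero a r) :
  exists y1 y2, is_solution q a p r lam y1 y2 /\ y1 0 = c1 /\ y2 0 = c2.
Proof.
  pose proof (pow4_unit P q hP hqP) as hq.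
  pose proof (pow_in_open_unit P hP 2 ltac:(lia)) as hP2.
  set (g := fun x => ccoef P (scale P q x) (potential q p r x) lam).
  set (k1 := (RtoC (- P) * c1)%C).
  assert (hgb : forall x, 0 < x <= a -> exists G, 0 <= G /\ forall j, Cmod (g x j) <= G * (P ^ 2) ^ j).
  { intros x hx.
    destruct (potential_bounded q a x p r hq ltac:(lra) hp hr) as [M hM].
    pose proof (Rle_trans _ _ _ (Rabs_pos _) (hM 0%nat)) as hM0.
    assert (hb : 0 < scale P q x).
    { unfold scale. apply Rdiv_lt_0_compat; [apply Rmult_lt_0_compat|]; lra. }
    exists (scale P q x * (Cmod lam + M)). split.
    - apply Rmult_le_pos; [lra|]. pose proof (Cmod_ge_0 lam). lra.
    - apply ccoef_bound; assumption. }
  assert (hex : forall x, exists Y, 0 < x <= a -> csol (g x) c2 k1 Y).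
  { intros x. destruct (classic (0 < x <= a)) as [hx|hx].
    - destruct (hgb x hx) as [G [hG hg]].
      destruct (csol_exists (P ^ 2) G (g x) c2 k1 hP2 hG hg) as [Y hY]. exists Y. auto.
    - exists (fun _ => RtoC 0). intros h. contradiction. }
  destruct (functional_choice _ hex) as [F hF].
  assert (hqx : forall x, 0 < x <= a -> 0 < q * x <= a) by (intros x hx; nra).
  (* The minus sign is that of the pattern after two steps. *)
  assert (hshift : forall x j, 0 < x <= a -> F (q * x) j = (- F x (S (S j)))%C).
  { intros x j hx. destruct (hgb _ (hqx x hx)) as [G [hG hg]].
    apply (csol_unique (P ^ 2) G (g (q * x)) c2 k1 _ (fun j => - F x (S (S j)))%C hP2 hG hg
             (hF _ (hqx x hx))).
    destruct (hF x hx) as [r1 r2]. split.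
    - intros i. rewrite (r1 (S (S i))).
      assert (hgi : g x (S (S i)) = g (q * x) i).
      { unfold g, ccoef.
        replace (potential q p r x (S (S i))) with (potential q p r (q * x) i).
        2:{ unfold potential. simpl. rewrite <- (Rmult_assoc x q), (Rmult_comm x q). reflexivity. }
        replace (scale P q x * (P ^ 2) ^ S (S i)) with (scale P q (q * x) * (P ^ 2) ^ i).
        2:{ unfold scale. rewrite hqP. simpl. field. lra. }
        reflexivity. }
      rewrite hgi. ring.
    - apply (is_lim_seq_ext (fun i => Cmod (F x (S (S i)) - pattern c2 k1 (S (S i))))).
      + intros i. rewrite pattern_SS.
        replace (- F x (S (S i)) - pattern c2 k1 i)%C
          with (- (F x (S (S i)) - - pattern c2 k1 i))%C by ring.
        rewrite Cmod_opp. reflexivity.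
      + apply (is_lim_seq_incr_1 (fun i => Cmod (F x (S i) - pattern c2 k1 (S i)))).
        apply (is_lim_seq_incr_1 (fun i => Cmod (F x i - pattern c2 k1 i))), r2. }
  assert (hshiftn : forall n x j, 0 < x <= a ->
            F (x * q ^ n) j = (RtoC ((-1) ^ n) * F x (2 * n + j)%nat)%C).
  { induction n as [|n IH]; intros x j hx.
    - simpl. rewrite Rmult_1_r. ring.
    - replace (x * q ^ S n) with (q * x * q ^ n) by (simpl; ring).
      rewrite (IH (q * x) j (hqx x hx)), hshift by exact hx.
      replace (2 * S n + j)%nat with (S (S (2 * n + j))) by lia.
      change ((-1) ^ S n) with (-1 * (-1) ^ n).
      replace (-1 * (-1) ^ n) with (- (-1) ^ n) by ring. rewrite RtoC_opp. ring. }
  assert (hrate : forall x, 0 < x <= a -> exists M, 0 <= M /\ forall j,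
            Cmod (F x j - pattern c2 k1 j) <= M * (P ^ 2) ^ j).
  { intros x hx. destruct (hgb x hx) as [G [hG hg]].
    destruct (csol_rate (P ^ 2) G (g x) c2 k1 (F x) hP2 hG hg (hF x hx)) as [M hM].
    exists M. split; [|exact hM]. pose proof (hM 0%nat) as h. simpl in h.
    pose proof (Cmod_ge_0 (F x 0%nat - pattern c2 k1 0)). lra. }
  assert (hQ2n : forall n, (P ^ 2) ^ (2 * n) = q ^ n).
  { intros n. rewrite hqP, <- !pow_mult. f_equal. lia. }
  set (y1 := fun x => if Req_EM_T x 0 then c1 else (RtoC (- / P) * F x 1%nat)%C).
  set (y2 := fun x => if Req_EM_T x 0 then c2 else F (q * x) 0%nat).
  assert (hy1 : forall x, x <> 0 -> y1 x = (RtoC (- / P) * F x 1%nat)%C).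
  { intros x hx. unfold y1. destruct (Req_EM_T x 0); [contradiction|reflexivity]. }
  assert (hy2 : forall x, x <> 0 -> y2 x = F (q * x) 0%nat).
  { intros x hx. unfold y2. destruct (Req_EM_T x 0); [contradiction|reflexivity]. }
  assert (hy10 : y1 0 = c1) by (unfold y1; destruct (Req_EM_T 0 0); [reflexivity|lra]).
  assert (hy20 : y2 0 = c2) by (unfold y2; destruct (Req_EM_T 0 0); [reflexivity|lra]).
  assert (hpos : forall x n, 0 < x -> 0 < x * q ^ n).
  { intros x n hx. apply Rmult_lt_0_compat; [exact hx|apply pow_lt; lra]. }
  assert (hle : forall x n, 0 < x <= a -> 0 < x * q ^ n <= a).
  { intros x n hx. split; [apply hpos; lra|]. destruct (pow_in_unit q hq n). nra. }
  assert (hdom : forall x, 0 < x <= a * / q -> 0 < q * x <= a).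
  { intros x hx. split; [apply Rmult_lt_0_compat; lra|].
    apply Rle_trans with (q * (a * / q)); [apply Rmult_le_compat_l; lra|].
    right. field. lra. }
  assert (hPinv : 0 < / P) by (apply Rinv_0_lt_compat; lra).
  assert (rate1 : forall x, 0 < x <= a -> exists M, forall n,
            Cmod (y1 (x * q ^ n)%R - c1) <= M * q ^ n).
  { intros x hx. destruct (hrate x hx) as [M [hM0 hM]]. exists (/ P * (M * P ^ 2)). intros n.
    rewrite hy1 by (pose proof (hpos x n ltac:(lra)); lra). rewrite hshiftn by exact hx.
    specialize (hM (2 * n + 1)%nat). rewrite pattern_odd in hM. unfold k1 in hM.
    replace (RtoC (- / P) * (RtoC ((-1) ^ n) * F x (2 * n + 1)%nat) - c1)%C
      with (RtoC (- / P * (-1) ^ n) *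
            (F x (2 * n + 1)%nat - RtoC ((-1) ^ n) * (RtoC (- P) * c1)))%C.
    - rewrite Cmod_mult, Cmod_R, Rabs_mult, pow_1_abs, Rmult_1_r, Rabs_Ropp, Rabs_right by lra.
      rewrite pow_add, hQ2n, pow_1 in hM. rewrite Rmult_assoc.
      apply Rmult_le_compat_l; [lra|]. eapply Rle_trans; [exact hM|]. right. ring.
    - assert (h1 : (RtoC (- / P * (-1) ^ n) * (RtoC ((-1) ^ n) * RtoC (- P)))%C = RtoC 1).
      { rewrite <- !RtoC_mult. f_equal.
        transitivity (((-1) ^ n * (-1) ^ n) * (/ P * P)); [ring|].
        rewrite <- pow_add, Rinv_l by lra.
        replace (n + n)%nat with (2 * n)%nat by lia. rewrite pow_mult.
        replace ((-1) ^ 2) with 1 by ring. rewrite pow1. ring. }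
      transitivity (RtoC (- / P * (-1) ^ n) * F x (2 * n + 1)%nat -
         (RtoC (- / P * (-1) ^ n) * (RtoC ((-1) ^ n) * RtoC (- P))) * c1)%C; [ring|].
      rewrite h1, RtoC_mult. ring. }
  assert (rate2 : forall x, 0 < x <= a * / q -> exists M, forall n,
            Cmod (y2 (x * q ^ n)%R - c2) <= M * q ^ n).
  { intros x hx. destruct (hrate _ (hdom x hx)) as [M [hM0 hM]]. exists M. intros n.
    rewrite hy2 by (pose proof (hpos x n ltac:(lra)); lra).
    replace (q * (x * q ^ n)) with (q * x * q ^ n) by ring.
    rewrite hshiftn by (apply hdom, hx).
    specialize (hM (2 * n)%nat). rewrite pattern_even, hQ2n in hM. rewrite Nat.add_0_r.
    assert (h1 : (RtoC ((-1) ^ n) * RtoC ((-1) ^ n))%C = RtoC 1).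
    { rewrite <- RtoC_mult. f_equal. rewrite <- pow_add.
      replace (n + n)%nat with (2 * n)%nat by lia. rewrite pow_mult.
      replace ((-1) ^ 2) with 1 by ring. apply pow1. }
    replace (RtoC ((-1) ^ n) * F (q * x)%R (2 * n)%nat - c2)%C
      with (RtoC ((-1) ^ n) * (F (q * x)%R (2 * n)%nat - RtoC ((-1) ^ n) * c2))%C.
    - rewrite Cmod_mult, Cmod_R, pow_1_abs, Rmult_1_l. exact hM.
    - transitivity (RtoC ((-1) ^ n) * F (q * x)%R (2 * n)%nat -
                    (RtoC ((-1) ^ n) * RtoC ((-1) ^ n)) * c2)%C; [ring|].
      rewrite h1. ring. }
  assert (cvg1 : forall x, 0 < x <= a -> cvg (fun n => y1 (x * q ^ n)%R) c1).
  { intros x hx. destruct (rate1 x hx) as [M hM].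
    apply (cvg_bounded_by _ _ _ hM), geometric_limit, hq. }
  assert (cvg2 : forall x, 0 < x <= a * / q -> cvg (fun n => y2 (x * q ^ n)%R) c2).
  { intros x hx. destruct (rate2 x hx) as [M hM].
    apply (cvg_bounded_by _ _ _ hM), geometric_limit, hq. }
  assert (eq1 : forall x, 0 < x <= a ->
     (y1 x - y1 (q * x)%R = RtoC (x * (1 - q)) * ((lam - RtoC (r x)) * y2 x))%C).
  { intros x hx. rewrite (hy1 x), (hy1 (q * x)), (hy2 x) by (try nra).
    rewrite !hshift by exact hx. rewrite (proj1 (hF x hx) 1%nat) at 1.
    unfold g, ccoef. replace (potential q p r x 1) with (r x)
      by (unfold potential; simpl; f_equal; ring).
    replace (scale P q x * (P ^ 2) ^ 1) with (x * (1 - q) * P) by (unfold scale; field; lra).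
    rewrite (RtoC_mult (x * (1 - q)) P), RtoC_opp, RtoC_inv by lra.
    field. apply RtoC_neq_0. lra. }
  assert (eq2 : forall x, 0 < x <= a ->
     (y2 x - y2 (/ q * x)%R = RtoC (x * (1 - q)) * ((lam - RtoC (p x)) * y1 x))%C).
  { intros x hx. pose proof (Rinv_0_lt_compat q ltac:(lra)).
    rewrite (hy1 x), (hy2 (/ q * x)), (hy2 x) by (try nra).
    replace (q * (/ q * x)) with x by (field; lra).
    rewrite !hshift by exact hx. rewrite (proj1 (hF x hx) 0%nat) at 1.
    unfold g, ccoef. replace (potential q p r x 0) with (p x)
      by (unfold potential; simpl; f_equal; ring).
    replace (scale P q x * (P ^ 2) ^ 0) with (x * (1 - q) * / P) by (unfold scale; simpl; field; lra).
    rewrite (RtoC_mult (x * (1 - q)) (/ P)), RtoC_opp. ring. }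
  exists y1, y2. split; [|split; assumption].
  split; [|split].
  - intros x hx. apply cvg_filterlim. rewrite hy10.
    destruct (Req_dec x 0) as [->|hne]; [|apply cvg1; lra].
    apply (cvg_ext (fun _ => c1)); [|apply cvg_const].
    intros n. rewrite Rmult_0_l. symmetry. exact hy10.
  - intros x hx. apply cvg_filterlim. rewrite hy20.
    destruct (Req_dec x 0) as [->|hne]; [|apply cvg2; lra].
    apply (cvg_ext (fun _ => c2)); [|apply cvg_const].
    intros n. rewrite Rmult_0_l. symmetry. exact hy20.
  - intros x hx. destruct (Req_dec x 0) as [->|hne].
    + exists ((lam - RtoC (r 0)) * c2)%C, (- RtoC q * ((lam - RtoC (p 0)) * c1))%C.
      rewrite hy10, hy20. split; [|split; [|split]].
      * split; [intros h; lra|]. intros _ t ht. apply cvg_filterlim. rewrite hy10.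
        destruct (rate1 t ht) as [M hM].
        refine (difference_quotient_limit q t M (fun n => y1 (t * q ^ n)%R)
                 (fun n => (lam - RtoC (r (t * q ^ n)%R)) * y2 (t * q ^ n)%R)%C _ _ hq (proj1 ht) _ _ hM).
        -- intros n. replace (t * q ^ S n) with (q * (t * q ^ n)) by (simpl; ring).
           apply eq1, hle, ht.
        -- apply cvg_mult.
           ++ apply cvg_plus; [apply cvg_const|]. apply cvg_opp.
              apply (is_lim_seq_ext (fun n => Rabs (r (t * q ^ n) - r 0))).
              ** intros n. rewrite <- RtoC_minus, Cmod_R. reflexivity.
              ** apply (proj1 (is_lim_seq_abs_0 _)).
                 replace (Finite 0) with (Finite (r 0 - r 0)) by (f_equal; ring).
                 apply is_lim_seq_minus'; [|apply is_lim_seq_const].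
                 apply (lattice_limit q a t r hq ltac:(lra) hr).
           ++ apply cvg2. split; [apply ht|].
              apply Rle_trans with a; [apply ht|].
              rewrite <- (Rmult_1_r a) at 1. apply Rmult_le_compat_l; [lra|].
              rewrite <- Rinv_1 at 1. apply Rinv_le_contravar; lra.
      * split; [intros h; lra|]. intros _. split; [intros h; lra|].
        intros _ t ht. apply cvg_filterlim. rewrite hy20.
        destruct (rate2 t ht) as [M hM]. pose proof (hdom t ht) as htq.
        refine (difference_quotient_limit q t M (fun n => y2 (t * q ^ n)%R)
                 (fun n => - RtoC q * ((lam - RtoC (p (q * t * q ^ n)%R)) * y1 (q * t * q ^ n)%R))%C
                 _ _ hq (proj1 ht) _ _ hM).
        -- intros n. pose proof (eq2 _ (hle _ n htq)) as h.
           replace (/ q * (q * t * q ^ n)) with (t * q ^ n) in h by (field; lra).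
           replace (t * q ^ S n) with (q * t * q ^ n) by (simpl; ring).
           transitivity (- (y2 (q * t * q ^ n)%R - y2 (t * q ^ n)%R))%C; [ring|].
           rewrite h. replace (q * t * q ^ n * (1 - q)) with (t * q ^ n * (1 - q) * q) by ring.
           rewrite (RtoC_mult (t * q ^ n * (1 - q)) q). ring.
        -- apply cvg_mult; [apply cvg_const|]. apply cvg_mult; [|apply cvg1, htq].
           apply cvg_plus; [apply cvg_const|]. apply cvg_opp.
           apply (is_lim_seq_ext (fun n => Rabs (p (q * t * q ^ n) - p 0))).
           ** intros n. rewrite <- RtoC_minus, Cmod_R. reflexivity.
           ** apply (proj1 (is_lim_seq_abs_0 _)).
              replace (Finite 0) with (Finite (p 0 - p 0)) by (f_equal; ring).
              apply is_lim_seq_minus'; [|apply is_lim_seq_const].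
              apply (lattice_limit q a (q * t) p hq ltac:(lra) hp).
      * replace (1 / q) with (/ q) by (field; lra). rewrite RtoC_inv by lra.
        field. apply RtoC_neq_0. lra.
      * ring.
    + assert (hx' : 0 < x <= a) by lra.
      assert (hxq : RtoC (x * (1 - q)) <> RtoC 0) by (apply RtoC_neq_0; nra).
      assert (hq0 : RtoC q <> RtoC 0) by (apply RtoC_neq_0; lra).
      exists ((y1 x - y1 (q * x)%R) / RtoC (x * (1 - q)))%C,
             ((y2 x - y2 (/ q * x)%R) / RtoC (x * (1 - / q)))%C.
      split; [|split; [|split]].
      * split; [reflexivity|intros h; contradiction].
      * split; [reflexivity|intros h; contradiction].
      * rewrite (eq2 x hx').
        replace (x * (1 - / q)) with (- (x * (1 - q)) / q) by (field; lra).
        rewrite !RtoC_div, !RtoC_opp by lra. field. split; assumption.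
      * rewrite (eq1 x hx'). field. exact hxq.
Qed.

(** * Eigenvalues and their asymptotics *)

(** An eigenfunction satisfies (k11^2 + k12^2) y = c phi with
    c = k12 y1(0) - k11 y2(0), hence c Delta = 0.  When k11 = k12 = 0, phi vanishes, and every lam is an
    eigenvalue since the second condition has a nontrivial solution in the plane of
    all solutions. *)
Lemma eigenvalue_iff_zero (P q a : R) (p r : R -> R) (k11 k12 k21 k22 : R)
  (phi1 phi2 : R -> C -> C) (lam : C) (hP : 0 < P < 1) (hqP : q = P ^ 4) (ha : 0 < a)
  (hp : continuous_at_zero a p) (hr : continuous_at_zero a r)
  (hphi : is_phi q a p r k11 k12 phi1 phi2) :
  is_eigenvalue q a p r k11 k12 k21 k22 lam <->
  Delta_char q a k21 k22 phi1 phi2 lam = RtoC 0.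
Proof.
  pose proof (pow4_unit P q hP hqP) as hq.
  assert (haq : 0 < a * / q) by (apply Rmult_lt_0_compat; [lra|apply Rinv_0_lt_compat; lra]).
  destruct (hphi lam) as [hs [f1 f2]].
  pose proof (solutions_dependent P q a p r lam) as hdep.
  unfold Delta_char. split.
  - intros [y1 [y2 [hy [hnt [b1 b2]]]]].
    set (n := (RtoC k11 * RtoC k11 + RtoC k12 * RtoC k12)%C).
    set (c := (RtoC k12 * y1 0 - RtoC k11 * y2 0)%C).
    assert (hn1 : (n * y1 0 = c * RtoC k12)%C).
    { unfold n, c. transitivity (RtoC k12 * (RtoC k12 * y1 0 - RtoC k11 * y2 0) +
        RtoC k11 * (RtoC k11 * y1 0 + RtoC k12 * y2 0))%C; [ring|]. rewrite b1. ring. }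
    assert (hn2 : (n * y2 0 = c * RtoC (- k11))%C).
    { unfold n, c. rewrite RtoC_opp. transitivity (- RtoC k11 * (RtoC k12 * y1 0 - RtoC k11 * y2 0) +
        RtoC k12 * (RtoC k11 * y1 0 + RtoC k12 * y2 0))%C; [ring|]. rewrite b1. ring. }
    destruct (hdep n (- c)%C (RtoC 0) y1 y2 _ _ _ _ hP hqP hp hr hy hs hs) as [e1 e2].
    { rewrite f1. replace (n * y1 0 + - c * RtoC k12 + RtoC 0 * RtoC k12)%C
        with (n * y1 0 - c * RtoC k12)%C by ring. rewrite hn1. ring. }
    { rewrite f2. replace (n * y2 0 + - c * RtoC (- k11) + RtoC 0 * RtoC (- k11))%C
        with (n * y2 0 - c * RtoC (- k11))%C by ring. rewrite hn2. ring. }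
    specialize (e1 a ltac:(lra)). specialize (e2 (a * / q) ltac:(lra)). cbv beta in e1, e2.
    assert (hc : (c * (RtoC k21 * phi1 a lam + RtoC k22 * phi2 (a * / q)%R lam) = RtoC 0)%C).
    { transitivity (n * (RtoC k21 * y1 a + RtoC k22 * y2 (a * / q)%R) -
         (RtoC k21 * (n * y1 a + - c * phi1 a lam + RtoC 0 * phi1 a lam) +
          RtoC k22 * (n * y2 (a * / q)%R + - c * phi2 (a * / q)%R lam + RtoC 0 * phi2 (a * / q)%R lam)))%C;
        [ring|]. rewrite e1, e2, b2. ring. }
    destruct (classic (c = RtoC 0)) as [hc0|hc0].
    2:{ destruct (classic ((RtoC k21 * phi1 a lam + RtoC k22 * phi2 (a * / q)%R lam)%C = RtoC 0))
          as [h|h]; [exact h|]. exfalso. exact (Cmult_neq_0 _ _ hc0 h hc). }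
    (* An eigenfunction does not vanish at zero, so c = 0 forces n = 0. *)
    assert (hk : k11 = 0 /\ k12 = 0).
    { destruct (classic (n = RtoC 0)) as [hn|hn].
      - assert (hkk : k11 * k11 + k12 * k12 = 0).
        { apply RtoC_inj. rewrite RtoC_plus, !RtoC_mult. exact hn. }
        split; nra.
      - exfalso.
        assert (z0 : forall y : C, (n * y = RtoC 0)%C -> y = RtoC 0).
        { intros y h. destruct (classic (y = RtoC 0)) as [h'|h']; [exact h'|].
          exfalso. exact (Cmult_neq_0 _ _ hn h' h). }
        assert (z1 : y1 0 = RtoC 0) by (apply z0; rewrite hn1, hc0; ring).
        assert (z2 : y2 0 = RtoC 0) by (apply z0; rewrite hn2, hc0; ring).
        destruct (hdep (RtoC 1) (RtoC 0) (RtoC 0) y1 y2 _ _ _ _ hP hqP hp hr hy hy hy) as [g1 g2].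
        { rewrite z1. ring. } { rewrite z2. ring. }
        destruct hnt as [[x [hx hne]]|[x [hx hne]]]; apply hne.
        + rewrite <- (g1 x hx). ring.
        + rewrite <- (g2 x hx). ring. }
    destruct hk as [-> ->].
    destruct (hdep (RtoC 1) (RtoC 0) (RtoC 0) _ _ _ _ _ _ hP hqP hp hr hs hs hs) as [g1 g2].
    { rewrite f1. ring. } { rewrite f2, Ropp_0. ring. }
    specialize (g1 a ltac:(lra)). specialize (g2 (a * / q) ltac:(lra)). cbv beta in g1, g2.
    transitivity (RtoC k21 * (RtoC 1 * phi1 a lam + RtoC 0 * phi1 a lam + RtoC 0 * phi1 a lam) +
       RtoC k22 * (RtoC 1 * phi2 (a * / q)%R lam + RtoC 0 * phi2 (a * / q)%R lam +
                   RtoC 0 * phi2 (a * / q)%R lam))%C; [ring|]. rewrite g1, g2. ring.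
  - intros hD.
    destruct (classic (k11 = 0 /\ k12 = 0)) as [[-> ->]|hk].
    + (* A nontrivial combination of two basis solutions satisfies the second condition. *)
      destruct (solution_exists P q a p r lam (RtoC 1) (RtoC 0) hP hqP hp hr)
        as [u1 [u2 [hu [u10 u20]]]].
      destruct (solution_exists P q a p r lam (RtoC 0) (RtoC 1) hP hqP hp hr)
        as [v1 [v2 [hv [v10 v20]]]].
      set (B := fun y1 y2 : R -> C => (RtoC k21 * y1 a + RtoC k22 * y2 (a * / q)%R)%C).
      assert (hg : exists g1 g2 : C, (g1 <> RtoC 0 \/ g2 <> RtoC 0) /\
                     (g1 * B u1 u2 + g2 * B v1 v2 = RtoC 0)%C).
      { destruct (classic (B v1 v2 = RtoC 0)) as [h|h].
        - exists (RtoC 0), (RtoC 1). split; [right; apply C1_nz|]. rewrite h. ring.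
        - exists (B v1 v2), (- B u1 u2)%C. split; [left; exact h|ring]. }
      destruct hg as [g1 [g2 [hne hB]]].
      destruct (solution_exists P q a p r lam g1 g2 hP hqP hp hr) as [y1 [y2 [hy [y10 y20]]]].
      exists y1, y2. split; [exact hy|]. split; [|split].
      * destruct hne as [h|h]; [left|right]; exists 0; (split; [lra|]).
        -- rewrite y10. exact h.
        -- rewrite y20. exact h.
      * ring.
      * destruct (hdep (RtoC 1) (- g1)%C (- g2)%C y1 y2 u1 u2 v1 v2 hP hqP hp hr hy hu hv)
          as [e1 e2].
        { rewrite y10, u10, v10. ring. } { rewrite y20, u20, v20. ring. }
        specialize (e1 a ltac:(lra)). specialize (e2 (a * / q) ltac:(lra)).
        transitivity (RtoC k21 * (RtoC 1 * y1 a + - g1 * u1 a + - g2 * v1 a) +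
           RtoC k22 * (RtoC 1 * y2 (a * / q)%R + - g1 * u2 (a * / q)%R + - g2 * v2 (a * / q)%R) +
           (g1 * B u1 u2 + g2 * B v1 v2))%C; [unfold B; ring|].
        rewrite e1, e2, hB. ring.
    + exists (fun x => phi1 x lam), (fun x => phi2 x lam).
      split; [exact hs|]. split; [|split].
      * destruct (Req_dec k12 0) as [h|h].
        -- right. exists 0. split; [lra|]. rewrite f2. apply RtoC_neq_0. intros h'.
           apply hk. split; lra.
        -- left. exists 0. split; [lra|]. rewrite f1. apply RtoC_neq_0, h.
      * rewrite f1, f2, RtoC_opp. ring.
      * exact hD.
Qed.

(** For real lam the imaginary part solves the same recurrence with limit zero. *)
Lemma real_part_sol (P b smax l rho k0 k1 : R) (s : nat -> R) (tau : nat) (Y : nat -> C)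
  (hP : 0 < P < 1) (hb : 0 < b) (hs : forall j, Rabs (s j) <= smax)
  (hrho : forall j, rho * (k0 * chi j + k1 * chi (j + 3)) = chi (j + tau))
  (hY : csol (ccoef P b s (RtoC l)) (RtoC k0) (RtoC k1) Y) :
  sol (coef P b s l) tau (fun j => rho * Re (Y j)) /\ forall j, Im (Y j) = 0.
Proof.
  pose proof (pow_in_open_unit P hP 2 ltac:(lia)) as h2.
  destruct hY as [hrec hlim].
  assert (hg : forall j, ccoef P b s (RtoC l) j = RtoC (coef P b s l j)).
  { intros j. unfold ccoef, coef. rewrite <- RtoC_minus, <- RtoC_mult. reflexivity. }
  assert (hpat : forall j, pattern (RtoC k0) (RtoC k1) j = RtoC (k0 * chi j + k1 * chi (j + 3))).
  { intros j. unfold pattern. rewrite <- !RtoC_mult, <- RtoC_plus. reflexivity. }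
  split.
  - split.
    + intros j. cbv beta. rewrite (hrec j), hg. unfold Cminus. rewrite re_plus, re_opp, re_scal_l. ring.
    + apply (proj2 (is_lim_seq_abs_0 _)).
      apply (squeeze_zero _ (fun j => Rabs rho * Cmod (Y j - pattern (RtoC k0) (RtoC k1) j))).
      * intros j. split; [apply Rabs_pos|].
        rewrite <- hrho, <- Rmult_minus_distr_l, Rabs_mult.
        apply Rmult_le_compat_l; [apply Rabs_pos|]. rewrite hpat.
        eapply Rle_trans; [|apply re_le_Cmod].
        unfold Cminus. rewrite re_plus, re_opp, re_RtoC. apply Rle_refl.
      * replace (Finite 0) with (Finite (Rabs rho * 0)) by (f_equal; ring).
        apply is_lim_seq_mult'; [apply is_lim_seq_const|exact hlim].
  - intros j. apply Rabs_eq_0. apply Rle_antisym; [|apply Rabs_pos].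
    assert (hl : is_lim_seq (fun j => Rabs (Im (Y j))) 0).
    { apply (squeeze_zero _ _) with (2 := hlim). intros i. split; [apply Rabs_pos|].
      eapply Rle_trans; [|apply im_le_Cmod]. rewrite hpat.
      unfold Cminus. rewrite im_plus, im_opp, im_RtoC, Ropp_0, Rplus_0_r. apply Rle_refl. }
    pose proof (Rle_trans _ _ _ (Rabs_pos _) (hs 0%nat)) as hsm.
    pose proof (Rabs_pos l) as hl0.
    eapply Rle_trans.
    + apply (second_order_bound (P ^ 2) (b * (Rabs l + smax)) 0 0 (fun j => Rabs (Im (Y j))) h2).
      * apply Rmult_le_pos; lra.
      * lra.
      * intros; apply Rabs_pos.
      * intros i. rewrite (hrec i) at 1. rewrite hg.
        unfold Cminus. rewrite im_plus, im_opp, im_scal_l.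
        eapply Rle_trans; [apply Rabs_triang|]. rewrite Rabs_Ropp, Rabs_mult.
        pose proof (coef_bound P b smax (Rabs l) l s hP hb hs (Rle_refl _) i).
        pose proof (Rabs_pos (Im (Y (S i)))). nra.
      * replace (Finite 0) with (Finite (0 + 0)) by (f_equal; ring).
        apply is_lim_seq_plus'; [exact hl|].
        apply (is_lim_seq_incr_1 (fun j => Rabs (Im (Y j)))), hl.
    + right. field. lra.
Qed.

(** Dropping the first [J] terms multiplies b by Q^J and shifts the phase by [J]. *)
Lemma asymptotics_of_zeros (E : C -> Prop) (P b smax kap rho k0 k1 : R) (s : nat -> R)
  (tau o J : nat) (Y : C -> nat -> C) (mu' eps : nat -> R)
  (hP : 0 < P < 1) (hb : 0 < b) (hs : forall j, Rabs (s j) <= smax)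
  (hk : k0 <> 0 \/ k1 <> 0)
  (hrho : forall j, rho * (k0 * chi j + k1 * chi (j + 3)) = chi (j + tau)) (hrho0 : rho <> 0)
  (hY : forall lam, csol (ccoef P b s lam) (RtoC k0) (RtoC k1) (Y lam))
  (hE : forall z, E z <-> Y z J = RtoC 0)
  (ho : (o <= 1)%nat) (hpar : Nat.odd (o + (J + tau)) = false)
  (hmu : forall n, mu' (S n) = mu P (b * (P ^ 2) ^ J) o n)
  (heps : forall n, P ^ (4 * n) <= kap * eps (S n)) :
  eigenvalues_asymp E mu' eps.
Proof.
  pose proof (fun l => real_part_sol P b smax l rho k0 k1 s tau (Y (RtoC l)) hP hb hs hrho
                (hY (RtoC l))) as hreal.
  apply (asymptotics_of_real_zeros E P (b * (P ^ 2) ^ J) smax kap (fun j => s (J + j)%nat)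
           (J + tau) o (fun l j => rho * Re (Y (RtoC l) (J + j)%nat)) mu' eps hP); auto.
  - apply Rmult_lt_0_compat; [lra|apply pow_lt, pow_lt; lra].
  - intros l. destruct (sol_shift _ _ J _ (proj1 (hreal l))) as [h1 h2].
    split; [|exact h2]. intros j. rewrite (h1 j). unfold coef. rewrite pow_add. ring.
  - intros z. rewrite hE. split.
    + intros h0.
      pose proof (zeros_are_real P b smax s z k0 k1 (Y z) J hP hb hs hk (hY z) h0) as him.
      assert (hz : z = RtoC (Re z)).
      { destruct z as [u v]. simpl in him. rewrite him. reflexivity. }
      exists (Re z). split; [exact hz|]. rewrite <- hz, Nat.add_0_r, h0.
      change (Re (RtoC 0)) with 0. ring.
    + intros [l [-> h0]]. rewrite Nat.add_0_r in h0.
      apply Rmult_integral in h0. destruct h0 as [h0|h0]; [contradiction|].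
      pose proof (proj2 (hreal l) J) as him.
      destruct (Y (RtoC l) J) as [u v]. simpl in h0, him. rewrite h0, him. reflexivity.
Qed.

Lemma Rpower_quarter (P q y : R) (k : nat) (hP : 0 < P < 1) (hqP : q = P ^ 4) :
  4 * y = - INR k -> Rpower q y = / P ^ k.
Proof.
  intros h. rewrite hqP, <- (Rpower_pow 4) by lra.
  rewrite Rpower_mult. replace (INR 4 * y) with (- INR k) by (simpl; lra).
  rewrite Rpower_Ropp, Rpower_pow by lra. reflexivity.
Qed.

Lemma quarter_power (q : R) (hq : 0 < q < 1) : exists P, 0 < P < 1 /\ q = P ^ 4.
Proof.
  exists (Rpower q (/ 4)). assert (h0 : 0 < Rpower q (/ 4)) by apply exp_pos.
  assert (h4 : q = Rpower q (/ 4) ^ 4).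
  { rewrite <- Rpower_pow by exact h0. rewrite Rpower_mult.
    replace (/ 4 * INR 4) with 1 by (simpl; field). rewrite Rpower_1; lra. }
  split; [|exact h4]. split; [exact h0|].
  apply Rnot_le_lt. intros h. pose proof (pow_R1_Rle _ 4 h). lra.
Qed.

Theorem theorem3p4 (q a : R) (p r : R -> R) (k11 k12 k21 k22 : R)
  (hq : 0 < q < 1) (ha : 0 < a)
  (hp0 : continuous_at_zero a p) (hr0 : continuous_at_zero a r)
  (hp1 : in_Lq1 q a p) (hr1 : in_Lq1 q a r)
  (hk2 : k21 <> 0 \/ k22 <> 0) :
  (forall phi1 phi2 : R -> C -> C,
     is_phi q a p r k11 k12 phi1 phi2 ->
     forall lam : C,
       is_eigenvalue q a p r k11 k12 k21 k22 lam <->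
       Delta_char q a k21 k22 phi1 phi2 lam = RtoC 0) /\
  (k12 <> 0 -> k11 = 0 ->
     (k21 = 0 ->
        eigenvalues_asymp (is_eigenvalue q a p r k11 k12 k21 k22)
          (fun m => Rpower q (- INR m + 1 / 2) / (a * (1 - q)))
          (fun m => Rpower q (INR m / 2))) /\
     (k22 = 0 ->
        eigenvalues_asymp (is_eigenvalue q a p r k11 k12 k21 k22)
          (fun m => Rpower q (- INR m + 1 / 2) / (a * (1 - q)))
          (fun m => Rpower q (INR m)))) /\
  (k12 = 0 -> k11 <> 0 ->
     (k21 = 0 ->
        eigenvalues_asymp (is_eigenvalue q a p r k11 k12 k21 k22)
          (fun m => Rpower q (- INR m + 1) / (a * (1 - q)))
          (fun m => Rpower q (INR m / 2))) /\
     (k22 = 0 ->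
        eigenvalues_asymp (is_eigenvalue q a p r k11 k12 k21 k22)
          (fun m => Rpower q (- INR m) / (a * (1 - q)))
          (fun m => Rpower q (INR m)))).
Proof.
  destruct (quarter_power q hq) as [P [hP hqP]].
  split.
  { intros phi1 phi2 hphi lam.
    apply (eigenvalue_iff_zero P q a p r); assumption. }
  set (b := scale P q a). set (s := potential q p r a).
  assert (hb : 0 < b).
  { unfold b, scale. apply Rdiv_lt_0_compat; [apply Rmult_lt_0_compat|]; lra. }
  destruct (potential_bounded q a a p r hq ltac:(lra) hp0 hr0) as [smax hs]. fold s in hs.
  assert (hex : forall lam : C, exists y : (R -> C) * (R -> C),
            is_solution q a p r lam (fst y) (snd y) /\
            fst y 0 = RtoC k12 /\ snd y 0 = RtoC (- k11)).
  { intros lam. destruct (solution_exists P q a p r lam (RtoC k12) (RtoC (- k11)) hP hqP hp0 hr0)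
      as [y1 [y2 h]]. exists (y1, y2). exact h. }
  destruct (functional_choice _ hex) as [Phi hPhi].
  set (Y := fun lam => interlace P q (fst (Phi lam)) (snd (Phi lam)) a).
  assert (hY : forall lam, csol (ccoef P b s lam) (RtoC (- k11)) (RtoC (- P * k12)) (Y lam)).
  { intros lam. destruct (hPhi lam) as [h1 [h2 h3]].
    pose proof (interlace_csol P q a a p r lam _ _ hP hqP ltac:(lra) h1) as h.
    rewrite h2, h3, <- RtoC_mult in h. exact h. }
  assert (hE : forall z, is_eigenvalue q a p r k11 k12 k21 k22 z <->
            (RtoC k21 * fst (Phi z) a + RtoC k22 * snd (Phi z) (a * / q)%R)%C = RtoC 0).
  { intros z. apply (eigenvalue_iff_zero P q a p r k11 k12 k21 k22
       (fun x l => fst (Phi l) x) (fun x l => snd (Phi l) x)); assumption. }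
  assert (hE0 : k21 = 0 -> forall z, is_eigenvalue q a p r k11 k12 k21 k22 z <-> Y z 0%nat = RtoC 0).
  { intros h21 z. rewrite hE. unfold Y. change 0%nat with (2 * 0)%nat. rewrite interlace_even.
    replace (/ q * (a * q ^ 0)) with (a * / q) by (simpl; ring). simpl ((-1) ^ 0).
    assert (h22 : RtoC k22 <> RtoC 0) by (apply RtoC_neq_0; tauto).
    rewrite h21. split; intros h.
    - destruct (classic (snd (Phi z) (a * / q)%R = RtoC 0)) as [h'|h']; [rewrite h'; ring|].
      exfalso. apply (Cmult_neq_0 _ _ h22 h'). rewrite <- h. ring.
    - rewrite Cmult_1_l in h. rewrite h. ring. }
  assert (hE1 : k22 = 0 -> forall z, is_eigenvalue q a p r k11 k12 k21 k22 z <-> Y z 1%nat = RtoC 0).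
  { intros h22 z. rewrite hE. unfold Y. change 1%nat with (2 * 0 + 1)%nat. rewrite interlace_odd.
    replace (a * q ^ 0) with a by (simpl; ring).
    assert (h21 : RtoC k21 <> RtoC 0) by (apply RtoC_neq_0; tauto).
    assert (hPm : RtoC (- (-1) ^ 0 * P) <> RtoC 0) by (apply RtoC_neq_0; simpl; lra).
    rewrite h22. split; intros h.
    - destruct (classic (fst (Phi z) a = RtoC 0)) as [h'|h']; [rewrite h'; ring|].
      exfalso. apply (Cmult_neq_0 _ _ h21 h'). rewrite <- h. ring.
    - destruct (classic (fst (Phi z) a = RtoC 0)) as [h'|h']; [rewrite h'; ring|].
      exfalso. exact (Cmult_neq_0 _ _ hPm h' h). }
  assert (heps1 : forall n, P ^ (4 * n) <= / q * Rpower q (INR (S n))).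
  { intros n. rewrite Rpower_pow by lra. right. rewrite pow_mult, <- hqP. simpl. field. lra. }
  assert (heps2 : forall n, P ^ (4 * n) <= / q * Rpower q (INR (S n) / 2)).
  { intros n. eapply Rle_trans; [apply heps1|].
    apply Rmult_le_compat_l; [left; apply Rinv_0_lt_compat; lra|].
    unfold Rpower. apply exp_le.
    assert (ln q < 0) by (rewrite <- ln_1; apply ln_increasing; lra).
    pose proof (pos_INR (S n)). nra. }
  assert (hpw : forall k, P ^ k <> 0) by (intros; apply pow_nonzero; lra).
  (* Both sides are powers of P over a (1 - q): y is the exponent of q in the
     asymptotic relation, and J = 1 when the first term is dropped. *)
  assert (hmu : forall (y : R) (k n o J : nat), 4 * y = - INR k ->
            (k + 2 = 2 * (2 * n + 1 + o) + 2 * J)%nat ->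
            Rpower q y / (a * (1 - q)) = mu P (b * (P ^ 2) ^ J) o n).
  { intros y k n o J hy hkn. rewrite (Rpower_quarter P q y k hP hqP hy).
    unfold mu, b, scale.
    assert (hk : P ^ k * (P * P) = P ^ (2 * (2 * n + 1 + o)) * (P ^ 2) ^ J).
    { rewrite <- pow_mult, <- pow_add, <- hkn, pow_add. ring. }
    replace (P ^ (2 * (2 * n + 1 + o)) * (a * (1 - q) / P * (P ^ 2) ^ J))
      with (P ^ (2 * (2 * n + 1 + o)) * (P ^ 2) ^ J * (a * (1 - q) / P)) by ring.
    rewrite <- hk. field. repeat split; try lra. apply hpw. }
  split.
  - intros h12 h11.
    assert (hrho : forall j, - / (P * k12) * (- k11 * chi j + - P * k12 * chi (j + 3)) = chi (j + 3)).
    { intros j. rewrite h11. field. split; [exact h12|lra]. }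
    assert (hrho0 : - / (P * k12) <> 0).
    { apply Ropp_neq_0_compat, Rinv_neq_0_compat, Rmult_integral_contrapositive. split; [lra|exact h12]. }
    assert (hk : - k11 <> 0 \/ - P * k12 <> 0).
    { right. apply Rmult_integral_contrapositive. split; [lra|exact h12]. }
    split; intros hk2x.
    + apply (asymptotics_of_zeros _ P b smax (/ q) _ _ _ s 3 1 0 Y _ _ hP hb hs hk hrho hrho0 hY (hE0 hk2x));
        [lia|reflexivity| |exact heps2].
      intros n. apply (hmu _ (4 * n + 2)%nat); [|lia].
      rewrite S_INR, plus_INR, mult_INR. simpl. lra.
    + apply (asymptotics_of_zeros _ P b smax (/ q) _ _ _ s 3 0 1 Y _ _ hP hb hs hk hrho hrho0 hY (hE1 hk2x));
        [lia|reflexivity| |exact heps1].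
      intros n. apply (hmu _ (4 * n + 2)%nat); [|lia].
      rewrite S_INR, plus_INR, mult_INR. simpl. lra.
  - intros h12 h11.
    assert (hrho : forall j, - / k11 * (- k11 * chi j + - P * k12 * chi (j + 3)) = chi (j + 0)).
    { intros j. rewrite h12, Nat.add_0_r. field. exact h11. }
    assert (hrho0 : - / k11 <> 0) by (apply Ropp_neq_0_compat, Rinv_neq_0_compat, h11).
    assert (hk : - k11 <> 0 \/ - P * k12 <> 0) by (left; lra).
    split; intros hk2x.
    + apply (asymptotics_of_zeros _ P b smax (/ q) _ _ _ s 0 0 0 Y _ _ hP hb hs hk hrho hrho0 hY (hE0 hk2x));
        [lia|reflexivity| |exact heps2].
      intros n. apply (hmu _ (4 * n)%nat); [|lia].
      rewrite S_INR, mult_INR. simpl. lra.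
    + apply (asymptotics_of_zeros _ P b smax (/ q) _ _ _ s 0 1 1 Y _ _ hP hb hs hk hrho hrho0 hY (hE1 hk2x));
        [lia|reflexivity| |exact heps1].
      intros n. apply (hmu _ (4 * n + 4)%nat); [|lia].
      rewrite S_INR, plus_INR, mult_INR. simpl. lra.
Qed.
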